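(* Assume $(k,\lambda_*,\beta_* )\in \{0\}\times[0,\infty)\times(0,2)\,\cup\, \mathbb{N}\times[0,\infty)\times(0,3/2)$, let $\{(\lambda_n,\beta_n)\}\subset(0,\infty)\times(0,2)$ with $(\lambda_n,\beta_n)\to(\lambda_*,\beta_* )$, and let $u_n\in S_{k,\lambda_n,\beta_n}$ with $u_n(0)>0$ for all $n\in\mathbb{N}$; if $k\neq0$ assume also that $\int_B|\nabla u_n|^2dx$ is uniformly bounded in $n$. Let $u_0$ be the weak limit of $(u_n)$ in $H_0^1(B)$ (up to a subsequence) and let $r_{i,n},u_{i,n},\rho_{i,n},\mu_{i,n}$ and Cases (i), (ii) be as described in the context. Suppose (for the subsequence under consideration) that Case (i) or Case (ii) occurs. First suppose Case (i) occurs. Then $(\beta_n)\subset(0,1]$ yields $k=0$. Moreover, for $k\in\{0\}\cup\mathbb{N}$, \[ \lim_{n\to\infty}\frac{\log\frac1{\lambda_n}}{\mu_{k+1,n}^{\beta_n}}=\alpha\Big(1-\frac{\beta_*}2\Big), \] and if $k\ge1$, for all $1\le i\le k$, \[ \lim_{n\to\infty}\frac{\log\frac1{\lambda_n}}{\mu_{i,n}^{\beta_n(\beta_n-1)^{k-i+1}}}=\Big\{\alpha\Big(1-\frac{\beta_*}2\Big)\Big\}^{\frac{2-\beta_*(\beta_*-1)^{k-i+1}}{2-\beta_*}}. \] Furthermore, for $k\in\{0\}\cup\mathbb{N}$, \[ \lim_{n\to\infty}\Big(\log\frac1{\lambda_n}\Big)^{\frac1{\beta_n}}|u_{k+1,n}'(1)|=2\Big\{\alpha\Big(1-\frac{\beta_*}2\Big)\Big\}^{\frac1{\beta_*}},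 \] and if $k\ge1$, for all $1\le i\le k$, \[ \lim_{n\to\infty}\frac{\log\frac1{\lambda_n}}{\big(\log\frac1{r_{i,n}}\big)^{(\beta_n-1)^{k-i+1}}}=\lim_{n\to\infty}\frac{\log\frac1{\lambda_n}}{\big(\log|u_{i,n}'(r_{i,n})|\big)^{(\beta_n-1)^{k-i+1}}}=2^{(\beta_*-1)^{k-i+1}}\Big\{\alpha\Big(1-\frac{\beta_*}2\Big)\Big\}^{\frac{2-2(\beta_*-1)^{k-i+1}}{2-\beta_*}}. \] If $k\ge2$, for all $i=2,\dots,k$, \[ \lim_{n\to\infty}\frac{\log\frac1{\lambda_n}}{\big(\log\frac1{\rho_{i,n}}\big)^{\frac{\beta_n(\beta_n-1)^{k-i+1}}2}}=2^{\frac{\beta_*(\beta_*-1)^{k-i+1}}2}\Big\{\alpha\Big(1-\frac{\beta_*}2\Big)\Big\}^{\frac{2-\beta_*(\beta_*-1)^{k-i+1}}{2-\beta_*}}. \] Lastly, suppose $k\ge1$. If there is a number $L\ge0$ such that \[ \lim_{n\to\infty}\frac{\log\log\frac1{\lambda_n}}{(\beta_n-1)\big(\log\frac1{\lambda_n}\big)^{2/\beta_n}}=L, \] then \[ \lim_{n\to\infty}\frac{\log\frac1{\lambda_n}}{\big(\log\frac1{\rho_{k+1,n}}\big)^{\beta_n/2}}=2^{\frac{\beta_*}2}\alpha\Big(1-\frac{\beta_*}2\Big)\Big[1+L\Big\{\alpha\Big(1-\frac{\beta_*}2\Big)\Big\}^{\frac2{\beta_*}}\Big]^{-\frac{\beta_*}2};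 \] and if instead \[ \lim_{n\to\infty}\frac{\log\log\frac1{\lambda_n}}{(\beta_n-1)\big(\log\frac1{\lambda_n}\big)^{2/\beta_n}}=\infty, \] then necessarily $\beta_*=1$ and \[ \lim_{n\to\infty}\frac{\log\log\frac1{\lambda_n}}{(\beta_n-1)\log\frac1{\rho_{k+1,n}}}=2. \] Next suppose Case (ii) occurs, with its number $N$ ($1\le N\le k$). Then $\beta_*\le1$, and $(\beta_n)\subset(0,1]$ implies $N=1$. Moreover, one of (a), (b) is true. (a) $\mu_{N+1}>0$, $\beta_*=1$, and for all $1\le i\le N$, \[ \lim_{n\to\infty}\mu_{i,n}^{(\beta_n-1)^{N-i+1}}=\lim_{n\to\infty}\Big(\log\frac1{r_{i,n}}\Big)^{(\beta_n-1)^{N-i+1}}=\lim_{n\to\infty}\big(\log|u_{i,n}'(r_{i,n})|\big)^{(\beta_n-1)^{N-i+1}}=\frac{2\mu_{N+1}}\alpha, \] and \[ \lim_{n\to\infty}u_{N+1,n}'(r_{N+1,n})=-\frac1{r_{N+1}}\lambda_*\int_0^{r_{N+1}}f_*(u_0)r\,dr,\qquad \lim_{n\to\infty}\rho_{N+1,n}^{\beta_n-1}=\sqrt{\frac{\alpha}{2\mu_{N+1}}}, \] where $f_*(t)=te^{t^2+\alpha|t|}$. Especially, $2\mu_{N+1}/\alpha>1$ (resp. $\in(0,1)$) implies $\beta_n>1$ (resp. $\beta_n<1$) for all sufficiently large $n$. On the other hand, $\beta_n>1$ (resp. $=1$, $<1$) for all $n$ requires $2\mu_{N+1}/\alpha\ge1$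 (resp. $=1$, $\le1$). Finally, if $1<N\le k$ (which yields $k\ge2$, $\beta_n>1$ for all sufficiently large $n$, and $2\mu_{N+1}/\alpha\ge1$), then, assuming $2\mu_{N+1}/\alpha>1$, for all $2\le i\le N$, \[ \lim_{n\to\infty}\Big(\log\frac1{\rho_{i,n}}\Big)^{(\beta_n-1)^{N-i+1}}=\Big(\frac{2\mu_{N+1}}\alpha\Big)^2. \] (b) $\mu_i=0$ for all $i=N+1,\dots,k+1$ and $\beta_n<1$ for all sufficiently large $n$.
   Context: $B\subset\mathbb{R}^2$ is the open unit ball centered at the origin, $\alpha>0$ is fixed, $\mathbb{N}=\{1,2,\dots\}$. For $(\lambda,\beta)\in(0,\infty)\times(0,2)$ consider \[ -\Delta u=\lambda ue^{u^2+\alpha|u|^\beta}\ \text{in }B,\qquad u=0\ \text{on }\partial B. \qquad (P_{\lambda,\beta}) \] For $k\in\{0\}\cup\mathbb{N}$, $S_{k,\lambda,\beta}$ is the set of radial solutions $u\in C^2(B)\cap C^0(\overline{B})$ of $(P_{\lambda,\beta})$ for which there are numbers $0=r_0<r_1<\dots<r_{k+1}=1$ such that, for all $1\le i\le k+1$, $u(x)=0$ if $|x|=r_i$ and $\mathrm{sgn}(u(0))(-1)^{i-1}u>0$ on $\{r_{i-1}<|x|<r_i\}$. Functions are regarded as functions of $r=|x|\in[0,1]$. $f_n(t)=te^{t^2+\alpha|t|^{\beta_n}}$; $0=r_{0,n}<r_{1,n}<\dots<r_{k+1,n}=1$ are such that for $1\le i\le k+1$, $u_n(r_{i,n})=0$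 and $(-1)^{i-1}u_n(r)>0$ for $r_{i-1,n}<r<r_{i,n}$; $u_{i,n}=u_n|_{[r_{i-1,n},r_{i,n}]}$; $\rho_{i,n}\in[r_{i-1,n},r_{i,n})$ and $\mu_{i,n}>0$ satisfy $\mu_{i,n}=|u_{i,n}(\rho_{i,n})|=\max_{[r_{i-1,n},r_{i,n}]}|u_{i,n}|$. When $\mu_{i,n}\to\infty$, $\gamma_{i,n}>0$ is defined by $1=2\lambda_n\mu_{i,n}f_n(\mu_{i,n})\gamma_{i,n}^2$ and $z_{i,n}(r)=2\mu_{i,n}(|u_{i,n}(\gamma_{i,n}r+\rho_{i,n})|-\mu_{i,n})$ for $r\in[(r_{i-1,n}-\rho_{i,n})/\gamma_{i,n},(r_{i,n}-\rho_{i,n})/\gamma_{i,n}]$; $z(r)=\log\frac{64}{(8+r^2)^2}$. $\Lambda_j=t_j^2$, $\varphi_j(r)=J_0(t_jr)$ with $0<t_1<t_2<\cdots$ the positive zeros of the Bessel function $J_0$. For an index $i$ let $(E_i)$ denote: $\mu_{i,n}\to\infty$, $\gamma_{i,n}\to0$, $z_{i,n}\to z$ in $C^2_{\mathrm{loc}}((0,\infty))\cap C^1_{\mathrm{loc}}([0,\infty))$, and both $\int_{r_{i-1,n}}^{r_{i,n}}u_{i,n}'(r)^2r\,dr$ and $\mu_{i,n}\int_{r_{i-1,n}}^{r_{i,n}}\lambda_nf_n(|u_{i,n}|)r\,dr$ equal $2-\alpha\beta_*\mu_{i,n}^{-(2-\beta_n)}+o(\mu_{i,n}^{-(2-\beta_n)})$.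 Case (i): $\max_{[0,1]}|u_n|\to\infty$, $(E_i)$ holds for all $i=1,\dots,k+1$, $\rho_{k+1,n}\to0$, $\lambda_*=0$, and $u_n\to u_0=0$ in $C^2_{\mathrm{loc}}((0,1])$. Case (ii): $\max_{[0,1]}|u_n|\to\infty$ and there is $N\in\{1,\dots,k\}$ such that for $i=1,\dots,N$, $(E_i)$ holds and $r_{i,n}\to0$, while for $i=N+1,\dots,k+1$ there are $\mu_i\ge0$, $r_i\in(0,1]$, $\rho_i\in[0,1)$ with $\mu_{i,n}\to\mu_i$, $r_{i,n}\to r_i$, $\rho_{i,n}\to\rho_i$, $0=\rho_{N+1}<r_{N+1}<\dots<\rho_{k+1}<r_{k+1}=1$ (if $N=k$: $0=\rho_{k+1}<r_{k+1}=1$); $\lambda_*\ne0$, $u_n|_{[r_{N,n},1]}\to u_0$ in $C^2_{\mathrm{loc}}((0,1])$, $\lim_{r\to0+}(-1)^Nu_0(r)=\mu_{N+1}$, $\int_{r_{N,n}}^1u_n'(r)^2r\,dr\to\int_0^1u_0'(r)^2r\,dr$; and, with $r_N:=0$, either $\mu_{N+1}>0$, $u_0(r_i)=0$ and $(-1)^{i-1}u_0>0$ on $(r_{i-1},r_i)$ for all $i=N+1,\dots,k+1$, or $\mu_{N+1}=0$, $u_0=0$, $u_n|_{[r_{N,n},1]}/\mu_{N+1,n}\to(-1)^N\varphi_{k-N+1}$ in $C^2_{\mathrm{loc}}((0,1])$ and $\lambda_*=\Lambda_{k-N+1}$. *)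

(* Defs.v *)
From HB Require Import structures.
From mathcomp Require Import all_boot all_order all_algebra.
From mathcomp Require Import all_classical all_reals all_analysis.
Set Implicit Arguments.
Unset Strict Implicit.
Unset Printing Implicit Defensive.
Import Order.TTheory GRing.Theory Num.Theory.
Import numFieldNormedType.Exports.
Local Open Scope classical_set_scope.
Local Open Scope ring_scope.

(* The norm that the library puts on the product [R * R] is the maximum norm
   (same topology), hence the explicit Euclidean norm. *)
Definition enorm (R : realType) (x : R * R) : R :=
  Num.sqrt (x.1 ^+ 2 + x.2 ^+ 2).

Definition disk (R : realType) : set (R * R) := [set x | enorm x < 1].
Definition cdisk (R : realType) : set (R * R) := [set x | enorm x <= 1].

Definition leb2 (R : realType) :=
  ((@lebesgue_measure R) \x (@lebesgue_measure R))%E.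

Definition evec (R : realType) (b : bool) : R * R :=
  if b then (0, 1) else (1, 0).

Definition partial (R : realType) (b : bool) (U : R * R -> R) : R * R -> R :=
  fun x => 'D_(evec R b) U x.

Definition laplacian (R : realType) (U : R * R -> R) (x : R * R) : R :=
  partial false (partial false U) x + partial true (partial true U) x.

Definition grad_sq (R : realType) (U : R * R -> R) (x : R * R) : R :=
  (partial false U x) ^+ 2 + (partial true U x) ^+ 2.

(* [U] is of class C^2 on the open set [A]. *)
Definition C2_on (R : realType) (A : set (R * R)) (U : R * R -> R) : Prop :=
  forall x, A x ->
    {for x, continuous U} /\
    forall b, derivable U x (evec R b) /\ {for x, continuous (partial b U)} /\
    forall c, derivable (partial b U) x (evec R c) /\
      {for x, continuous (partial c (partial b U))}.

(* The function on the plane with radial profile [v]. *)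
Definition planar (R : realType) (v : R -> R) : R * R -> R :=
  fun x => v (enorm x).

Definition nonlin (R : realType) (alpha bet t : R) : R :=
  t * expR (t ^+ 2 + alpha * `|t| `^ bet).

(* The set S_{k,lambda,beta}. Only the values of [U] on the closed unit disk
   matter. *)
Definition nodal_sol (R : realType) (alpha : R) (k : nat) (lam bet : R)
    (U : R * R -> R) : Prop :=
  [/\ forall x y, cdisk x -> enorm x = enorm y -> U x = U y,
      C2_on (@disk R) U,
      {within @cdisk R, continuous U},
      forall x, disk x -> - laplacian U x = lam * nonlin alpha bet (U x) &
      (forall x, enorm x = 1 -> U x = 0) /\
      exists r : nat -> R,
        [/\ r 0%N = 0, r k.+1 = 1,
            forall i, (i <= k)%N -> r i < r i.+1 &
            forall i, (1 <= i <= k.+1)%N ->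
              (forall x, enorm x = r i -> U x = 0) /\
              (forall x, r i.-1 < enorm x < r i ->
                 0 < Num.sg (U 0) * (-1) ^+ i.-1 * U x)]].

Definition smooth (R : realType) (phi : R * R -> R) : Prop :=
  forall (s : seq bool) x, differentiable (foldr (@partial R) phi s) x.

Definition test_fun (R : realType) (phi : R * R -> R) : Prop :=
  smooth phi /\
  exists K : set (R * R),
    [/\ compact K, K `<=` @disk R & forall x, ~ K x -> phi x = 0].

Definition L2_disk (R : realType) (g : R * R -> R) : Prop :=
  measurable_fun (@disk R) g /\
  (\int[@leb2 R]_(x in @disk R) ((g x) ^+ 2)%:E < +oo)%E.

(* [U] belongs to H^1_0 of the unit disk (the closure of the test functions in
   H^1) and its weak partial derivatives are [G false] and [G true]. *)
Definition in_H10 (R : realType) (U : R * R -> R) (G : bool -> R * R -> R)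
    : Prop :=
  [/\ L2_disk U, forall b, L2_disk (G b) &
      exists phi : nat -> R * R -> R,
        [/\ forall m, test_fun (phi m),
            (fun m => \int[@leb2 R]_(x in @disk R) ((phi m x - U x) ^+ 2)%:E)%E
              @ \oo --> 0%E &
            forall b,
            (fun m => \int[@leb2 R]_(x in @disk R)
                        ((partial b (phi m) x - G b x) ^+ 2)%:E)%E
              @ \oo --> 0%E]].

Definition H10_dot (R : realType) (G H : bool -> R * R -> R) : R :=
  Rintegral (@leb2 R) (@disk R)
    (fun x => G false x * H false x + G true x * H true x).

(* Weak convergence in the Hilbert space H^1_0 with the Dirichlet inner product;
   by Riesz every continuous functional is an inner product. *)
Definition weak_cvg_H10 (R : realType) (Un : nat -> R * R -> R)
    (U : R * R -> R) : Prop :=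
  exists (Gn : nat -> bool -> R * R -> R) (G : bool -> R * R -> R),
    [/\ forall n, in_H10 (Un n) (Gn n), in_H10 U G &
        forall V H, in_H10 V H ->
          (fun n => H10_dot (Gn n) H) @ \oo --> H10_dot G H].

(* Derivative of the restriction of [f] to [D]; one-sided at an endpoint of an
   interval. *)
Definition derivable_in (R : realType) (D : set R) (f : R -> R) (x : R) : Prop :=
  cvg ((fun y => (f y - f x) / (y - x)) @ within D x^').

Definition derive_in (R : realType) (D : set R) (f : R -> R) (x : R) : R :=
  lim ((fun y => (f y - f x) / (y - x)) @ within D x^').

(* The restriction of [f] to [D] is of class C^m at all points of [K]. *)
Definition C_in (R : realType) (m : nat) (D : set R) (f : R -> R) (K : set R)
    : Prop :=
  forall x, K x ->
    (forall j, (j < m)%N -> derivable_in D (iter j (derive_in D) f) x) /\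
    (forall j, (j <= m)%N ->
       iter j (derive_in D) f @ within D (nbhs x) --> iter j (derive_in D) f x).

(* f_n -> f in C^m_loc(J), where f_n is a function on D_n and D_n eventually
   contains any given compact subinterval of the interval J. *)
Definition cvg_Cloc (R : realType) (m : nat) (J : set R) (D : nat -> set R)
    (fn : nat -> R -> R) (f : R -> R) : Prop :=
  C_in m J f J /\
  forall a b : R, `[a, b] `<=` J ->
    (\forall n \near \oo, `[a, b] `<=` D n /\ C_in m (D n) (fn n) `[a, b]) /\
    forall j, (j <= m)%N ->
      {uniform `[a, b], (fun n => iter j (derive_in (D n)) (fn n)) @ \oo -->
                        iter j (derive_in J) f}.

(* int_a^b v'(r)^2 r dr for the restriction of [v] to [a, b]. *)
Definition dirichlet (R : realType) (v : R -> R) (a b : R) : R :=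
  Rintegral (@lebesgue_measure R) `[a, b]
    (fun r => (derive_in `[a, b] v r) ^+ 2 * r).

Definition zlim (R : realType) (r : R) : R := ln (64 / (8 + r ^+ 2) ^+ 2).

Definition J0 (R : realType) (x : R) : R :=
  lim (series (fun m => (-1) ^+ m / (m`!%:R) ^+ 2 * (x / 2) ^+ (2 * m)%N) @ \oo).

(* 0 < t 1 < t 2 < ... are the positive zeros of J0; [t 0] is unused. *)
Definition J0_zeros (R : realType) (t : nat -> R) : Prop :=
  [/\ 0 < t 1%N, forall j, (1 <= j)%N -> t j < t j.+1 &
      forall x, 0 < x -> (J0 x = 0 <-> exists2 j, (1 <= j)%N & x = t j)].

(* Below, doubly indexed quantities [r i n], [rho i n], [mu i n], [gam i n] have
   first index i (node or nodal interval) and second index n (sequence). *)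
Definition nodal_data (R : realType) (alpha : R) (k : nat) (lam bet : nat -> R)
    (u : nat -> R -> R) (r rho mu gam : nat -> nat -> R) : Prop :=
  forall n,
    [/\ r 0%N n = 0, r k.+1 n = 1,
        forall i, (i <= k)%N -> r i n < r i.+1 n &
        forall i, (1 <= i <= k.+1)%N ->
          [/\ u n (r i n) = 0,
              forall s, r i.-1 n < s < r i n -> 0 < (-1) ^+ i.-1 * u n s,
              r i.-1 n <= rho i n < r i n,
              0 < mu i n /\ mu i n = `|u n (rho i n)| /\
              (forall s, r i.-1 n <= s <= r i n -> `|u n s| <= mu i n) &
              0 < gam i n /\
              1 = 2 * lam n * mu i n * nonlin alpha (bet n) (mu i n)
                    * gam i n ^+ 2]].

Definition rescaled (R : realType) (v : R -> R) (rho mu gam s : R) : R :=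
  2 * mu * (`|v (gam * s + rho)| - mu).

(* A_n = 2 - alpha * bets * mu_n^{-(2-beta_n)} + o(mu_n^{-(2-beta_n)}) *)
Definition energy_expansion (R : realType) (alpha bets : R)
    (bet mu A : nat -> R) : Prop :=
  (fun n => (A n - (2 - alpha * bets * mu n `^ (- (2 - bet n))))
              / mu n `^ (- (2 - bet n))) @ \oo --> (0 : R).

Definition condE (R : realType) (alpha bets : R) (lam bet : nat -> R)
    (u : nat -> R -> R) (r rho mu gam : nat -> nat -> R) (i : nat) : Prop :=
  let D n : set R := `[(r i.-1 n - rho i n) / gam i n, (r i n - rho i n) / gam i n]%classic in
  let z n := rescaled (u n) (rho i n) (mu i n) (gam i n) in
  [/\ mu i @ \oo --> +oo,
      gam i @ \oo --> (0 : R),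
      cvg_Cloc 2 `]0, +oo[ D z (@zlim R) /\
      cvg_Cloc 1 `[0, +oo[ D z (@zlim R),
      energy_expansion alpha bets bet (mu i)
        (fun n => dirichlet (u n) (r i.-1 n) (r i n)) &
      energy_expansion alpha bets bet (mu i)
        (fun n => mu i n * Rintegral (@lebesgue_measure R)
           `[r i.-1 n, r i n]
           (fun s => lam n * nonlin alpha (bet n) `|u n s| * s))].

Definition max_blowup (R : realType) (u : nat -> R -> R) : Prop :=
  (fun n => sup [set `|u n s| | s in `[0, 1]]) @ \oo --> +oo.

Definition case_i (R : realType) (alpha : R) (k : nat) (lams bets : R)
    (lam bet : nat -> R) (u : nat -> R -> R) (u0 : R -> R)
    (r rho mu gam : nat -> nat -> R) : Prop :=
  [/\ max_blowup u,
      forall i, (1 <= i <= k.+1)%N -> condE alpha bets lam bet u r rho mu gam i,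
      rho k.+1 @ \oo --> (0 : R),
      lams = 0 &
      cvg_Cloc 2 `]0, 1] (fun=> `[0, 1]%classic) u u0 /\
      (forall s, 0 < s <= 1 -> u0 s = 0)].

(* [mui], [ri], [rhoi] are the limits of [mu i], [r i], [rho i] for i > N, and
   [ri N] is the conventional value r_N := 0. *)
Definition case_ii (R : realType) (alpha : R) (k : nat) (lams bets : R)
    (lam bet : nat -> R) (u : nat -> R -> R) (u0 : R -> R)
    (r rho mu gam : nat -> nat -> R) (t : nat -> R)
    (N : nat) (mui ri rhoi : nat -> R) : Prop :=
  [/\ max_blowup u /\ (1 <= N <= k)%N,
      forall i, (1 <= i <= N)%N ->
        condE alpha bets lam bet u r rho mu gam i /\ r i @ \oo --> (0 : R),
      (forall i, (N.+1 <= i <= k.+1)%N ->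
         [/\ 0 <= mui i, 0 < ri i <= 1, 0 <= rhoi i < 1 &
             [/\ mu i @ \oo --> mui i, r i @ \oo --> ri i &
                 rho i @ \oo --> rhoi i]]) /\
      [/\ rhoi N.+1 = 0, ri N = 0, ri k.+1 = 1,
          forall i, (N.+1 <= i <= k.+1)%N -> rhoi i < ri i &
          forall i, (N.+1 <= i <= k)%N -> ri i < rhoi i.+1],
      [/\ lams <> 0,
          cvg_Cloc 2 `]0, 1] (fun n => `[r N n, 1]%classic) u u0,
          (fun s => (-1) ^+ N * u0 s) @ 0^'+ --> mui N.+1 &
          (fun n => dirichlet (u n) (r N n) 1) @ \oo -->
            Rintegral (@lebesgue_measure R) `]0, 1]
              (fun s => (derive_in `]0, 1] u0 s) ^+ 2 * s)] &
      (0 < mui N.+1 /\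
       forall i, (N.+1 <= i <= k.+1)%N ->
         u0 (ri i) = 0 /\
         forall s, ri i.-1 < s < ri i -> 0 < (-1) ^+ i.-1 * u0 s)
      \/
      [/\ mui N.+1 = 0,
          forall s, 0 < s <= 1 -> u0 s = 0,
          cvg_Cloc 2 `]0, 1] (fun n => `[r N n, 1]%classic)
            (fun n s => u n s / mu N.+1 n)
            (fun s => (-1) ^+ N * J0 (t (k - N + 1)%N * s)) &
          lams = t (k - N + 1)%N ^+ 2]].

(* Main.v *)
Require Import Defs.
From HB Require Import structures.
From mathcomp Require Import all_boot all_order all_algebra.
From mathcomp Require Import all_classical all_reals all_analysis.
From mathcomp Require Import measurable_realfun ring lra.
Set Implicit Arguments.
Unset Strict Implicit.
Unset Printing Implicit Defensive.
Import Order.TTheory GRing.Theory Num.Theory.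
Import numFieldNormedType.Exports.
Local Open Scope classical_set_scope.
Local Open Scope ring_scope.

(** Why the asymptotics hold.  The flux [P r = - r * u'(r)] of a radial solution
    satisfies [P' = lambda f(u) r].  On the [i]-th nodal interval, [w = |u|] and
    the signed flux [Q] form an [arc]: [Q] increases and vanishes at the maximum
    point [rho_i], so [w] is a logarithm of slope [Q] wherever little mass
    remains.  The quantities that matter are the height [mu_i] and the outflux
    [M_i], the value of [Q] at the outer node [r_i].  Put
    [A = alpha (1 - beta_* / 2)].

    One bubble.  For an interval that blows up, the difference between [mu] times
    the mass and the Dirichlet integral is the integral of [mu - w] against [dQ];
    the two energy expansions say that it is [o(mu^(beta-2))].  It is at least
    [Q(s) (M log (b/s) - w(s))] for every [s] right of the maximum point
    ([arc_energy_gap]), and at [s = rho + gamma] the factor [Q(s)] is at least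
    [1 / (8 mu)].  Hence [w] is a logarithm outside the core, up to an error
    [o(mu^(beta-1))].  The mass expansion gives [mu M] to second order provided
    that the influx is negligible, and the definition of [gamma] gives
    [log (1/gamma)] in terms of [mu] and [lambda].  Together:
    [mu M --> 2] and [(log (1/lambda) + 2 log (1/b)) / mu^beta --> A]
    ([bubble_flux], [bubble_log]).

    Necks.  From the node [r_j] to the next maximum point the flux is [- M_j] up
    to [lambda f(mu_(j+1)) rho_(j+1)^2], so that
    [mu_(j+1) = M_j log (rho_(j+1) / r_j)] to leading order, and the mass gained
    there must cancel [M_j], which locates [rho_(j+1)] ([arc_left_log],
    [arc_left_flux_le], [arc_left_flux_ge]).  A first, crude consequence is
    [mu_(j+1) <= C mu_j^(beta-1)] ([neck_upper]).  It forces [beta_n > 1] as soon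
    as two consecutive intervals blow up, and it makes the influx into the second
    one negligible ([neck_left_small]); thus the analysis of one bubble
    propagates from the centre outwards ([all_bubbled]).  The sharp form is
    [mu_(j+1) / mu_j^(beta-1) --> A] together with
    [2 log (1/rho_(j+1)) - log mu_j ~ mu_(j+1)^2]
    ([neck_rec_bubble], [neck_rho_asym]).

    Conclusion.  In terms of [X_i = log mu_i] these relations are linear up to
    convergent errors: [X_(j+1) - (beta-1) X_j --> log A] and
    [log log (1/r_i) - beta X_i --> log (A/2)].  When [lambda_n] vanishes, the
    last node is [1], so that [log (1/lambda) ~ A mu_(k+1)^beta], and each limit
    is a linear combination of these relations.  When a nonzero [lambda_*]
    remains, the [N]-th bubble feeds an interval of bounded height, where the
    neck relation becomes [mu_(N+1) / mu_N^(beta-1) --> A] with a convergent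
    numerator ([residual_neck]).  A positive limit of [mu_(N+1)] fixes the limit
    of [(beta_n - 1) log mu_N], whence [beta_* = 1] and all the other limits; a
    zero limit forces [beta_n < 1].  The slope at [r_(N+1)] is the limit of the
    integrated equation, by dominated convergence. *)

(** * Primitives on a closed interval *)

(** Nothing is asked of [f] at the end points: the slope [- P s / s] of a radial
    function is only meaningful for [s > 0], while the interval may start at the
    centre. *)
Definition prim (R : realType) (a b : R) (F f : R -> R) : Prop :=
  {within `[a, b], continuous F} /\
  forall x, a < x < b -> is_derive x 1 F (f x).

Lemma prim_sub (R : realType) (a b c d : R) (F f : R -> R) :
  a <= c -> d <= b -> prim a b F f -> prim c d F f.
Proof.
move=> ac db [cF dF]; split.
  by apply: continuous_subspaceW cF; apply: subset_itv; rewrite bnd_simp.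
by move=> x /andP[cx xd]; apply: dF; rewrite (le_lt_trans ac) ?(lt_le_trans xd).
Qed.

Lemma prim_ext (R : realType) (a b : R) (F f g : R -> R) :
  (forall x, a < x < b -> f x = g x) -> prim a b F f -> prim a b F g.
Proof. by move=> fg [cF dF]; split=> // x /[dup] xab /fg <-; exact: dF. Qed.

Lemma prim_cst (R : realType) (a b c : R) : prim a b (fun=> c) (fun=> 0).
Proof.
split; first by apply: continuous_subspaceT => x; exact: cvg_cst.
by move=> x _; exact: is_derive_cst.
Qed.

Lemma prim_id (R : realType) (a b : R) : prim a b id (fun=> 1).
Proof.
split; first by apply: continuous_subspaceT => x; exact: cvg_id.
by move=> x _; exact: is_derive_id.
Qed.

Lemma primD (R : realType) (a b : R) (F G f g : R -> R) :
  prim a b F f -> prim a b G g ->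
  prim a b (fun x => F x + G x) (fun x => f x + g x).
Proof.
move=> [cF dF] [cG dG]; split.
  by move=> x; apply: cvgD; [exact: cF|exact: cG].
by move=> x xab; have := dF _ xab; have := dG _ xab => ? ?; exact: is_deriveD.
Qed.

Lemma primM (R : realType) (a b : R) (F G f g : R -> R) :
  prim a b F f -> prim a b G g ->
  prim a b (fun x => F x * G x) (fun x => f x * G x + F x * g x).
Proof.
move=> [cF dF] [cG dG]; split.
  by move=> x; apply: cvgM; [exact: cF|exact: cG].
move=> x xab; have := dF _ xab; have := dG _ xab => ? ?.
apply: is_derive_eq; rewrite /GRing.scale/= addrC; congr (_ + _).
exact: mulrC.
Qed.

Lemma primZ (R : realType) (a b c : R) (F f : R -> R) :
  prim a b F f -> prim a b (fun x => c * F x) (fun x => c * f x).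
Proof.
move=> pF; apply: prim_ext (primM (prim_cst a b c) pF) => x _.
by rewrite mul0r add0r.
Qed.

Lemma primB (R : realType) (a b : R) (F G f g : R -> R) :
  prim a b F f -> prim a b G g ->
  prim a b (fun x => F x - G x) (fun x => f x - g x).
Proof.
move=> pF pG; have := primD pF (primZ (-1) pG).
by under eq_fun do rewrite mulN1r; under [X in prim _ _ _ X]eq_fun do rewrite mulN1r.
Qed.

Lemma prim_ln (R : realType) (a b : R) : 0 < a -> prim a b (@ln R) (fun x => x^-1).
Proof.
move=> a0; split.
  apply: continuous_in_subspaceT => x; rewrite inE/= in_itv/= => /andP[ax _].
  by apply: continuous_ln; exact: lt_le_trans ax.
by move=> x /andP[ax _]; apply: is_derive1_ln; exact: lt_trans ax.
Qed.

Lemma prim_mono (R : realType) (a b : R) (F f : R -> R) :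
  prim a b F f -> (forall x, a < x < b -> 0 <= f x) ->
  forall x y, a <= x -> x <= y -> y <= b -> F x <= F y.
Proof.
move=> pF f0 x y ax xy yb.
have [cF dF] := prim_sub ax yb pF.
move: xy; rewrite le_eqVlt => /predU1P[->//|xy].
have dF' z : z \in `]x, y[ -> is_derive z 1 F (f z) by rewrite in_itv/=; exact: dF.
have [c] := MVT xy dF' cF.
rewrite in_itv/= => /andP[xc cy] FE; rewrite -subr_ge0 FE mulr_ge0 ?subr_ge0 ?(ltW xy)//.
by apply: f0; rewrite (le_lt_trans ax) ?(lt_le_trans cy).
Qed.

Lemma prim_le (R : realType) (a b : R) (F G f g : R -> R) :
  prim a b F f -> prim a b G g -> (forall x, a < x < b -> f x <= g x) ->
  forall x y, a <= x -> x <= y -> y <= b -> F y - F x <= G y - G x.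
Proof.
move=> pF pG fg x y ax xy yb.
have := @prim_mono _ _ _ _ _ (primB pG pF) _ _ _ ax xy yb => /=.
move=> H; have : G x - F x <= G y - F y by apply: H => z /fg; rewrite subr_ge0.
lra.
Qed.

(** * One-sided derivatives and existence of primitives *)

Lemma proper_within_left (R : realType) (a b x : R) : a < x -> x <= b ->
  ProperFilter (within `[a, b] x^').
Proof.
move=> ax xb; apply: Build_ProperFilter => -[].
rewrite /= => d /= d0; rewrite /within/= => H.
pose y := Num.max a (x - d / 2).
have yx : y < x by rewrite gt_max ax gtrBl divr_gt0.
apply: (H y) => /=; last 2 first.
- by rewrite lt_eqF.
- by rewrite in_itv/= le_max lexx/= (le_trans (ltW yx)).
rewrite /ball/= ger0_norm ?subr_ge0 ?(ltW yx)// ltrBlDl -ltrBlDr.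
rewrite lt_max; apply/orP; right; move: d0; lra.
Qed.

Lemma prim_derive_in (R : realType) (a b x : R) (F f : R -> R) :
  a < x < b -> prim a b F f -> derive_in `[a, b] F x = f x.
Proof.
move=> /[dup] xab /andP[ax xb] [_ /(_ _ xab) dF].
rewrite /derive_in.
have lP : (fun h => h^-1 *: ((F \o shift x) (h *: 1) - F x)) @ 0^' --> f x.
  have [dF1 dF2] := dF; rewrite -dF2; exact: dF1.
have nb := proper_within_left ax (ltW xb).
apply/cvg_lim => //; apply/cvgrPdist_le => e e0.
have /cvgrPdist_le/(_ _ e0) := lP.
rewrite !near_withinE => /nbhs_ballP[d /= d0 dP]; apply/nbhs_ballP; exists d => //= y.
rewrite /ball/= => xy yx _.
have := dP (y - x).
rewrite /ball/= sub0r normrN distrC; move=> /(_ xy); rewrite subr_eq0 => /(_ yx).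
by rewrite /= scaler1 subrK mulrC.
Qed.

(** By the mean value theorem a limit of the derivative is also the one-sided
    derivative at the end point. *)
Lemma prim_derive_in_right (R : realType) (a b l : R) (F f : R -> R) :
  a < b -> prim a b F f -> f @ b^'- --> l -> derive_in `[a, b] F b = l.
Proof.
move=> ab pF fl.
have nb := proper_within_left ab (lexx b).
apply/cvg_lim => //; apply/cvgrPdist_le => e e0.
have /cvgrPdist_le/(_ _ e0) := fl.
rewrite /at_left !near_withinE => /nbhs_ballP[d /= d0 dP]; apply/nbhs_ballP; exists d => //= y.
rewrite /ball/= => yd yb; rewrite in_itv/= => /andP[ay yb'].
have yb2 : y < b by rewrite lt_neqAle yb.
have [cF dF] := prim_sub ay (lexx b) pF.
have dF' z : z \in `]y, b[ -> is_derive z 1 F (f z) by rewrite in_itv/=; exact: dF.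
have [c] := MVT yb2 dF' cF; rewrite in_itv/= => /andP[yc cb] FE.
have -> : (F y - F b) / (y - b) = f c.
  have -> : F y - F b = f c * (y - b) by rewrite -opprB FE; ring.
  by rewrite mulfK// subr_eq0.
apply: dP => //=; rewrite /ball/= ger0_norm ?subr_ge0 ?(ltW cb)//.
rewrite ger0_norm ?subr_ge0// in yd.
by apply: le_lt_trans yd; rewrite lerD2l lerN2 ltW.
Qed.

Lemma exists_prim (R : realType) (a b : R) (h : R -> R) : a < b ->
  {within `[a, b], continuous h} ->
  exists H, prim a b H h /\ forall x y, a <= x -> x <= y -> y <= b ->
   Rintegral (@lebesgue_measure R) `[x, y] h = H y - H x.
Proof.
move=> ab ch.
have ih : (@lebesgue_measure R).-integrable `[a, b] (EFin \o h).
  by apply: continuous_compact_integrable => //; exact: segment_compact.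
pose H x := Rintegral (@lebesgue_measure R) `[a, x] h.
exists H; split.
  split; first exact: (parameterized_integral_continuous (ltW ab) ih).
  move=> x /andP[ax xb].
  have [] := @continuous_FTC1_closed R h a x b xb ih ax.
    by apply: (within_continuous_continuous ab ch); rewrite in_itv/= ax.
  by move=> dH <-; rewrite derive1E; apply/derivableP.
move=> x y ax xy yb; rewrite /H.
have iy : (@lebesgue_measure R).-integrable `[a, y] (EFin \o h).
  by apply: integrableS ih => //; apply: subset_itvl; rewrite bnd_simp.
rewrite -(@Rintegral_itv_obnd_cbnd R x).
  by rewrite -(@Rintegral_itvB R h (BLeft a) (BRight y) x iy) ?bnd_simp.
by apply: integrableS iy => //; apply: subset_itv; rewrite bnd_simp.
Qed.

(** * Flux comparison on one nodal interval *)

(** One nodal interval of a radial solution: [w] is the modulus of the solution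
    and [Q s = - s * w'(s)] its flux through the circle of radius [s].  The inner
    end is either a node or the centre of the disk.  All comparisons below are
    valid for an arbitrary nonnegative nondecreasing [f]. *)
Record arc (R : realType) (f : R -> R) (lam mu a rho b : R) (w Q : R -> R)
    : Prop := Arc {
  arc_lam : 0 < lam;
  arc_f0 : 0 <= f 0;
  arc_fmono : forall x y, 0 <= x -> x <= y -> f x <= f y;
  arc_a : 0 <= a;
  arc_rho : a <= rho < b;
  arc_w : prim a b w (fun s => - (Q s / s));
  arc_Q : prim a b Q (fun s => lam * f (w s) * s);
  arc_range : forall s, a <= s <= b -> 0 <= w s <= mu;
  arc_top : w rho = mu;
  arc_topQ : Q rho = 0;
  arc_start : 0 < a -> w a = 0;
  arc_start0 : a = 0 -> Q a = 0;
  arc_end : w b = 0 }.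

Section arc_estimates.
Context (R : realType) (f : R -> R) (lam mu a rho b : R) (w Q : R -> R).
Hypothesis H : arc f lam mu a rho b w Q.

Let f_ge0 x : 0 <= x -> 0 <= f x.
Proof. by move=> x0; apply: le_trans (arc_f0 H) _; exact: (arc_fmono H). Qed.

Let ab : a < b. Proof. by have /andP[] := arc_rho H; exact: le_lt_trans. Qed.
Let arho : a <= rho. Proof. by have /andP[] := arc_rho H. Qed.
Let rhob : rho < b. Proof. by have /andP[] := arc_rho H. Qed.
Let rho0 : 0 <= rho. Proof. exact: le_trans (arc_a H) arho. Qed.
Let lam0 := arc_lam H.
Let a0 := arc_a H.

Let w_ge0 s : a <= s -> s <= b -> 0 <= w s.
Proof. by move=> as_ sb; have /andP[] := @arc_range _ _ _ _ _ _ _ _ _ H s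
  ltac:(by rewrite as_ sb). Qed.
Let w_le s : a <= s -> s <= b -> w s <= mu.
Proof. by move=> as_ sb; have /andP[] := @arc_range _ _ _ _ _ _ _ _ _ H s
  ltac:(by rewrite as_ sb). Qed.

Lemma arc_Q_ndecr s t : a <= s -> s <= t -> t <= b -> Q s <= Q t.
Proof.
apply: (prim_mono (arc_Q H)) => x /andP[ax xb].
rewrite !mulr_ge0 ?(ltW lam0)// ?f_ge0 ?w_ge0 ?ltW//; exact: le_lt_trans ax.
Qed.

Lemma arc_Q_ge0 s : rho <= s -> s <= b -> 0 <= Q s.
Proof. by move=> rs sb; rewrite -(arc_topQ H) arc_Q_ndecr. Qed.

Lemma arc_Q_le0 s : a <= s -> s <= rho -> Q s <= 0.
Proof. by move=> rs sb; rewrite -(arc_topQ H) arc_Q_ndecr// ltW. Qed.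

Let wr : prim rho b w (fun s => - (Q s / s)).
Proof. exact: prim_sub (arc_w H). Qed.

Lemma arc_w_nincr s t : rho <= s -> s <= t -> t <= b -> w t <= w s.
Proof.
move=> rs st tb.
suff : - w s <= - w t by rewrite lerN2.
have := primZ (-1) wr => /prim_mono/(_ _ s t rs st tb); rewrite !mulN1r; apply.
move=> x /andP[rx xb]; rewrite mulN1r opprK divr_ge0 ?arc_Q_ge0 ?ltW//.
exact: le_lt_trans rx.
Qed.

(** The slope of [w] in the variable [ln s] never exceeds the final flux [Q b]. *)
Lemma arc_w_le_log s : rho <= s -> 0 < s -> s <= b -> w s <= Q b * ln (b / s).
Proof.
move=> rs s0 sb.
have b0 : 0 < b by exact: lt_le_trans sb.
have pw : prim s b (fun x => -1 * w x) (fun x => Q x / x).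
  apply: (@prim_ext _ _ _ _ (fun x => -1 * - (Q x / x))).
    by move=> x _; rewrite mulN1r opprK.
  exact/primZ/(prim_sub rs _ wr).
have := prim_le pw (primZ (Q b) (prim_ln b s0)) _ (lexx s) sb (lexx b).
rewrite (arc_end H) !mulN1r oppr0 add0r opprK => /(_ _)/le_trans; apply.
  move=> x /andP[sx xb]; rewrite ler_pM2r ?invr_gt0 ?(lt_trans s0)//.
  apply: arc_Q_ndecr; rewrite ?(ltW xb)//.
  by rewrite (le_trans _ (ltW sx))// (le_trans _ rs).
by rewrite -mulrBr ln_div.
Qed.

(** The right-hand side is the integral of [mu - w] against [dQ]: the boundary term
    [w a * Q a] vanishes because [a] is either the centre or a node.  Right of [s]
    the flux is at least [Q s], so that [mu - w x] is at least [Q s * ln (x / s)],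
    and integrating this by parts against [dQ] gives the left-hand side.  Thus a
    small energy gap forces [w] to be almost a logarithm of slope [Q b] from [s]
    on. *)
Lemma arc_energy_gap (E : R -> R) s : rho <= s -> 0 < s -> s <= b ->
  prim a b E (fun x => Q x ^+ 2 / x) ->
  Q s * (Q b * ln (b / s) - w s) <= mu * (Q b - Q a) - (E b - E a).
Proof.
move=> rs s0 sb pE.
have as_ : a <= s by exact: le_trans rs.
have b0 : 0 < b by exact: lt_le_trans sb.
pose K x := (mu - w x) * Q x - E x.
have pK : prim a b K (fun x => (mu - w x) * (lam * f (w x) * x)).
  have := primB (primM (primB (prim_cst a b mu) (arc_w H)) (arc_Q H)) pE.
  apply: prim_ext => x _; ring.
have Kpos x : a < x < b -> 0 <= lam * f (w x) * x.
  move=> /andP[ax xb]; rewrite !mulr_ge0 ?(ltW lam0)// ?f_ge0 ?w_ge0 ?(ltW ax) ?(ltW xb)//.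
  by apply: ltW; exact: le_lt_trans ax.
have K1 : K a <= K s.
  apply: (prim_mono pK) => // x /[dup] xab /andP[ax xb].
  by rewrite mulr_ge0 ?Kpos// subr_ge0 w_le ?ltW.
have gap x : s <= x -> x <= b -> Q s * ln (x / s) <= mu - w x.
  move=> sx xb.
  have x0 : 0 < x by exact: lt_le_trans sx.
  have pw : prim s b (fun x => -1 * w x) (fun x => Q x / x).
    apply: (@prim_ext _ _ _ _ (fun x => -1 * - (Q x / x))).
      by move=> z _; rewrite mulN1r opprK.
    exact/primZ/(prim_sub rs _ wr).
  have := prim_le (primZ (Q s) (prim_ln b s0)) pw _ (lexx s) sx xb.
  rewrite !mulN1r opprK -mulrBr -ln_div// => h.
  apply: (@le_trans _ _ (- w x + w s)).
    apply: h => z /andP[sz zb]; rewrite ler_pM2r ?invr_gt0 ?(lt_trans s0)//.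
    by apply: arc_Q_ndecr; rewrite ?(ltW sz)// ltW.
  by rewrite addrC lerD2r w_le.
(* Integration by parts of [Q s * ln (x / s)] against [dQ], using [w' = - Q / x]. *)
have pB : prim s b (fun x => Q s * (Q x * (ln x - ln s) + w x))
   (fun x => Q s * (ln x - ln s) * (lam * f (w x) * x)).
  have pQ := prim_sub as_ (lexx b) (arc_Q H).
  have pw := prim_sub as_ (lexx b) (arc_w H).
  have := primZ (Q s) (primD (primM pQ (primB (prim_ln b s0) (prim_cst s b (ln s)))) pw).
  by apply: prim_ext => x _; ring.
have := prim_le pB (prim_sub as_ (lexx b) pK) _ (lexx s) sb (lexx b).
rewrite subrr mulr0 add0r (arc_end H) addr0.
have -> : Q s * (Q b * (ln b - ln s)) - Q s * w s = Q s * (Q b * ln (b / s) - w s).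
  by rewrite ln_div//; ring.
move=> h; apply: (@le_trans _ _ (K b - K s)).
  apply: h => x /andP[sx xb].
  have xab : a < x < b by rewrite (le_lt_trans as_ sx).
  apply: ler_wpM2r; first exact: Kpos.
  by rewrite -ln_div ?posrE// ?(lt_trans s0)//; apply: gap; exact: ltW.
have Ka : K a = mu * Q a - E a.
  (* At the centre [Q a = 0], at a node [w a = 0]. *)
  rewrite /K; suff -> : (mu - w a) * Q a = mu * Q a by [].
  move: a0; rewrite le_eqVlt => /predU1P[/esym/(arc_start0 H)->|/(arc_start H)->].
    by rewrite !mulr0.
  by rewrite subr0.
have Kb : K b = mu * Q b - E b by rewrite /K (arc_end H) subr0.
by move: K1; rewrite Ka Kb; lra.
Qed.

(** Right of the maximum [w] decreases, so the mass between [rho] and [s] is at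
    least that of the constant density [lam * f (w t)]. *)
Lemma arc_Q_lower s t : rho <= s -> s <= t -> t <= b ->
  lam * f (w t) * ((s ^+ 2 - rho ^+ 2) / 2) <= Q s.
Proof.
move=> rs st tb.
have pq : prim rho s (fun x => (lam * f (w t) / 2) * (x * x))
    (fun x => lam * f (w t) * x).
  apply: prim_ext (primZ _ (primM (prim_id _ _) (prim_id _ _))) => x _.
  by rewrite /=; field.
have sb : s <= b by exact: le_trans tb.
have := prim_le pq (prim_sub arho sb (arc_Q H)) _ (lexx _) rs (lexx _).
rewrite (arc_topQ H) subr0 => h.
have -> : lam * f (w t) * ((s ^+ 2 - rho ^+ 2) / 2) =
   lam * f (w t) / 2 * (s * s) - lam * f (w t) / 2 * (rho * rho) by field.
apply: h => x /andP[rx xs].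
have xt : x <= t by rewrite (le_trans (ltW xs)).
apply: ler_wpM2r; first by rewrite (le_trans rho0) ?ltW.
rewrite ler_pM2l//; apply: (arc_fmono H).
  by apply: w_ge0 => //; rewrite (le_trans _ st) ?(le_trans _ rs).
by apply: arc_w_nincr => //; exact: ltW.
Qed.

(** If [rho] were [0], the disk of radius [t] around the maximum would lower [w]
    by [lam * f * t ^ 2 / 4]; a maximum at distance [rho >> t] from the centre is
    essentially one-dimensional and drops by [lam * f * t ^ 2 / 2].  The last
    factor interpolates between the two and is what detects the position of the
    maximum. *)
Lemma arc_drop t : 0 < t -> rho + t <= b ->
  lam * f (w (rho + t)) * (t ^+ 2 / 4) * (1 + rho / (rho + t)) <= mu - w (rho + t).
Proof.
move=> t0 tb.
set T := rho + t; set c := lam * f (w T).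
have rT : rho <= T by rewrite /T lerDl ltW.
have T0 : 0 < T by rewrite /T ltr_wpDl.
have c0 : 0 <= c by rewrite mulr_ge0 ?(ltW lam0)// f_ge0// w_ge0// (le_trans arho).
have pq : prim rho T (fun x => c * (1 + rho / T) / 4 * ((x - rho) * (x - rho)))
    (fun x => c * (1 + rho / T) * ((x - rho) / 2)).
  have pid := primB (prim_id rho T) (prim_cst rho T rho).
  apply: prim_ext (primZ _ (primM pid pid)) => x _ /=.
  by field; exact: lt0r_neq0.
have pw : prim rho T (fun x => -1 * w x) (fun x => Q x / x).
  apply: (@prim_ext _ _ _ _ (fun x => -1 * - (Q x / x))).
    by move=> x _; rewrite mulN1r opprK.
  exact/primZ/(prim_sub (lexx _) tb wr).
have := prim_le pq pw _ (lexx _) rT (lexx _).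
rewrite (arc_top H) !mulN1r opprK => h.
have -> : c * (t ^+ 2 / 4) * (1 + rho / T) =
  c * (1 + rho / T) / 4 * ((T - rho) * (T - rho)) -
  c * (1 + rho / T) / 4 * ((rho - rho) * (rho - rho)).
  have -> : T - rho = t by rewrite /T; ring.
  by field; exact: lt0r_neq0.
rewrite [leRHS]addrC; apply: h => x /andP[rx xT].
have x0 : 0 < x by exact: le_lt_trans rx.
have Ql := arc_Q_lower (ltW rx) (ltW xT) tb.
rewrite ler_pdivlMr//; apply: le_trans Ql; rewrite -/c.
have -> : c * ((x ^+ 2 - rho ^+ 2) / 2) = c * ((x - rho) / 2) * (x + rho) by field.
have -> : c * (1 + rho / T) * ((x - rho) / 2) * x =
  c * ((x - rho) / 2) * (x + rho / T * x) by ring.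
apply: ler_wpM2l; first by rewrite mulr_ge0// divr_ge0// subr_ge0 ltW.
by rewrite lerD2l mulrAC ler_pdivrMr// ler_wpM2l// ltW.
Qed.

(** Between the node and the maximum the flux is largest in modulus at the node,
    which gives the lower bound; it has decreased by at most
    [lam * f mu * x ^ 2 / 2] at [x], which gives the upper one. *)
Lemma arc_left_log : 0 < a ->
  mu <= - Q a * ln (rho / a) <= mu + lam * f mu * rho ^+ 2 / 4.
Proof.
move=> a0'.
have rho0' : 0 < rho by exact: lt_le_trans arho.
have pl : prim a rho (fun x => - Q a * (ln x - ln a)) (fun x => - Q a / x).
  have := primZ (- Q a) (primB (prim_ln rho a0') (prim_cst a rho (ln a))).
  by apply: prim_ext => x _; rewrite subr0.
have pw := prim_sub (lexx a) (ltW rhob) (arc_w H).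
have Qbd x : a <= x -> x <= rho -> Q x - Q a <= lam * f mu * x ^+ 2 / 2.
  move=> ax xr.
  have pq : prim a x (fun x => (lam * f mu / 2) * (x * x))
      (fun x => lam * f mu * x).
    apply: prim_ext (primZ _ (primM (prim_id _ _) (prim_id _ _))) => z _.
    by rewrite /=; field.
  have xb : x <= b by rewrite (le_trans xr)// ltW.
  have := prim_le (prim_sub (lexx a) xb (arc_Q H)) pq _ (lexx _) ax (lexx _) => h.
  have fmu0 : 0 <= f mu by rewrite f_ge0// -(arc_top H) w_ge0// ltW.
  apply: le_trans (h _) _.
    move=> z /andP[az zx]; apply: ler_wpM2r; first by rewrite ltW// (lt_trans a0').
    have zb : z <= b by rewrite (le_trans (ltW zx)).
    rewrite ler_pM2l//; apply: (arc_fmono H); [exact: w_ge0 (ltW az) _|exact: w_le (ltW az) _].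
  have -> : lam * f mu * x ^+ 2 / 2 = lam * f mu / 2 * (x * x) by field.
  by rewrite gerBl mulr_ge0// ?divr_ge0 ?mulr_ge0// ltW.
rewrite -[ln _]/(ln (rho / a)) ln_div//; apply/andP; split.
  have := prim_le pw pl _ (lexx _) arho (lexx _).
  rewrite (arc_top H) (arc_start H)// !subr0 subrr mulr0 subr0; apply.
  move=> x /andP[ax xr]; rewrite -mulNr ler_pM2r ?invr_gt0 ?(lt_trans a0')//.
  by rewrite lerN2 arc_Q_ndecr ?(ltW ax)// ltW// (lt_trans xr).
have pq : prim a rho (fun x => (lam * f mu / 4) * (x * x))
      (fun x => lam * f mu * x / 2).
  apply: prim_ext (primZ _ (primM (prim_id _ _) (prim_id _ _))) => z _.
  by rewrite /=; field.
have := prim_le pl (primD pw pq) _ (lexx _) arho (lexx _).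
rewrite (arc_top H) (arc_start H)// subrr mulr0 subr0 => h.
apply: le_trans (h _) _.
  move=> x /andP[ax xr]; have x0 : 0 < x by exact: lt_trans ax.
  move: (Qbd x (ltW ax) (ltW xr)) => Qbx.
  rewrite -(ler_pM2r x0) mulrDl divfK ?gt_eqF//.
  have -> : - (Q x / x) * x = - Q x by rewrite mulNr divfK ?gt_eqF.
  have -> : lam * f mu * x / 2 * x = lam * f mu * x ^+ 2 / 2 by field.
  by move: Qbx; lra.
have -> : lam * f mu * rho ^+ 2 / 4 = lam * f mu / 4 * (rho * rho) by field.
have fmu0 : 0 <= f mu by rewrite f_ge0// -(arc_top H) w_ge0// ltW.
rewrite add0r gerBl mulr_ge0 ?divr_ge0 ?mulr_ge0 ?(ltW lam0)// ltW//.
Qed.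

(** The influx at the node is exactly the mass between the node and the maximum. *)
Lemma arc_left_flux_le : - Q a <= lam * f mu * rho ^+ 2 / 2.
Proof.
have pq : prim a rho (fun x => (lam * f mu / 2) * (x * x))
      (fun x => lam * f mu * x).
  apply: prim_ext (primZ _ (primM (prim_id _ _) (prim_id _ _))) => z _.
  by rewrite /=; field.
have := prim_le (prim_sub (lexx a) (ltW rhob) (arc_Q H)) pq _ (lexx _) arho (lexx _) => h.
rewrite (arc_topQ H) sub0r in h.
have fmu0 : 0 <= f mu by rewrite f_ge0// -(arc_top H) w_ge0// ltW.
apply: le_trans (h _) _.
  move=> z /andP[az zx]; apply: ler_wpM2r; first by rewrite ltW// (le_lt_trans a0).
  have zb : z <= b by rewrite ltW// (lt_trans zx).
  rewrite ler_pM2l//; apply: (arc_fmono H); [exact: w_ge0 (ltW az) _|exact: w_le (ltW az) _].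
have -> : lam * f mu * rho ^+ 2 / 2 = lam * f mu / 2 * (rho * rho) by field.
by rewrite gerBl mulr_ge0// ?divr_ge0 ?mulr_ge0// ltW.
Qed.

(** On [[rho / 2, rho]] the profile stays within [- Q a * ln 2] of its maximum,
    and the mass of that annulus alone is bounded by the influx. *)
Lemma arc_left_flux_ge : 0 < a -> a <= rho / 2 ->
  0 <= mu + Q a * ln 2 ->
  3 / 8 * (lam * f (mu + Q a * ln 2) * rho ^+ 2) <= - Q a.
Proof.
move=> a0' ar2 mQ.
have rho0' : 0 < rho by exact: lt_le_trans arho.
set h := rho / 2; set m := mu + Q a * ln 2.
have h0 : 0 < h by rewrite divr_gt0.
have hr : h <= rho by rewrite /h; move: rho0'; lra.
have hb : h <= b by rewrite (le_trans hr)// ltW.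
have wge x : h <= x -> x <= rho -> m <= w x.
  move=> hx xr.
  have x0 : 0 < x by exact: lt_le_trans hx.
  have ax : a <= x by exact: le_trans hx.
  have pw := prim_sub ax (ltW rhob) (arc_w H).
  have := prim_le pw (primZ (- Q a) (prim_ln rho x0)) _ (lexx _) xr (lexx _).
  rewrite (arc_top H) -mulrBr -ln_div// => hh.
  have {hh} : mu - w x <= - Q a * ln (rho / x).
    apply: hh => z /andP[xz zr]; rewrite -mulNr ler_pM2r ?invr_gt0 ?(lt_trans x0)//.
    rewrite lerN2 arc_Q_ndecr// ?(le_trans ax) ?ltW//.
    exact: lt_trans rhob.
  have lnx : ln (rho / x) <= ln 2.
    rewrite ler_ln ?posrE ?divr_gt0// ler_pdivrMr// mulrC -ler_pdivrMr//.
  have Qa : 0 <= - Q a by rewrite oppr_ge0 arc_Q_le0.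
  have := ler_wpM2l Qa lnx; rewrite /m; lra.
have pq : prim h rho (fun x => (lam * f m / 2) * (x * x))
      (fun x => lam * f m * x).
  apply: prim_ext (primZ _ (primM (prim_id _ _) (prim_id _ _))) => z _.
  by rewrite /=; field.
have := prim_le pq (prim_sub ar2 (ltW rhob) (arc_Q H)) _ (lexx _) hr (lexx _).
rewrite (arc_topQ H) sub0r => hh.
have -> : 3 / 8 * (lam * f m * rho ^+ 2) =
  lam * f m / 2 * (rho * rho) - lam * f m / 2 * (h * h) by rewrite /h; field.
apply: le_trans (hh _) _; last by rewrite lerN2 arc_Q_ndecr.
move=> z /andP[hz zr]; apply: ler_wpM2r; first by rewrite ltW// (lt_trans h0).
rewrite ler_pM2l//; apply: (arc_fmono H) => //; apply: wge; exact: ltW.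
Qed.

End arc_estimates.

(** * The nonlinearity *)

(** The base may tend to [0], where the power function is not jointly continuous
    in general; a positive limit of the exponents restores convergence. *)
Lemma cvg_powR (R : realType) (T : Type) (F : set_system T) (FF : Filter F)
    (f g : T -> R) (t b : R) : 0 < b -> (forall x, 0 <= f x) ->
  f @ F --> t -> g @ F --> b -> (fun x => f x `^ g x) @ F --> t `^ b.
Proof.
move=> b0 f0 ft gb.
have [t0|t0|t0] := ltgtP 0 t; last first.
- rewrite -t0 powR0 ?gt_eqF//; apply/cvgrPdist_le => e e0.
  have d0 : 0 < Num.min 1 (e `^ (2 / b)) by rewrite lt_min ltr01 powR_gt0.
  move/cvgrPdist_le: ft => /(_ _ d0) ft.
  have gb2 : \forall x \near F, b / 2 <= g x.
    by apply: (cvgr_ge b gb); move: b0; lra.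
  apply: filterS2 ft gb2 => x + gx.
  rewrite -t0 !sub0r !normrN ger0_norm// ger0_norm ?powR_ge0//.
  rewrite le_min => /andP[fx1 fxe].
  have [fx0|fx0] := eqVneq (f x) 0.
    by rewrite fx0 powR0 ?ltW// gt_eqF// (lt_le_trans _ gx)// divr_gt0.
  apply: (@le_trans _ _ (f x `^ (b / 2))).
    by apply: ger_powR => //; rewrite lt_neqAle eq_sym fx0 f0.
  apply: (@le_trans _ _ ((e `^ (2 / b)) `^ (b / 2))).
    by apply: ge0_ler_powR; rewrite ?nnegrE ?powR_ge0// divr_ge0// ltW.
  have -> : (e `^ (2 / b)) `^ (b / 2) = e.
    rewrite -powRrM (_ : _ * _ = 1) ?powRr1 ?ltW//.
    by field; rewrite gt_eqF.
  by [].
- have H : F (fun x => f x < 0) by exact: (cvgr_lt t ft).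
  apply/cvgrPdist_lt => e e0; apply: (@filterS _ F FF _ _ _ H) => x.
  by rewrite ltNge f0.
- have -> : t `^ b = expR (b * ln t) by rewrite /powR gt_eqF.
  apply: (@cvg_trans _ ((fun x => expR (g x * ln (f x))) @ F)).
    have H : F (fun x => 0 < f x) by exact: (cvgr_gt t ft).
    apply: near_eq_cvg; apply: (@filterS _ F FF _ _ _ H) => x fx.
    by rewrite /powR gt_eqF.
  apply: continuous_cvg; first exact: continuous_expR.
  apply: cvgM => //; apply: continuous_cvg => //.
  exact: continuous_ln.
Qed.

Lemma cvg_nonlin_weight (R : realType) (T : Type) (F : set_system T)
    (FF : Filter F) (alpha : R) (f g : T -> R) (t b : R) : 0 < b ->
  f @ F --> t -> g @ F --> b ->
  (fun x => expR (f x ^+ 2 + alpha * `|f x| `^ g x)) @ F -->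
    expR (t ^+ 2 + alpha * `|t| `^ b).
Proof.
move=> b0 ft gb; apply: continuous_cvg; first exact: continuous_expR.
apply: cvgD; first by under eq_fun do rewrite expr2; rewrite expr2; exact: cvgM.
apply: cvgMr; apply: cvg_powR => //; exact: cvg_norm.
Qed.

Lemma cvg_nonlin (R : realType) (T : Type) (F : set_system T) (FF : Filter F)
    (alpha : R) (f g : T -> R) (t b : R) : 0 < b ->
  f @ F --> t -> g @ F --> b ->
  (fun x => nonlin alpha (g x) (f x)) @ F --> nonlin alpha b t.
Proof. by move=> b0 ft gb; apply: cvgM => //; exact: cvg_nonlin_weight. Qed.

Lemma nonlinN (R : realType) (alpha b t : R) :
  nonlin alpha b (- t) = - nonlin alpha b t.
Proof. by rewrite /nonlin sqrrN normrN mulNr. Qed.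

Lemma nonlin_mono (R : realType) (alpha b x y : R) : 0 <= alpha -> 0 < b ->
  0 <= x -> x <= y -> nonlin alpha b x <= nonlin alpha b y.
Proof.
move=> a0 b0 x0 xy; have y0 := le_trans x0 xy.
rewrite /nonlin ler_pM ?expR_ge0// ler_expR lerD//.
  by rewrite ler_sqr ?nnegrE.
rewrite ler_wpM2l// ge0_ler_powR ?nnegrE ?(ltW b0)//.
by rewrite !ger0_norm.
Qed.

(** * Derivatives of radial functions of the plane *)

Arguments enorm : simpl never.

Lemma is_derive_line (R : realType) (U : R * R -> R) (x w : R * R) (g : R -> R)
    (s : R) :
  (\forall h \near (0 : R), g (h + s) = U (h *: w + x)) -> derivable U x w ->
  is_derive s 1 g ('D_w U x).
Proof.
move=> gU dU.
have gs : g s = U x by have := nbhs_singleton gU; rewrite scale0r !add0r.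
have E : \forall h \near (0 : R)^',
    h^-1 *: ((U \o shift x) (h *: w) - U x) = h^-1 *: ((g \o shift s) (h *: (1 : R)) - g s).
  apply: nbhs_dnbhs; apply: filterS gU => h /= ghs.
  by rewrite /= scaler1 ghs gs.
have cg : (fun h => h^-1 *: ((g \o shift s) (h *: (1 : R)) - g s)) @ (0 : R)^' --> 'D_w U x.
  exact: cvg_trans (near_eq_cvg E) dU.
apply: DeriveDef; first exact: (cvgP _ cg).
by apply/cvg_lim.
Qed.

Lemma is_derive_unique (R : realType) (g : R -> R) (s a b : R) :
  is_derive s 1 g a -> is_derive s 1 g b -> a = b.
Proof. by move=> [_ <-] [_ <-]. Qed.

Lemma enorm_axis (R : realType) (s : R) : enorm (s, 0) = `|s|.
Proof. by rewrite /enorm/= expr0n/= addr0 sqrtr_sqr. Qed.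

Lemma planar_continuous (R : realType) (v : R -> R) :
  {within @cdisk R, continuous (planar v)} -> {within `[0, 1], continuous v}.
Proof.
move=> /subspace_continuousP cU; apply/subspace_continuousP => s /=.
rewrite in_itv/= => /andP[s0 s1].
have /cU : cdisk (s, 0) by rewrite /cdisk/= enorm_axis ger0_norm.
move=> /cvgrPdist_lt H; apply/cvgrPdist_lt => e e0.
have := H e e0; rewrite !near_withinE => /nbhs_ballP[d /= d0 dP].
apply/nbhs_ballP; exists d => //= y sy; rewrite in_itv/= => /andP[y0 y1].
have := dP (y, 0).
rewrite /from_subspace /planar !enorm_axis (ger0_norm s0) (ger0_norm y0); apply.
  by split => //=; exact: ballxx.
by rewrite /cdisk/= enorm_axis ger0_norm.
Qed.

Lemma evec_shift (R : realType) (b : bool) (h p q : R) :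
  h *: evec R b + (p, q) = if b then (p, h + q) else (h + p, q).
Proof.
have scaleE (x y : R) : h *: (x, y) = (h * x, h * y) :> R * R by [].
have addE (x y z t : R) : (x, y) + (z, t) = (x + z, y + t) :> R * R by [].
by case: b; rewrite /evec scaleE addE mulr1 mulr0 add0r.
Qed.

Lemma planar_derive (R : realType) (v : R -> R) (s : R) :
  C2_on (@disk R) (planar v) -> 0 < s < 1 ->
  is_derive s 1 v (partial false (planar v) (s, 0)).
Proof.
move=> C2 /andP[s0 s1].
have [_ /(_ false)[dU _]] : _ := C2 (s, 0) ltac:(by rewrite /disk/= enorm_axis gtr0_norm).
apply: is_derive_line dU.
near=> h; rewrite evec_shift /planar enorm_axis gtr0_norm//.
rewrite -ltrBlDr sub0r; near: h.
apply: lt_nbhsr; rewrite oppr_lt0//.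
Unshelve. all: by end_near. Qed.

Lemma planar_derive2 (R : realType) (v : R -> R) (s : R) :
  C2_on (@disk R) (planar v) -> 0 < s < 1 ->
  is_derive s 1 (fun s => partial false (planar v) (s, 0))
    (partial false (partial false (planar v)) (s, 0)).
Proof.
move=> C2 /andP[s0 s1].
have [_ /(_ false)[_ [_ /(_ false)[dU _]]]] : _ := C2 (s, 0)
  ltac:(by rewrite /disk/= enorm_axis gtr0_norm).
apply: is_derive_line dU.
by near=> h; rewrite evec_shift.
Unshelve. all: by end_near. Qed.

Lemma is_derive_enorm (R : realType) (s h : R) : 0 < s ->
  is_derive h 1 (fun t => enorm (s, t)) (h / enorm (s, h)).
Proof.
move=> s0.
have p : 0 < s ^+ 2 + h ^+ 2 by rewrite ltr_pwDl ?exprn_gt0// sqr_ge0.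
have d1 : is_derive h 1 (fun t : R => s ^+ 2 + t ^+ 2) (2 * h).
  apply: is_derive_eq.
  by rewrite add0r /GRing.scale/= mul1r mulr1; ring.
have d2 := is_derive1_sqrt p.
have := @is_derive1_comp R Num.sqrt (fun t : R => s ^+ 2 + t ^+ 2) h _ _ d2 d1; rewrite /comp/=
  /enorm/=.
have -> : (2 * Num.sqrt (s ^+ 2 + h ^+ 2))^-1 * (2 * h) =
  h / Num.sqrt (s ^+ 2 + h ^+ 2) by field; rewrite gt_eqF// sqrtr_gt0.
by [].
Qed.

(** Along the tangent line at [(s, 0)] the function is [v] of the Euclidean norm,
    so its derivative at [h] is [h * v'(rho) / rho] with [rho] the norm; the
    derivative of this at [h = 0] is [v'(s) / s]. *)
Lemma planar_angular (R : realType) (v : R -> R) (s : R) :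
  C2_on (@disk R) (planar v) -> 0 < s < 1 ->
  partial true (partial true (planar v)) (s, 0) =
  partial false (planar v) (s, 0) / s.
Proof.
move=> C2 /andP[s0 s1].
set d := fun s => partial false (planar v) (s, 0).
have es : enorm (s, 0) = s by rewrite enorm_axis gtr0_norm.
have eh h : 0 < enorm (s, h).
  by rewrite sqrtr_gt0/= ltr_pwDl ?exprn_gt0// sqr_ge0.
have near1 : \forall h \near (0 : R), enorm (s, h) < 1.
  have [/derivable1_diffP/differentiable_continuous + _] := is_derive_enorm 0 s0.
  by move=> /(cvgr_lt (enorm (s, 0))); apply; rewrite es.
have dU h : enorm (s, h) < 1 ->
    partial true (planar v) (s, h) = h * (d (enorm (s, h)) / enorm (s, h)).
  move=> h1.
  have [_ /(_ true)[dt _]] := C2 (s, h) h1.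
  have D1 : is_derive h 1 (fun t => v (enorm (s, t))) ('D_(evec R true) (planar v) (s, h)).
    by apply: is_derive_line dt; near=> t; rewrite evec_shift.
  have := is_derive1_comp (planar_derive C2 _) (is_derive_enorm h s0).
  rewrite eh h1 => /(_ isT) /(is_derive_unique D1) E.
  by rewrite mulrCA; exact: E.
have [_ /(_ true)[_ [_ /(_ true)[dtt _]]]] : _ := C2 (s, 0) ltac:(by rewrite /disk/= es).
have D1 : is_derive (0 : R) 1 (fun h : R => h * (d (enorm (s, h)) / enorm (s, h)))
   (partial true (partial true (planar v)) (s, 0)).
  apply: is_derive_line dtt; apply: filterS near1 => h h1.
  by rewrite evec_shift !addr0 dU.
have D2 : is_derive (enorm (s, 0)) 1 d (partial false (partial false (planar v)) (s, 0)).
  by rewrite es; apply: planar_derive2 => //; rewrite s0.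
have D3 := @is_derive1_comp R d (fun h : R => enorm (s, h)) 0 _ _ D2 (is_derive_enorm 0 s0).
have D4 := @is_deriveV R (fun h : R => enorm (s, h)) 0 _ _ (lt0r_neq0 (eh 0))
  (is_derive_enorm 0 s0).
have D5 := @is_deriveM R R^o (d \o (fun h : R => enorm (s, h)))
  (fun h : R => (enorm (s, h))^-1) 0 1 _ _ D3 D4.
have D6 := is_deriveM (is_derive_id (0 : R) 1) D5.
rewrite (is_derive_unique D1 D6) scale0r add0r /GRing.scale/= mulr1.
by rewrite -[LHS]/(d (enorm (s, 0)) * (enorm (s, 0))^-1) es.
Unshelve. all: by end_near. Qed.

(** * The radial equation in flux form *)

(** The equation [- (s v')' = lam * f(v) * s] as a first-order system, with
    [P s = - s * v'(s)]; [P 0 = 0] is the regularity at the centre. *)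
Definition radial_flux (R : realType) (lam alpha bet : R) (v P : R -> R) : Prop :=
  [/\ prim 0 1 v (fun s => - (P s / s)),
      prim 0 1 P (fun s => lam * nonlin alpha bet (v s) * s) & P 0 = 0].

Lemma within_nonlin (R : realType) (lam alpha bet : R) (v : R -> R) (A : set R) :
  0 < bet -> {within A, continuous v} ->
  {within A, continuous (fun s => lam * nonlin alpha bet (v s) * s)}.
Proof.
move=> b0 /subspace_continuousP cv; apply/subspace_continuousP => s As.
apply: cvgM; last exact: cvg_within.
apply: cvgMr; apply: cvg_nonlin => //; first exact: cv.
exact: cvg_cst.
Qed.

(** In polar coordinates the equation makes [s * v'(s)] plus a primitive of
    [lam * f(v) * s] constant on [(0, 1)]; the continuity of [v'] at the centre
    identifies the constant. *)
Lemma radial_system (R : realType) (alpha : R) (k : nat) (lam bet : R) (v : R -> R) :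
  0 < bet -> nodal_sol alpha k lam bet (planar v) ->
  exists P, radial_flux lam alpha bet v P.
Proof.
move=> b0 [_ C2 cU pde _].
have cv := planar_continuous cU.
have ch := @within_nonlin R lam alpha bet v _ b0 cv.
have [H [pH _]] := exists_prim ltr01 ch.
pose d s := partial false (planar v) (s, 0).
pose P s := H s - H 0.
have pP : prim 0 1 P (fun s => lam * nonlin alpha bet (v s) * s).
  by apply: prim_ext (primB pH (prim_cst 0 1 (H 0))) => x _; rewrite subr0.
have dE (s : R) : 0 < s < 1 -> is_derive s 1 (fun t => H t + t * d t) 0.
  move=> s01; have s0 : 0 < s by case/andP: s01.
  have := pde (s, 0); rewrite /disk/= enorm_axis gtr0_norm//.
  case/andP: (s01) => _ s1 /(_ s1); rewrite /laplacian planar_angular//.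
  rewrite /planar enorm_axis gtr0_norm// -/(d s) => E.
  have D1 := planar_derive2 C2 s01.
  have D2 := pH.2 s s01.
  apply: is_derive_eq; rewrite -E /GRing.scale/= /d mulr1.
  by field; rewrite gt_eqF.
have cst s t : 0 < s -> s <= t -> t < 1 -> H s + s * d s = H t + t * d t.
  move=> s0 st t1.
  have p0 : prim s t (fun t => H t + t * d t) (fun=> 0).
    split; last first.
      by move=> x /andP[sx xt]; apply: dE; rewrite (lt_trans s0)// (lt_trans xt).
    apply: derivable_within_continuous => x; rewrite in_itv/= => /andP[sx xt].
    by have [] : is_derive x 1 (fun t => H t + t * d t) 0;
      first by apply: dE; rewrite (lt_le_trans s0)// (le_lt_trans xt).
  apply/le_anti; apply/andP; split.
    by apply: (prim_mono p0).
  by have := prim_mono (primZ (-1) p0) _ (lexx s) st (lexx t);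
    rewrite !mulN1r lerN2; apply => *; rewrite oppr0.
(* The partial derivatives are continuous at the centre, which excludes a
   logarithmic singularity there. *)
have cd : {for 0, continuous d}.
  have [_ /(_ false)[_ [cp _]]] : _ := C2 (0, 0) ltac:(by rewrite /disk/= enorm_axis normr0).
  apply/cvgrPdist_lt => e e0; move/cvgrPdist_lt: cp => /(_ e e0).
  move=> /nbhs_ballP[r /= r0 rP]; apply/nbhs_ballP; exists r => //= y ry.
  by apply: (rP (y, 0)); split => //; exact: ballxx.
have H0 s : 0 < s < 1 -> H s + s * d s = H 0.
  move=> /andP[s0 s1].
  have l1 : (fun t => H t + t * d t) @ 0^'+ --> H 0 + 0 * d 0.
    apply: cvgD.
      by have /(continuous_within_itvP _ ltr01)[] := pH.1.
    apply: cvgM; first exact: cvg_at_right_filter cvg_id.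
    exact: cvg_at_right_filter cd.
  have l2 : (fun t => H t + t * d t) @ 0^'+ --> H s + s * d s.
    apply: cvg_near_cst; near=> t.
    by apply: cst => //; near: t; exact: nbhs_right_le.
  by rewrite (cvg_unique _ l2 l1) // mul0r addr0.
exists P; split => //; last by rewrite /P subrr.
split=> // s s01; have s0 : 0 < s by case/andP: s01.
suff -> : - (P s / s) = d s by exact: planar_derive.
by rewrite /P -(H0 s s01); field; rewrite gt_eqF.
Unshelve. all: by end_near. Qed.

(** * Nodal intervals of a radial solution *)

Lemma sub_cc01 (R : realType) (a b : R) : 0 <= a -> b <= 1 -> `[a, b] `<=` `[0, 1].
Proof. by move=> a0 b1; apply: subset_itv; rewrite bnd_simp. Qed.

Section on_one_interval.
Context (R : realType) (alpha lam bet : R) (v P : R -> R).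
Hypotheses (alpha0 : 0 < alpha) (lam0 : 0 < lam) (bet0 : 0 < bet)
  (vP : radial_flux lam alpha bet v P).

Lemma nonlin_sign (e : nat) (t : R) :
  nonlin alpha bet ((-1) ^+ e * t) = (-1) ^+ e * nonlin alpha bet t.
Proof.
rewrite -signr_odd; case: odd; last by rewrite expr0 !mul1r.
by rewrite expr1 !mulN1r nonlinN.
Qed.

Section interval.
Context (a b rho mu : R) (e : nat).
Hypotheses (a0 : 0 <= a) (b1 : b <= 1) (arb : a <= rho < b) (mu0 : 0 < mu)
  (muE : mu = `|v rho|) (vb : v b = 0) (va : 0 < a -> v a = 0)
  (v0 : a = 0 -> 0 <= (-1) ^+ e * v a)
  (vs : forall s, a < s < b -> 0 < (-1) ^+ e * v s)
  (vmu : forall s, a <= s <= b -> `|v s| <= mu).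

Let ab : a < b. Proof. by case/andP: arb; exact: le_lt_trans. Qed.

Lemma radial_abs (s : R) : a <= s <= b -> `|v s| = (-1) ^+ e * v s.
Proof.
have absE t : `|(-1) ^+ e * v t| = `|v t|.
  by rewrite normrM normrX normrN1 expr1n mul1r.
move=> /andP[]; rewrite le_eqVlt => /predU1P[<-|as_].
  move: a0; rewrite le_eqVlt => /predU1P[/esym/v0/ger0_norm|/va ->].
    by rewrite absE.
  by rewrite normr0 mulr0.
rewrite le_eqVlt => /predU1P[->|sb]; first by rewrite vb normr0 mulr0.
have /vs/gtr0_norm : a < s < b by rewrite as_.
by rewrite absE.
Qed.

Let pv : prim a b v (fun s => - (P s / s)).
Proof. by have [pv _ _] := vP; exact: prim_sub pv. Qed.
Let pP : prim a b P (fun s => lam * nonlin alpha bet (v s) * s).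
Proof. by have [_ pP _] := vP; exact: prim_sub pP. Qed.

(** At an interior maximum the derivative vanishes.  A maximum at the inner end
    can only be the centre of the disk, since the height at a node is [0]. *)
Lemma radial_top_flux : P rho = 0.
Proof.
have [_ _ P0] := vP; have /andP[ar rb] := arb.
move: ar; rewrite le_eqVlt => /predU1P[E|ar].
  rewrite -E; move: a0; rewrite le_eqVlt => /predU1P[<-//|/va va0].
  by have := mu0; rewrite muE -E va0 normr0 ltxx.
pose w s := (-1) ^+ e * v s.
have pw : prim a b w (fun s => (-1) ^+ e * - (P s / s)) by exact: primZ.
have [_ dw] := pw.
have rab : rho \in `]a, b[ by rewrite in_itv/= ar.
have D0 : is_derive rho 1 w 0.
  apply: (derive1_at_max (ltW ab)) rab _ => t; rewrite in_itv/= => tab.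
    by have [] := dw t tab.
  have /andP[at_ tb] := tab.
  rewrite /w -!radial_abs ?(ltW at_) ?(ltW tb) ?(ltW ar) ?(ltW rb)//.
  by rewrite -muE vmu// (ltW at_) ltW.
have := is_derive_unique D0 (dw rho _); rewrite ar rb => /(_ isT)/esym/eqP.
rewrite mulf_eq0 signr_eq0/= oppr_eq0 mulf_eq0 invr_eq0.
by rewrite (gt_eqF (le_lt_trans a0 ar)) orbF => /eqP.
Qed.

Lemma radial_arc : arc (nonlin alpha bet) lam mu a rho b
    (fun s => (-1) ^+ e * v s) (fun s => (-1) ^+ e * P s).
Proof.
have /andP[ar rb] := arb.
split => //.
- by rewrite /nonlin mul0r.
- by move=> x y; exact: nonlin_mono (ltW alpha0) bet0.
- by apply: prim_ext (primZ _ pv) => s _; rewrite mulrN mulrA.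
- by apply: prim_ext (primZ ((-1) ^+ e) pP) => s _; rewrite nonlin_sign; ring.
- by move=> s sab; rewrite -radial_abs// normr_ge0 vmu.
- by rewrite -radial_abs ?muE// ar ltW.
- by rewrite radial_top_flux mulr0.
- by move=> /va ->; rewrite mulr0.
- by have [_ _ P0] := vP; move=> ->; rewrite P0 mulr0.
- by rewrite vb mulr0.
Qed.

Lemma radial_mass :
  Rintegral (@lebesgue_measure R) `[a, b]
    (fun s => lam * nonlin alpha bet `|v s| * s) =
  (-1) ^+ e * P b - (-1) ^+ e * P a.
Proof.
have pQ := arc_Q radial_arc.
pose g s := lam * nonlin alpha bet ((-1) ^+ e * v s) * s.
transitivity (Rintegral (@lebesgue_measure R) `[a, b] g).
  by apply: eq_Rintegral => s; rewrite inE/= in_itv/= /g => sab; rewrite radial_abs.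
have ch : {within `[a, b], continuous g}.
  by apply: within_nonlin => //; have [] := arc_w radial_arc.
have [H [pH HE]] := exists_prim ab ch.
rewrite (HE a b (lexx a) (ltW ab) (lexx b)).
have l1 := prim_le pH pQ (fun x _ => lexx _) (lexx a) (ltW ab) (lexx b).
have l2 := prim_le pQ pH (fun x _ => lexx _) (lexx a) (ltW ab) (lexx b).
by apply/le_anti; rewrite l1 l2.
Qed.

End interval.

(** Makes [P s ^+ 2 / s] continuous at the centre, so that it has a primitive up
    to there. *)
Lemma radial_flux_quad : exists C, forall s, 0 <= s <= 1 -> `|P s| <= C * s ^+ 2.
Proof.
have [pv pP P0] := vP.
have ch : {within `[0, 1], continuous (fun s => lam * nonlin alpha bet (v s))}.
  apply/subspace_continuousP => s As; apply: cvgMr; apply: cvg_nonlin => //.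
    by move/subspace_continuousP: pv.1; exact.
  exact: cvg_cst.
have /compact_bounded[M [_ HM]] := continuous_compact ch (@segment_compact R 0 1).
set C := `|M| + 1.
have CB s : 0 <= s <= 1 -> `|lam * nonlin alpha bet (v s)| <= C.
  move=> s01; apply: HM; last by exists s.
  by rewrite (le_lt_trans (ler_norm _))// ltrDl.
exists C => s /andP[s0 s1].
have pq : prim 0 1 (fun x => C / 2 * (x * x)) (fun x => C * x).
  by apply: prim_ext (primZ _ (primM (prim_id _ _) (prim_id _ _))) => x _ /=; field.
have le1 := prim_le pP pq _ (lexx 0) s0 s1.
have le2 := prim_le (primZ (-1) pP) pq _ (lexx 0) s0 s1.
have C0 : 0 <= C by rewrite addr_ge0.
have E : C / 2 * (s * s) <= C * s ^+ 2.
  have -> : C * s ^+ 2 = C * (s * s) by rewrite expr2.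
  by rewrite ler_wpM2r ?mulr_ge0//; lra.
have E2 x : 0 < x < 1 -> `|lam * nonlin alpha bet (v x) * x| <= C * x.
  move=> /andP[x0 x1]; rewrite normrM (gtr0_norm x0) ler_pM2r// CB// !ltW//.
rewrite ler_norml; apply/andP; split.
  rewrite lerNl; apply: le_trans E.
  move: le2; rewrite P0 !mulr0 !subr0 mulN1r; apply => x /E2.
  by rewrite ler_norml mulN1r => /andP[]; rewrite lerNl.
apply: le_trans E; move: le1; rewrite P0 !mulr0 !subr0; apply => x /E2.
by rewrite ler_norml => /andP[].
Qed.

Lemma radial_dirichlet (a b : R) : 0 <= a -> a < b -> b <= 1 ->
  exists E, prim a b E (fun s => P s ^+ 2 / s) /\ dirichlet v a b = E b - E a.
Proof.
move=> a0 ab b1; have [pv pP P0] := vP.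
have pvab := prim_sub a0 b1 pv.
have [C HC] := radial_flux_quad.
have ch : {within `[a, b], continuous (fun s => P s ^+ 2 / s)}.
  apply: (continuous_subspaceW (sub_cc01 a0 b1)).
  apply/subspace_continuousP => s /=; rewrite in_itv/= => /andP[].
  rewrite le_eqVlt => /predU1P[<- _|s0 s1]; last first.
    apply: cvgM; last by apply: cvgV; [rewrite gt_eqF|exact: cvg_within].
    under eq_fun do rewrite expr2; rewrite expr2.
    have cP : P @ within `[0, 1] (nbhs s) --> P s.
      by move/subspace_continuousP: pP.1; apply; rewrite /= in_itv/= ltW.
    exact: cvgM.
  (* At the centre the total division gives the value [0], which is also the limit. *)
  rewrite /from_subspace P0 expr0n/= mul0r.
  apply/cvgrPdist_le => e e0; rewrite near_withinE.
  pose D := C ^+ 2 + 1.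
  have D0 : 0 < D by rewrite ltr_wpDl// sqr_ge0.
  have d0 : 0 < Num.min 1 (e / D) by rewrite lt_min ltr01 divr_gt0.
  apply/nbhs_ballP; exists (Num.min 1 (e / D)) => //= y.
  rewrite /ball/= sub0r normrN => + /[!in_itv]/= /andP[y0 y1].
  rewrite ger0_norm// lt_min => /andP[_ yd].
  rewrite sub0r normrN ger0_norm ?divr_ge0 ?sqr_ge0//.
  move: y0; rewrite le_eqVlt => /predU1P[<-|y0]; first by rewrite invr0 mulr0 ltW.
  rewrite ler_pdivrMr// -real_normK ?num_real//.
  have Py := HC y; rewrite (ltW y0) y1 in Py.
  apply: (@le_trans _ _ ((C * y ^+ 2) ^+ 2)).
    by rewrite ler_sqr ?nnegrE ?Py// (le_trans (normr_ge0 _) (Py isT)).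
  rewrite exprMn -exprM.
  have yD : D * y <= e by rewrite mulrC -ler_pdivlMr// ltW.
  have y3 : y ^+ 3 <= 1 by rewrite exprn_ile1// ltW.
  apply: (@le_trans _ _ (D * y * y)); last by rewrite ler_wpM2r// ltW.
  have -> : C ^+ 2 * y ^+ 4 = C ^+ 2 * y ^+ 2 * y ^+ 2 by ring.
  have -> : D * y * y = D * y ^+ 2 by ring.
  rewrite ler_wpM2r ?sqr_ge0//; apply: (@le_trans _ _ (C ^+ 2)); last by rewrite /D lerDl.
  by rewrite ler_piMr ?sqr_ge0// exprn_ile1// ltW.
have [E [pE HE]] := exists_prim ab ch.
exists E; split => //.
rewrite -(HE a b (lexx a) (ltW ab) (lexx b)) /dirichlet /Rintegral.
congr (fine _).
have mP : measurable_fun `]a, b[ (fun s => P s ^+ 2 / s).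
  apply: (@measurable_funS _ _ _ _ `[a, b]) => //; first exact: subset_itv_oo_cc.
  have /measurable_int/measurable_EFinP // := continuous_compact_integrable
    (@segment_compact R a b) ch.
have fg : {in `]a, b[, (fun r => derive_in `[a, b] v r ^+ 2 * r) =1 (fun s => P s ^+ 2 / s)}.
  move=> s; rewrite in_itv/= => sab; rewrite (prim_derive_in sab pvab) sqrrN exprMn.
  have s0 : s != 0 by case/andP: sab => as_ _; rewrite gt_eqF// (le_lt_trans a0).
  by field.
apply: eq_integral_itv_bounded => //.
by apply: eq_measurable_fun mP => s; rewrite inE => /fg.
Qed.

Lemma radial_slope (a b : R) : 0 <= a -> a < b -> b <= 1 ->
  derive_in `[a, b] v b = - (P b / b).
Proof.
move=> a0 ab b1; have [pv pP P0] := vP.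
apply: (prim_derive_in_right ab (prim_sub a0 b1 pv)).
have b0 : 0 < b by exact: le_lt_trans ab.
apply: cvgN; apply: cvgM.
  have [cP _] := prim_sub (lexx 0) b1 pP.
  by have [] := (continuous_within_itvP _ b0).1 cP.
by apply: cvgV; [rewrite gt_eqF|exact: cvg_at_left_filter cvg_id].
Qed.

End on_one_interval.

(** * Growth of powers and logarithms along sequences *)

Lemma cvg_near_eq (R : realType) (f g : nat -> R) (l : R) :
  (\forall n \near \oo, f n = g n) -> g @ \oo --> l -> f @ \oo --> l.
Proof.
move=> fg; apply: cvg_trans; apply: near_eq_cvg.
by apply: filterS fg => n ->.
Qed.

Lemma powR_sqr_split (R : realType) (x b : R) : 0 < x ->
  x `^ b = x ^+ 2 * x `^ (b - 2).
Proof.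
move=> x0; rewrite -powR_mulrn ?ltW// -powRD; last by apply/implyP => _; rewrite gt_eqF.
by congr (_ `^ _); ring.
Qed.

(** The exponents differ by
    [m ^+ 2 - th ^+ 2 + al * (m `^ be - th `^ be)], and
    [x `^ be = x ^+ 2 * x `^ (be - 2)] where the last factor does not increase,
    because [be <= 2]. *)
Lemma nonlin_ratio (R : realType) (al be th m : R) : 0 <= al -> be <= 2 ->
  0 < th -> th <= m ->
  nonlin al be m *
    (th / m * expR (- ((m ^+ 2 - th ^+ 2) * (1 + al * m `^ (be - 2))))) <=
  nonlin al be th.
Proof.
move=> al0 be2 th0 thm; have m0 : 0 < m by exact: lt_le_trans thm.
rewrite /nonlin (gtr0_norm m0) (gtr0_norm th0).
set A := expR (m ^+ 2 + _); set B := expR (- _).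
have -> : m * A * (th / m * B) = th * (A * B) by field; rewrite gt_eqF.
rewrite ler_pM2l// -expRD ler_expR (powR_sqr_split be m0) (powR_sqr_split be th0).
have pw : m `^ (be - 2) <= th `^ (be - 2).
  rewrite -[be - 2]opprB !powRN lef_pV2 ?posrE ?powR_gt0//.
  by apply: ge0_ler_powR; rewrite ?nnegrE ?subr_ge0 ?(ltW m0) ?(ltW th0).
have : th ^+ 2 * (al * m `^ (be - 2)) <= th ^+ 2 * (al * th `^ (be - 2)).
  by rewrite ler_wpM2l ?sqr_ge0// ler_wpM2l.
by move: (m `^ _) (th `^ _) => M T; lra.
Qed.

Section growth.
Context (R : realType) (mu bet : nat -> R) (bets : R).
Hypotheses (bets0 : 0 < bets) (bet_cvg : bet @ \oo --> bets)
  (mu_oo : mu @ \oo --> +oo).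

Lemma cvgy_near_gt (c : R) : \forall n \near \oo, c < mu n.
Proof. exact: (cvgryPgt _).1. Qed.

Lemma ln_cvgy : (fun n => ln (mu n)) @ \oo --> +oo.
Proof.
apply/cvgryPgt => c; apply: filterS (cvgy_near_gt (expR c)) => n h.
by rewrite -(expRK c) ltr_ln ?posrE ?expR_gt0// (lt_trans _ h)// expR_gt0.
Qed.

Lemma powR_cvgy : (fun n => mu n `^ bet n) @ \oo --> +oo.
Proof.
have b2 : \forall n \near \oo, bets / 2 <= bet n.
  by apply: (cvgr_ge _ bet_cvg); move: bets0; lra.
have H := (cvgryPgt _).1 ln_cvgy.
apply/cvgryPgt => c.
near=> n.
have m0 : 0 < mu n by near: n; exact: cvgy_near_gt.
have X : 2 / bets * `|c| <= ln (mu n) by apply: ltW; near: n; exact: H.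
have bn : bets / 2 <= bet n by near: n.
rewrite /powR gt_eqF//; apply: lt_le_trans (expR_ge1Dx _).
apply: (@le_lt_trans _ _ `|c|); first exact: ler_norm.
have X0 : 0 <= ln (mu n) by apply: le_trans X; rewrite mulr_ge0// divr_ge0// ltW.
have : bets / 2 * ln (mu n) <= bet n * ln (mu n) by rewrite ler_wpM2r.
have : bets / 2 * (2 / bets * `|c|) <= bets / 2 * ln (mu n).
  by rewrite ler_wpM2l// divr_ge0// ltW.
have -> : bets / 2 * (2 / bets * `|c|) = `|c| by field; rewrite gt_eqF.
lra.
Unshelve. all: by end_near. Qed.

Lemma cvgy_inv (f : nat -> R) : f @ \oo --> +oo -> (fun n => (f n)^-1) @ \oo --> (0 : R).
Proof. by move=> fy; apply/(gtr0_cvgV0 _).2 => //; exact: (cvgryPgt _).1. Qed.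

(** From [x ^+ 2 / 2 <= expR x] with [x = bet n * ln (mu n)]. *)
Lemma ln_powR_cvg0 : (fun n => ln (mu n) / mu n `^ bet n) @ \oo --> (0 : R).
Proof.
have H : (fun n => 2 / bet n ^+ 2 * (ln (mu n))^-1) @ \oo --> (0 : R).
  rewrite -(mulr0 (2 / bets ^+ 2)); apply: cvgM; last exact: cvgy_inv ln_cvgy.
  apply: cvgMr; apply: cvgV; first by rewrite sqrf_eq0 gt_eqF.
  by under eq_fun do rewrite expr2; rewrite expr2; exact: cvgM.
apply: (squeeze_cvgr _ (cvg_cst 0) H).
have b2 : \forall n \near \oo, bets / 2 <= bet n.
  by apply: (cvgr_ge _ bet_cvg); move: bets0; lra.
have Hl := (cvgryPgt _).1 ln_cvgy.
near=> n.
have m0 : 0 < mu n by near: n; exact: cvgy_near_gt.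
have X0 : 0 < ln (mu n) by near: n; exact: Hl.
have bn : bets / 2 <= bet n by near: n.
have bn0 : 0 < bet n by apply: lt_le_trans bn; rewrite divr_gt0.
apply/andP; split; first by rewrite divr_ge0 ?powR_ge0// ltW.
rewrite ler_pdivrMr ?powR_gt0//.
have : (bet n * ln (mu n)) ^+ 2 / 2 <= mu n `^ bet n.
  rewrite /powR gt_eqF//.
  have := @expR_ge1Dxn R (bet n * ln (mu n)) 1 (ltW (mulr_gt0 bn0 X0)).
  by apply: le_trans; rewrite lerDr.
have c0 : 0 <= 2 / bet n ^+ 2 / ln (mu n) by rewrite !divr_ge0 ?sqr_ge0 ?(ltW X0).
move=> /(ler_wpM2l c0); apply: le_trans.
by rewrite le_eqVlt; apply/orP; left; apply/eqP; field; rewrite !gt_eqF.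
Unshelve. all: by end_near. Qed.

End growth.

(** * Asymptotics of one bubble *)

Section bubble.
Context (R : realType) (alpha bets : R) (lam bet a rho b mu gam Ms En : nat -> R)
  (w Q : nat -> R -> R).
Hypotheses (alpha0 : 0 < alpha) (bets02 : 0 < bets < 2)
  (bet02 : forall n, 0 < bet n < 2) (bet_cvg : bet @ \oo --> bets)
  (warc : forall n, arc (nonlin alpha (bet n)) (lam n) (mu n) (a n) (rho n) (b n)
            (w n) (Q n))
  (mu0 : forall n, 0 < mu n) (gam0 : forall n, 0 < gam n)
  (gamE : forall n,
     1 = 2 * lam n * mu n * nonlin alpha (bet n) (mu n) * gam n ^+ 2)
  (mu_oo : mu @ \oo --> +oo)
  (z_cvg : forall s, 0 < s -> (\forall n \near \oo, rho n + gam n * s <= b n) /\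
     (fun n => 2 * mu n * (w n (rho n + gam n * s) - mu n)) @ \oo --> zlim s)
  (massE : forall n, Ms n = Q n (b n) - Q n (a n))
  (gap : forall n s, rho n <= s -> 0 < s -> s <= b n ->
     Q n s * (Q n (b n) * ln (b n / s) - w n s) <= mu n * Ms n - En n)
  (En_exp : energy_expansion alpha bets bet mu En)
  (Ms_exp : energy_expansion alpha bets bet mu (fun n => mu n * Ms n)).

Let y n := mu n `^ (- (2 - bet n)).

Let lam0 n : 0 < lam n. Proof. exact: arc_lam (warc n). Qed.

Let lam_gam n : lam n * nonlin alpha (bet n) (mu n) * gam n ^+ 2 = (2 * mu n)^-1.
Proof.
apply/(mulfI (lt0r_neq0 (mulr_gt0 (ltr0Sn R 1) (mu0 n)))).
rewrite divff ?gt_eqF ?mulr_gt0//; apply/esym/(etrans (gamE n)); ring.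
Qed.

Let rho0 n : 0 <= rho n.
Proof. by have /andP[ar _] := arc_rho (warc n); exact: le_trans (arc_a (warc n)) ar. Qed.

Let y_gt0 n : 0 < y n. Proof. exact: powR_gt0. Qed.

Let y_cvg0 : y @ \oo --> (0 : R).
Proof.
have H : (fun n => mu n `^ (2 - bet n)) @ \oo --> +oo.
  apply: (@powR_cvgy _ mu (fun n => 2 - bet n) (2 - bets)) => //.
    by case/andP: bets02; lra.
  by apply: cvgB => //; exact: cvg_cst.
apply: cvg_near_eq (cvgy_inv H); near=> n; exact: powRN.
Unshelve. all: by end_near. Qed.

Let mu_y n : mu n `^ bet n = mu n ^+ 2 * y n.
Proof. by rewrite (powR_sqr_split (bet n) (mu0 n)) /y opprB. Qed.

Let muV_cvg0 : (fun n => (mu n)^-1) @ \oo --> (0 : R).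
Proof. exact: cvgy_inv. Qed.

(* [gs s] is the lower bound of [f (th s) / f mu] provided by [nonlin_ratio]; it
   tends to [expR (zlim s)]. *)
Let th s n := w n (rho n + gam n * s).
Let zs s n := 2 * mu n * (th s n - mu n).
Let gs s n := th s n / mu n *
  expR (- ((mu n ^+ 2 - th s n ^+ 2) * (1 + alpha * mu n `^ (bet n - 2)))).

Let thE s n : th s n = mu n + zs s n / 2 * (mu n)^-1.
Proof. by rewrite /zs; field; rewrite gt_eqF. Qed.

Let zs_mu2 s : 0 < s -> (fun n => zs s n * (mu n)^-1 * (mu n)^-1) @ \oo --> (0 : R).
Proof.
move=> s0; have [_ zc] := z_cvg s0.
rewrite -(mulr0 (zlim s * 0)); apply: cvgM => //; exact: cvgM.
Qed.

Let th_ratio s : 0 < s -> (fun n => th s n / mu n) @ \oo --> (1 : R).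
Proof.
move=> s0.
apply: (@cvg_near_eq _ _ (fun n => 1 + 2^-1 * (zs s n * (mu n)^-1 * (mu n)^-1))).
  by apply: nearW => n; rewrite thE; field; rewrite gt_eqF.
rewrite -[X in _ --> X]addr0 -[X in _ + X](mulr0 (2^-1)).
by apply: cvgD; [exact: cvg_cst|apply: cvgMr; exact: zs_mu2].
Qed.

Let th_gt0 s : 0 < s -> \forall n \near \oo, 0 < th s n.
Proof.
move=> s0; have : \forall n \near \oo, 0 < th s n / mu n.
  exact: (cvgr_gt _ (th_ratio s0)).
by apply: filterS => n; rewrite pmulr_lgt0// invr_gt0.
Qed.

Let gs_cvg s : 0 < s -> gs s @ \oo --> expR (zlim s).
Proof.
move=> s0; have [_ zc] := z_cvg s0.
rewrite -[X in _ --> X]mul1r; apply: cvgM; first exact: th_ratio.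
apply: continuous_cvg; first exact: continuous_expR.
apply: (@cvg_near_eq _ _ (fun n => zs s n * (1 + 4^-1 * (zs s n * (mu n)^-1 * (mu n)^-1)) *
   (1 + alpha * y n))).
  apply: nearW => n; rewrite thE /y opprB.
  by move: (mu n `^ _) => t; field; rewrite gt_eqF.
have -> : zlim s = zlim s * (1 + 4^-1 * 0) * (1 + alpha * 0) by ring.
apply: cvgM; [apply: cvgM => //|]; apply: cvgD; try exact: cvg_cst.
  by apply: cvgMr; exact: zs_mu2.
exact: cvgMr.
Qed.

Let bub_drop s : 0 < s -> \forall n \near \oo,
  gs s n * (s ^+ 2 / 4) * (1 + rho n / (rho n + gam n * s)) <= - zs s n.
Proof.
move=> s0; have [hb _] := z_cvg s0.
near=> n.
have tb : rho n + gam n * s <= b n by near: n; exact: hb.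
have t0 : 0 < th s n by near: n; exact: th_gt0.
have gs0 : 0 < gam n * s by rewrite mulr_gt0.
have tm : th s n <= mu n.
  have /andP[ar rb] := arc_rho (warc n).
  have rr : rho n <= rho n + gam n * s by rewrite lerDl ltW.
  have ab : a n <= rho n + gam n * s <= b n by rewrite (le_trans ar).
  by have /andP[] := arc_range (warc n) ab.
have b2 : bet n <= 2 by case/andP: (bet02 n) => _ /ltW.
have D := arc_drop (warc n) gs0 tb; rewrite -/(th s n) in D.
have Rt := nonlin_ratio (ltW alpha0) b2 t0 tm.
rewrite -/(gs s n) in Rt.
set c := 1 + rho n / _ in D *.
have c0 : 0 <= c by rewrite addr_ge0// divr_ge0// addr_ge0// ltW.
have H1 : (2 * mu n)^-1 * gs s n * (s ^+ 2 / 4) * c <= mu n - th s n.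
  apply: le_trans D; apply: ler_wpM2r => //.
  rewrite -lam_gam.
  have -> : lam n * nonlin alpha (bet n) (mu n) * gam n ^+ 2 * gs s n * (s ^+ 2 / 4) =
     lam n * ((gam n * s) ^+ 2 / 4) * (nonlin alpha (bet n) (mu n) * gs s n) by ring.
  have -> : lam n * nonlin alpha (bet n) (th s n) * ((gam n * s) ^+ 2 / 4) =
     lam n * ((gam n * s) ^+ 2 / 4) * nonlin alpha (bet n) (th s n) by ring.
  rewrite ler_wpM2l// mulr_ge0 ?(ltW (lam0 n))// divr_ge0 ?sqr_ge0//.
have m2 : 0 < 2 * mu n by rewrite mulr_gt0.
have := ler_wpM2l (ltW m2) H1.
have -> : 2 * mu n * ((2 * mu n)^-1 * gs s n * (s ^+ 2 / 4) * c) =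
  gs s n * (s ^+ 2 / 4) * c by field; rewrite gt_eqF.
by move/le_trans; apply; rewrite /zs; lra.
Unshelve. all: by end_near. Qed.

(** The limit of [arc_drop] at scale [gam] reads
    [expR (zlim s) * (s ^+ 2 / 4) * (1 + t) <= - zlim s] for any limit point [t] of
    [rho / (rho + gam * s)].  Since [- zlim s <= s ^+ 2 / 4] and [expR (zlim s)] is
    [1] up to order [s ^+ 2], this gives [t <= 2 * s ^+ 2], and a small [s] shows that
    [rho] is small compared to [gam]. *)
Lemma bubble_center : (fun n => rho n / gam n) @ \oo --> (0 : R).
Proof.
apply/cvgrPdist_le => e e0.
pose s := Num.min e (1 / 2).
have s0 : 0 < s by rewrite lt_min e0 divr_gt0.
have s12 : s <= 1 / 2 by rewrite ge_min lexx orbT.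
have se : s <= e by rewrite ge_min lexx.
have [_ zc] := z_cvg s0.
set G := expR (zlim s).
have s2 : 0 < s ^+ 2 by rewrite exprn_gt0.
have p0 : 0 < 8 + s ^+ 2 by rewrite ltr_wpDr// sqr_ge0.
have GE : G = 64 / (8 + s ^+ 2) ^+ 2.
  by rewrite /G /zlim lnK// posrE divr_gt0// exprn_gt0.
have zE : - zlim s <= s ^+ 2 / 4.
  have p1 : 0 < 1 + s ^+ 2 / 8 by move: s2; lra.
  have -> : zlim s = - (ln (1 + s ^+ 2 / 8) *+ 2).
    rewrite -lnXn// -lnV ?posrE ?exprn_gt0// /zlim; congr ln.
    by field; rewrite !gt_eqF.
  have : ln (1 + s ^+ 2 / 8) <= s ^+ 2 / 8 by apply: le_ln1Dx; move: s2; lra.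
  by rewrite mulr2n; lra.
have G1 : 1 < (1 + 2 * s ^+ 2) * G.
  rewrite GE mulrA ltr_pdivlMr ?exprn_gt0// mul1r.
  have : s ^+ 2 <= 1 by rewrite -(expr1n R 2) ler_sqr ?nnegrE ?(ltW s0)//; move: s12; lra.
  by move: s2; move: (s ^+ 2) => t; nra.
have : (fun n => (1 + 2 * s ^+ 2) * gs s n * (s ^+ 2 / 4) + zs s n) @ \oo -->
    (1 + 2 * s ^+ 2) * G * (s ^+ 2 / 4) + zlim s.
  apply: cvgD => //; apply: cvgMl; apply: cvgMr; exact: gs_cvg.
have lim0 : 0 < (1 + 2 * s ^+ 2) * G * (s ^+ 2 / 4) + zlim s.
  have s4 : 0 < s ^+ 2 / 4 by rewrite divr_gt0.
  by have := ltr_pM2r s4 1 ((1 + 2 * s ^+ 2) * G); rewrite G1 mul1r; move: zE; lra.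
move=> /cvgr_gt/(_ _ lim0) H1.
have H2 := bub_drop s0.
have H3 : \forall n \near \oo, 0 < gs s n.
  by apply: (cvgr_gt _ (gs_cvg s0)); exact: expR_gt0.
near=> n.
have h1 : 0 < (1 + 2 * s ^+ 2) * gs s n * (s ^+ 2 / 4) + zs s n by near: n.
have h2 : gs s n * (s ^+ 2 / 4) * (1 + rho n / (rho n + gam n * s)) <= - zs s n by near: n.
have h3 : 0 < gs s n by near: n.
have d0 : 0 < rho n + gam n * s by rewrite ltr_wpDl// mulr_gt0.
have c2 : rho n / (rho n + gam n * s) < 2 * s ^+ 2.
  have g4 : 0 < gs s n * (s ^+ 2 / 4) by rewrite mulr_gt0// divr_gt0.
  rewrite -(ltr_pM2l g4); move: h1 h2; rewrite mulrDr mulr1; lra.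
rewrite sub0r normrN ger0_norm ?divr_ge0 ?(ltW (gam0 n))//.
apply: le_trans se; rewrite ler_pdivrMr//.
rewrite ltr_pdivrMr// in c2.
have r0 := rho0 n; have g0 := gam0 n.
have gs0 : 0 < gam n * s by rewrite mulr_gt0.
have s14 : s ^+ 2 <= 1 / 4.
  have -> : 1 / 4 = (1 / 2) ^+ 2 :> R by field.
  by rewrite ler_sqr ?nnegrE ?(ltW s0)// divr_ge0.
move: c2 r0 gs0 s14 s2; rewrite (mulrC s); move: (s ^+ 2) (gam n * s) (rho n) => S g r.
nra.
Unshelve. all: by end_near. Qed.

Let center := bubble_center.

Let s0 n := rho n + gam n * 1.
Let l n := ln (b n / s0 n).
(* The defect of the arc from a logarithm outside the core. *)
Let delta n := Q n (b n) * l n - th 1 n.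

Let s0_gt0 n : 0 < s0 n. Proof. by rewrite /s0 mulr1 ltr_wpDl. Qed.

Let delta_bound : \forall n \near \oo,
  0 <= delta n <= 8 * mu n * (mu n * Ms n - En n).
Proof.
have [hb _] := z_cvg ltr01.
have hg : \forall n \near \oo, 1 / 2 < gs 1 n.
  apply: (cvgr_gt _ (gs_cvg ltr01)).
  rewrite /zlim expr1n lnK ?posrE ?divr_gt0 ?exprn_gt0// ?ltr_wpDr//.
  rewrite ltr_pdivlMr ?exprn_gt0//; lra.
have ht := th_gt0 ltr01.
near=> n.
have sb : s0 n <= b n by near: n.
have g2 : 1 / 2 < gs 1 n by near: n.
have t0 : 0 < th 1 n by near: n.
have rs : rho n <= s0 n by rewrite /s0 mulr1 lerDl ltW.
have bn2 : bet n <= 2 by case/andP: (bet02 n) => _ /ltW.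
have tm : th 1 n <= mu n.
  have /andP[ar rb] := arc_rho (warc n).
  have ab : a n <= s0 n <= b n by rewrite (le_trans ar).
  by have /andP[] := arc_range (warc n) ab.
have d0 : 0 <= delta n.
  by rewrite subr_ge0; exact: arc_w_le_log (warc n) _ rs (s0_gt0 n) sb.
rewrite d0/=.
have Rt := nonlin_ratio (ltW alpha0) bn2 t0 tm.
rewrite -/(gs 1 n) in Rt.
have Qs : 1 / (8 * mu n) <= Q n (s0 n).
  apply: le_trans (arc_Q_lower (warc n) rs (lexx _) sb).
  rewrite -/(th 1 n).
  apply: (@le_trans _ _ (lam n * (nonlin alpha (bet n) (mu n) * gs 1 n) * (gam n ^+ 2 / 2))).
    have -> : lam n * (nonlin alpha (bet n) (mu n) * gs 1 n) * (gam n ^+ 2 / 2) =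
      lam n * nonlin alpha (bet n) (mu n) * gam n ^+ 2 * (gs 1 n / 2) by ring.
    rewrite lam_gam.
    have -> : 1 / (8 * mu n) = (2 * mu n)^-1 * (4^-1) by field; rewrite gt_eqF.
    by rewrite ler_wpM2l ?invr_ge0 ?mulr_ge0 ?(ltW (mu0 n))//; lra.
  apply: ler_pM => //.
  - by rewrite mulr_ge0 ?(ltW (lam0 n))// mulr_ge0 ?(ltW (lt_trans _ g2))// mulr_ge0 ?expR_ge0
    ?(ltW (mu0 n)).
  - by rewrite divr_ge0// sqr_ge0.
  - by rewrite ler_wpM2l ?(ltW (lam0 n)).
  rewrite ler_wpM2r// /s0 mulr1.
  have -> : (rho n + gam n) ^+ 2 - rho n ^+ 2 = gam n ^+ 2 + 2 * (rho n * gam n) by ring.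
  have := mulr_ge0 (rho0 n) (ltW (gam0 n)); lra.
have := gap rs (s0_gt0 n) sb; rewrite -/(th 1 n) -/(l n) -/(delta n) => G.
have m8 : 0 < 8 * mu n by rewrite mulr_gt0.
have := le_trans (ler_wpM2r d0 Qs) G.
by rewrite mulrAC mul1r ler_pdivrMr// mulrC.
Unshelve. all: by end_near. Qed.

Let gap_cvg0 : (fun n => (mu n * Ms n - En n) / y n) @ \oo --> (0 : R).
Proof.
rewrite -(subrr (0 : R)); apply: (@cvg_near_eq _ _ (fun n =>
  (mu n * Ms n - (2 - alpha * bets * y n)) / y n -
  (En n - (2 - alpha * bets * y n)) / y n)); last exact: cvgB.
by apply: nearW => n; field; rewrite gt_eqF.
Qed.

Let delta_cvg0 : (fun n => mu n * delta n / mu n `^ bet n) @ \oo --> (0 : R).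
Proof.
have H : (fun n => 8 * ((mu n * Ms n - En n) / y n)) @ \oo --> (0 : R).
  by rewrite -(mulr0 8); exact: cvgMr.
apply: (squeeze_cvgr _ (cvg_cst 0) H).
apply: filterS delta_bound => n /andP[d0 d1]; apply/andP; split.
  by rewrite divr_ge0 ?powR_ge0// mulr_ge0// ltW.
rewrite mu_y ler_pdivrMr ?mulr_gt0 ?exprn_gt0//.
have -> : 8 * ((mu n * Ms n - En n) / y n) * (mu n ^+ 2 * y n) =
  mu n * (8 * mu n * (mu n * Ms n - En n)) by field; rewrite gt_eqF.
by rewrite ler_wpM2l// ltW.
Qed.

Section with_left_flux.
Hypothesis left_small : (fun n => mu n * Q n (a n) / y n) @ \oo --> (0 : R).

Let q n := mu n * Q n (b n).

Let q_exp : (fun n => (2 - q n) / y n) @ \oo --> alpha * bets.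
Proof.
have -> : alpha * bets = alpha * bets - 0 - 0 by ring.
apply: (@cvg_near_eq _ _ (fun n => alpha * bets -
  (mu n * Ms n - (2 - alpha * bets * y n)) / y n - mu n * Q n (a n) / y n)).
  by apply: nearW => n; rewrite /q massE; field; rewrite gt_eqF.
by apply: cvgB => //; apply: cvgB => //; exact: cvg_cst.
Qed.

(** The mass is the outflux plus the influx.  With a negligible influx, its
    expansion is therefore one of [mu * Q b], whose leading term is [2]. *)
Lemma bubble_flux : q @ \oo --> (2 : R).
Proof.
have -> : 2 = 2 - alpha * bets * 0 :> R by ring.
apply: (@cvg_near_eq _ _ (fun n => 2 - (2 - q n) / y n * y n)).
  by apply: nearW => n; field; rewrite gt_eqF.
by apply: cvgB; [exact: cvg_cst|exact: cvgM].
Qed.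

Let z1 := (z_cvg ltr01).2.

Let qlE n : q n * l n = mu n ^+ 2 + zs 1 n / 2 + mu n * delta n.
Proof. by rewrite /q /delta thE; field; rewrite gt_eqF. Qed.

Let l_ratio : (fun n => l n / mu n ^+ 2) @ \oo --> (2^-1 : R).
Proof.
have q0 : \forall n \near \oo, 0 < q n by exact: (cvgr_gt _ bubble_flux).
have -> : 2^-1 = (1 + 2^-1 * 0 + 0 * 0) * 2^-1 :> R by ring.
apply: (@cvg_near_eq _ _ (fun n => (1 + 2^-1 * (zs 1 n * (mu n)^-1 * (mu n)^-1) +
   mu n * delta n / mu n `^ bet n * y n) * (q n)^-1)).
  near=> n; have qn : 0 < q n by near: n.
  have -> : l n = (mu n ^+ 2 + zs 1 n / 2 + mu n * delta n) / q n.
    by rewrite -qlE; field; rewrite gt_eqF.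
  by rewrite mu_y; field; rewrite !gt_eqF.
apply: cvgM; last by apply: cvgV => //; exact: bubble_flux.
apply: cvgD; last exact: cvgM.
apply: cvgD; [exact: cvg_cst|apply: cvgMr; exact: zs_mu2].
Unshelve. all: by end_near. Qed.

Let powV_cvg0 : (fun n => (mu n `^ bet n)^-1) @ \oo --> (0 : R).
Proof. by apply: cvgy_inv; apply: (@powR_cvgy _ mu bet bets) => //; case/andP: bets02. Qed.

Let l_exp : (fun n => (2 * l n - mu n ^+ 2) / mu n `^ bet n) @ \oo --> alpha * bets / 2.
Proof.
have -> : alpha * bets / 2 = 2^-1 * (alpha * bets) + 2^-1 * (zlim 1 * 0) + 0 by field.
apply: (@cvg_near_eq _ _ (fun n => l n / mu n ^+ 2 * ((2 - q n) / y n) +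
    2^-1 * (zs 1 n * (mu n `^ bet n)^-1) + mu n * delta n / mu n `^ bet n)).
  apply: nearW => n.
  have -> : 2 * l n - mu n ^+ 2 = l n * (2 - q n) + zs 1 n / 2 + mu n * delta n.
    by rewrite mulrBr [l n * q n]mulrC qlE; ring.
  by rewrite mu_y; field; rewrite !gt_eqF.
apply: cvgD => //; apply: cvgD; first exact: cvgM.
by apply: cvgMr; apply: cvgM.
Qed.

(** Let [l = ln (b / s0)] with [s0 = rho + gam].  The arc is a logarithm outside
    the core, so that [mu * Q b * l] is [mu ^+ 2 + o(mu `^ bet)]; with the second
    order expansion of [mu * Q b] this gives
    [2 * l = mu ^+ 2 + alpha * bets / 2 * mu `^ bet + o(mu `^ bet)].  The definition of
    [gam] gives
    [- 2 * ln gam = ln lam + mu ^+ 2 + alpha * mu `^ bet + O(ln mu)], and subtracting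
    leaves [alpha * (1 - bets / 2)]. *)
Lemma bubble_log : (fun n => (ln (1 / lam n) + 2 * ln (1 / b n)) / mu n `^ bet n)
  @ \oo --> alpha * (1 - bets / 2).
Proof.
have bets0 : 0 < bets by case/andP: bets02.
have le : (fun n => ln (1 + rho n / gam n)) @ \oo --> (0 : R).
  have -> : 0 = ln (1 + 0) :> R by rewrite addr0 ln1.
  apply: continuous_cvg; first by apply: continuous_ln; rewrite addr0.
  by apply: cvgD; [exact: cvg_cst|exact: center].
have -> : alpha * (1 - bets / 2) = alpha - alpha * bets / 2 + ln 2 * 0 + 2 * 0 - 2 * (0 * 0).
  by field.
apply: (@cvg_near_eq _ _ (fun n => alpha - (2 * l n - mu n ^+ 2) / mu n `^ bet n +
   ln 2 * (mu n `^ bet n)^-1 + 2 * (ln (mu n) / mu n `^ bet n) -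
   2 * (ln (1 + rho n / gam n) * (mu n `^ bet n)^-1))); last first.
  apply: cvgB; last by apply: cvgMr; exact: cvgM.
  apply: cvgD; last by apply: cvgMr; exact: ln_powR_cvg0 bet_cvg mu_oo.
  apply: cvgD; last exact: cvgMr.
  by apply: cvgB; [exact: cvg_cst|exact: l_exp].
apply: nearW => n.
have m0 := mu0 n; have g0 := gam0 n; have L0 := lam0 n.
have b0 : 0 < b n.
  have /andP[_ rb] := arc_rho (warc n); exact: le_lt_trans rb.
have e0 : 0 < 1 + rho n / gam n by rewrite ltr_pwDl// divr_ge0// ltW.
have lE : l n = ln (b n) - ln (gam n) - ln (1 + rho n / gam n).
  rewrite /l ln_div ?posrE//.
  have -> : s0 n = gam n * (1 + rho n / gam n) by rewrite /s0; field; rewrite gt_eqF.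
  by rewrite lnM ?posrE//; ring.
have E := congr1 (@ln R) (gamE n).
rewrite ln1 /nonlin (gtr0_norm m0) in E.
rewrite !lnM ?posrE ?mulr_gt0 ?expR_gt0 ?exprn_gt0// in E.
rewrite expRK in E.
rewrite ln_div ?posrE// ln_div ?posrE// !ln1 lE.
have P0 : mu n `^ bet n != 0 by rewrite gt_eqF// powR_gt0.
move: E P0; move: (mu n `^ bet n) => p E P0.
have E1 : ln (lam n) = - (ln 2 + ln (mu n) + ln (mu n) + mu n ^+ 2 + alpha * p + 2 * ln (gam n)).
  move: E; lra.
by rewrite E1; field.
Qed.

End with_left_flux.

End bubble.

(** * Consecutive bubbles and the necks between them *)

Lemma ln_le (R : realType) (x y : R) : 0 < x -> x <= y -> ln x <= ln y.
Proof. by move=> x0 xy; rewrite ler_ln ?posrE//; exact: lt_le_trans xy. Qed.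

Lemma cvg_Cloc_pointwise (R : realType) (m : nat) (J : set R) (D : nat -> set R)
    (fn : nat -> R -> R) (f : R -> R) (s : R) : J s ->
  cvg_Cloc m J D fn f ->
  (\forall n \near \oo, D n s) /\ (fun n => fn n s) @ \oo --> f s.
Proof.
move=> Js [_ /(_ s s)]; rewrite set_itv1 => /(_ _)[]; first by move=> _ ->.
move=> Dn /(_ 0%N (leq0n _)); rewrite uniform_set1 => H; split => //.
by apply: filterS Dn => n [sD _]; exact: sD.
Qed.

Section bubble_tower.
Context (R : realType) (alpha : R) (k : nat) (lams bets : R)
    (lam bet : nat -> R) (u P : nat -> R -> R)
    (r rho mu gam : nat -> nat -> R).
Hypotheses (alpha0 : 0 < alpha) (bets02 : 0 < bets < 2)
  (lam0 : forall n, 0 < lam n) (bet02 : forall n, 0 < bet n < 2)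
  (lam_cvg : lam @ \oo --> lams) (bet_cvg : bet @ \oo --> bets)
  (u0_gt0 : forall n, 0 < u n 0)
  (data : nodal_data alpha k lam bet u r rho mu gam)
  (uP : forall n, radial_flux (lam n) alpha (bet n) (u n) (P n)).

(** The flux that leaves the [i]-th interval through its outer node and enters the
    next one; the sign makes it positive. *)
Definition outflux (i n : nat) : R := (-1) ^+ i.-1 * P n (r i n).

Let A := alpha * (1 - bets / 2).
Let A0 : 0 < A.
Proof. by rewrite mulr_gt0//; case/andP: bets02; lra. Qed.

Let bets0 : 0 < bets. Proof. by case/andP: bets02. Qed.

Let bet0 n : 0 < bet n. Proof. by case/andP: (bet02 n). Qed.

Lemma node_mono n i j : (i < j)%N -> (j <= k.+1)%N -> r i n < r j n.
Proof.
have [_ _ rS _] := data n.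
elim: j => // j IH; rewrite ltnS leq_eqVlt => /predU1P[->|ij] jk; first exact: rS.
by apply: lt_trans (rS _ jk); apply: IH => //; exact: ltnW.
Qed.

Lemma node_ge0 n i : (i <= k.+1)%N -> 0 <= r i n.
Proof.
have [r0 _ _ _] := data n; case: i => [|i] ik; first by rewrite r0.
by rewrite -r0 ltW// node_mono.
Qed.

Lemma node_gt0 n i : (0 < i)%N -> (i <= k.+1)%N -> 0 < r i n.
Proof. by have [r0 _ _ _] := data n; move=> i0 ik; rewrite -r0 node_mono. Qed.

Lemma node_le1 n i : (i <= k.+1)%N -> r i n <= 1.
Proof.
have [_ r1 _ _] := data n; rewrite leq_eqVlt => /predU1P[->|ik]; first by rewrite r1.
by rewrite -r1 ltW// node_mono.
Qed.

Section interval_facts.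
Variables (i n : nat).
Hypothesis ik : (1 <= i <= k.+1)%N.

Let i1k : (i.-1 < i)%N. Proof. by case/andP: ik => i0 _; rewrite prednK. Qed.
Let ik1 : (i <= k.+1)%N. Proof. by case/andP: ik. Qed.
Let aik : (i.-1 <= k.+1)%N. Proof. exact: leq_trans (leq_pred _) ik1. Qed.

Lemma node_lt : r i.-1 n < r i n. Proof. exact: node_mono. Qed.

Let a_zero : r i.-1 n = 0 -> i.-1 = 0%N.
Proof.
move=> a0; apply/eqP; rewrite -leqn0 leqNgt; apply/negP => i0.
by have := node_gt0 n i0 aik; rewrite a0 ltxx.
Qed.

Let ua : 0 < r i.-1 n -> u n (r i.-1 n) = 0.
Proof.
move=> a0; have [r0 _ _ H] := data n.
have i0 : (0 < i.-1)%N by rewrite lt0n; apply/eqP => E; move: a0; rewrite E r0 ltxx.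
by have [] := H i.-1 ltac:(by rewrite i0 aik).
Qed.

Let ua0 : r i.-1 n = 0 -> 0 <= (-1) ^+ i.-1 * u n (r i.-1 n).
Proof. by move=> E; rewrite E (a_zero E) expr0 mul1r ltW. Qed.

Lemma data_abs s : r i.-1 n <= s <= r i n -> `|u n s| = (-1) ^+ i.-1 * u n s.
Proof.
have [_ _ _ /(_ i ik)[ub us _ _ _]] := data n.
exact: (radial_abs (node_ge0 n aik) ub ua ua0 us).
Qed.

Lemma mu_gt0 : 0 < mu i n.
Proof. by have [_ _ _ /(_ i ik)[_ _ _ [] ]] := data n. Qed.

Lemma rho_itv : r i.-1 n <= rho i n < r i n.
Proof. by have [_ _ _ /(_ i ik)[]] := data n. Qed.

Lemma data_arc : arc (nonlin alpha (bet n)) (lam n) (mu i n) (r i.-1 n) (rho i n) (r i n)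
   (fun s => (-1) ^+ i.-1 * u n s) (fun s => (-1) ^+ i.-1 * P n s).
Proof.
have [_ _ _ /(_ i ik)[ub us rh [mu0 [muE umu]] _]] := data n.
exact: (radial_arc alpha0 (lam0 n) (bet0 n) (uP n) (node_ge0 n aik) (node_le1 n ik1) rh mu0 muE
  ub ua ua0 us umu).
Qed.

Lemma data_mass : Rintegral (@lebesgue_measure R) `[r i.-1 n, r i n]
     (fun s => lam n * nonlin alpha (bet n) `|u n s| * s) =
  (-1) ^+ i.-1 * P n (r i n) - (-1) ^+ i.-1 * P n (r i.-1 n).
Proof.
have [_ _ _ /(_ i ik)[ub us rh [mu0 [muE umu]] _]] := data n.
exact: (radial_mass alpha0 (lam0 n) (bet0 n) (uP n) (node_ge0 n aik) (node_le1 n ik1) rh mu0 muE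
  ub ua ua0 us umu).
Qed.

Lemma influxE : (-1) ^+ i.-1 * P n (r i.-1 n) = - outflux i.-1 n.
Proof.
rewrite /outflux; case: i ik => // -[|j] _ /=; last by rewrite exprS; ring.
by have [-> _ _ _] := data n; have [_ _ ->] := uP n; rewrite !mulr0 oppr0.
Qed.

Lemma data_gap s : rho i n <= s -> 0 < s -> s <= r i n ->
  (-1) ^+ i.-1 * P n s * ((-1) ^+ i.-1 * P n (r i n) * ln (r i n / s) -
     (-1) ^+ i.-1 * u n s) <=
  mu i n * Rintegral (@lebesgue_measure R) `[r i.-1 n, r i n]
     (fun s => lam n * nonlin alpha (bet n) `|u n s| * s) -
  dirichlet (u n) (r i.-1 n) (r i n).
Proof.
move=> rs s0 sb.
have [E [pE ->]] := radial_dirichlet (bet0 n) (uP n) (node_ge0 n aik) node_lt (node_le1 n ik1).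
have pE' : prim (r i.-1 n) (r i n) E (fun x => ((-1) ^+ i.-1 * P n x) ^+ 2 / x).
  by apply: prim_ext pE => x _; rewrite exprMn sqrr_sign mul1r.
by rewrite data_mass; exact: (arc_energy_gap data_arc rs s0 sb pE').
Qed.

Lemma gam_eq : 0 < gam i n /\
  1 = 2 * lam n * mu i n * nonlin alpha (bet n) (mu i n) * gam i n ^+ 2.
Proof. by have [_ _ _ /(_ i ik)[_ _ _ _]] := data n. Qed.

Lemma data_slope : derive_in `[r i.-1 n, r i n] (u n) (r i n) =
  - (-1) ^+ i.-1 * (outflux i n / r i n).
Proof.
rewrite (radial_slope (uP n) (node_ge0 n aik) node_lt (node_le1 n ik1)) /outflux.
by rewrite mulNr mulrA [_ * (_ * _)]mulrA -expr2 sqrr_sign mul1r.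
Qed.

End interval_facts.

Lemma outflux0 n : outflux 0 n = 0.
Proof.
by rewrite /outflux; have [-> _ _ _] := data n; have [_ _ ->] := uP n; rewrite mulr0.
Qed.

(** All that the neighbouring intervals see of a bubble. *)
Definition bubbled (i : nat) : Prop :=
  [/\ mu i @ \oo --> +oo,
      (fun n => mu i n * outflux i n) @ \oo --> (2 : R),
      (fun n => (ln (1 / lam n) + 2 * ln (1 / r i n)) / mu i n `^ bet n) @ \oo --> A &
      (fun n => rho i n / gam i n) @ \oo --> (0 : R)].

Section bubble_i.
Variable i : nat.
Hypothesis ik : (1 <= i <= k.+1)%N.
Hypothesis cE : condE alpha bets lam bet u r rho mu gam i.

Let z_cvg (s : R) : 0 < s ->
  (\forall n \near \oo, rho i n + gam i n * s <= r i n) /\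
  (fun n => 2 * mu i n * ((-1) ^+ i.-1 * u n (rho i n + gam i n * s) - mu i n))
     @ \oo --> zlim s.
Proof.
move=> s0; have [_ _ [zc _] _ _] := cE.
have Js : (`]0, +oo[%classic : set R) s by rewrite /= in_itv/= s0.
have [Dn zn] := cvg_Cloc_pointwise Js zc.
have Dn' : \forall n \near \oo, rho i n + gam i n * s <= r i n.
  apply: filterS Dn => n; rewrite /= in_itv/= => /andP[_].
  by have [g0 _] := gam_eq n ik; rewrite ler_pdivlMr// mulrC; lra.
split=> //; apply: cvg_near_eq zn; apply: filterS Dn' => n sr.
have [g0 _] := gam_eq n ik.
have /andP[ar rb] := rho_itv n ik.
rewrite /rescaled [gam i n * s + _]addrC (@data_abs i n ik)// sr andbT.
by rewrite (le_trans ar)// lerDl mulr_ge0// ltW.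
Qed.

Let mu_oo : mu i @ \oo --> +oo. Proof. by case: cE. Qed.

Let w n := fun s => (-1) ^+ i.-1 * u n s.
Let Q n := fun s => (-1) ^+ i.-1 * P n s.

Lemma condE_center : (fun n => rho i n / gam i n) @ \oo --> (0 : R).
Proof.
exact: (@bubble_center R alpha bets lam bet (r i.-1) (rho i) (r i) (mu i) (gam i)
  w Q alpha0 bets02 bet02 bet_cvg (fun n => data_arc n ik) (fun n => mu_gt0 n ik)
  (fun n => (gam_eq n ik).1) (fun n => (gam_eq n ik).2) mu_oo z_cvg).
Qed.

Lemma condE_bubbled :
  (fun n => mu i n * outflux i.-1 n / mu i n `^ (- (2 - bet n))) @ \oo --> (0 : R) ->
  bubbled i.
Proof.
move=> small.
have small' : (fun n => mu i n * Q n (r i.-1 n) / mu i n `^ (- (2 - bet n))) @ \oo --> (0 : R).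
  rewrite -oppr0; apply: cvg_near_eq (cvgN small).
  by apply: nearW => n; rewrite /Q influxE// mulrN mulNr.
have [_ _ _ En Ms] := cE.
split => //; last exact: condE_center.
  exact: (@bubble_flux R alpha bets bet (r i.-1) (r i) (mu i) _ Q bets02 bet_cvg
    (fun n => mu_gt0 n ik) mu_oo (fun n => data_mass n ik) Ms small').
exact: (@bubble_log R alpha bets lam bet (r i.-1) (rho i) (r i) (mu i) (gam i) _ _
  w Q alpha0 bets02 bet02 bet_cvg (fun n => data_arc n ik) (fun n => mu_gt0 n ik)
  (fun n => (gam_eq n ik).1) (fun n => (gam_eq n ik).2) mu_oo z_cvg (fun n => data_mass n ik)
  (fun n s => @data_gap i n ik s) En Ms small').
Qed.

End bubble_i.

Section neck.
Variable j : nat.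
Hypothesis jk : (1 <= j <= k)%N.

Let i := j.+1.
Let j0 : (0 < j)%N. Proof. by case/andP: jk. Qed.
Let jk' : (1 <= j <= k.+1)%N. Proof. by case/andP: jk => -> /leqW. Qed.
Let ik : (1 <= i <= k.+1)%N. Proof. by case/andP: jk. Qed.

Lemma neck_node_gt0 n : 0 < r j n.
Proof. by apply: node_gt0 => //; case/andP: jk'. Qed.

Lemma neck_rho_gt0 n : 0 < rho i n.
Proof. by have /andP[ar _] := rho_itv n ik; exact: lt_le_trans (neck_node_gt0 n) ar. Qed.

Lemma neck_rho_le1 n : rho i n <= 1.
Proof.
have /andP[_ rb] := rho_itv n ik; apply: le_trans (ltW rb) _.
by apply: node_le1; case/andP: ik.
Qed.

Let influx n : - ((-1) ^+ i.-1 * P n (r i.-1 n)) = outflux j n.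
Proof. by rewrite influxE// opprK. Qed.

Lemma neck_log n : mu i n <= outflux j n * ln (rho i n / r j n) <=
  mu i n + lam n * nonlin alpha (bet n) (mu i n) * rho i n ^+ 2 / 4.
Proof. by have := arc_left_log (data_arc n ik) (neck_node_gt0 n); rewrite influx. Qed.

Lemma neck_flux_le n :
  outflux j n <= lam n * nonlin alpha (bet n) (mu i n) * rho i n ^+ 2 / 2.
Proof. by have := arc_left_flux_le (data_arc n ik); rewrite influx. Qed.

Lemma neck_flux_ge n : r j n <= rho i n / 2 -> 0 <= mu i n - outflux j n * ln 2 ->
  3 / 8 * (lam n * nonlin alpha (bet n) (mu i n - outflux j n * ln 2) * rho i n ^+ 2)
  <= outflux j n.
Proof.
move=> h1 h2; have E : (-1) ^+ i.-1 * P n (r i.-1 n) = - outflux j n by rewrite influxE.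
have := arc_left_flux_ge (data_arc n ik) (neck_node_gt0 n) h1.
by rewrite E mulNr opprK; exact.
Qed.

Lemma ln_lam_lower : \forall n \near \oo, - ln (`|lams| + 1) <= ln (1 / lam n).
Proof.
have H : \forall n \near \oo, lam n < `|lams| + 1.
  by apply: (cvgr_lt _ lam_cvg); rewrite (le_lt_trans (ler_norm _))// ltrDl.
apply: filterS H => n h.
rewrite ln_div ?posrE// ln1 sub0r lerN2 ler_ln ?posrE ?ltW//.
Qed.

Hypothesis bj : bubbled j.

Let muj_oo : mu j @ \oo --> +oo. Proof. by case: bj. Qed.

Let muj_gt0 n : 0 < mu j n. Proof. exact: mu_gt0. Qed.
Let mui_gt0 n : 0 < mu i n. Proof. exact: mu_gt0. Qed.

Lemma outflux_bounds : \forall n \near \oo, 0 < outflux j n /\ outflux j n <= 3 / mu j n.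
Proof.
have [_ M2 _ _] := bj.
have H1 : \forall n \near \oo, 0 < mu j n * outflux j n by apply: (cvgr_gt _ M2).
have H2 : \forall n \near \oo, mu j n * outflux j n <= 3.
  by apply: (cvgr_le _ M2); lra.
near=> n; split.
  by rewrite -(pmulr_rgt0 _ (muj_gt0 n)); near: n.
by rewrite ler_pdivlMr// mulrC; near: n.
Unshelve. all: by end_near. Qed.

Let B := ln (3 * (A + 2) / 2).

(** In [neck_log] the influx is at most [3 / mu j], and
    [ln (1 / r j)] is at most a multiple of [mu j `^ bet] by the logarithmic balance
    of the previous bubble, because [ln (1 / lam)] is bounded below. *)
Lemma neck_upper : \forall n \near \oo,
  ln (mu i n) <= B + (bet n - 1) * ln (mu j n).
Proof.
have [_ _ L _] := bj.
have H1 : \forall n \near \oo,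
    (ln (1 / lam n) + 2 * ln (1 / r j n)) / mu j n `^ bet n <= A + 1.
  by apply: (cvgr_le _ L); lra.
have H2 := ln_lam_lower.
have H3 : \forall n \near \oo, ln (`|lams| + 1) < mu j n `^ bet n.
  exact: cvgy_near_gt (@powR_cvgy _ (mu j) bet bets bets0 bet_cvg muj_oo) _.
have H4 := outflux_bounds.
near=> n.
have h1 : (ln (1 / lam n) + 2 * ln (1 / r j n)) / mu j n `^ bet n <= A + 1 by near: n.
have h2 : - ln (`|lams| + 1) <= ln (1 / lam n) by near: n.
have h3 : ln (`|lams| + 1) < mu j n `^ bet n by near: n.
have [f0 f3] : 0 < outflux j n /\ outflux j n <= 3 / mu j n by near: n.
have p0 : 0 < mu j n `^ bet n by rewrite powR_gt0.
rewrite ler_pdivrMr// in h1.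
have l1 : ln (1 / r j n) <= (A + 2) / 2 * mu j n `^ bet n.
  by move: h1 h2 h3; move: (mu j n `^ _) => p; lra.
have /andP[n1 _] := neck_log n.
have l2 : ln (rho i n / r j n) <= ln (1 / r j n).
  rewrite ler_ln ?posrE ?divr_gt0 ?neck_rho_gt0 ?neck_node_gt0//.
  by rewrite ler_pM2r ?invr_gt0 ?neck_node_gt0// neck_rho_le1.
have l3 : mu i n <= 3 / mu j n * ((A + 2) / 2 * mu j n `^ bet n).
  apply: le_trans n1 _; apply: le_trans (ler_wpM2l (ltW f0) (le_trans l2 l1)) _.
  by rewrite ler_wpM2r// mulr_ge0 ?(ltW p0)//; move: A0; lra.
have A2 : 0 < 3 * (A + 2) / 2 by move: A0; lra.
have l4 : mu i n <= 3 * (A + 2) / 2 * mu j n `^ (bet n - 1).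
  rewrite powRB; last by apply/implyP => _; rewrite gt_eqF.
  rewrite powRr1 ?(ltW (muj_gt0 n))//; apply: le_trans l3 _.
  by rewrite le_eqVlt; apply/orP; left; apply/eqP; field; rewrite gt_eqF.
have := l4; rewrite -(@ler_ln R) ?posrE ?(mulr_gt0 A2) ?powR_gt0//.
by rewrite lnM ?posrE ?powR_gt0// ln_powR.
Unshelve. all: by end_near. Qed.

Section neck_bubble.
Hypothesis mui_oo : mu i @ \oo --> +oo.

Lemma neck_bet_gt1 : \forall n \near \oo, 1 < bet n.
Proof.
have H1 := neck_upper.
have H2 := cvgy_near_gt (ln_cvgy mui_oo) B.
have H3 := cvgy_near_gt (ln_cvgy muj_oo) 0.
near=> n.
have h1 : ln (mu i n) <= B + (bet n - 1) * ln (mu j n) by near: n.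
have h2 : B < ln (mu i n) by near: n.
have h3 : 0 < ln (mu j n) by near: n.
have : 0 < (bet n - 1) * ln (mu j n) by lra.
by rewrite pmulr_lgt0// subr_gt0.
Unshelve. all: by end_near. Qed.

(** Let [X = ln (mu i)], [Y = ln (mu j)] and [t = bet - 1].  The quantity is at most
    [3 * expR ((2 - t) * X - Y)], and [neck_upper] says that [Y >= (X - B) / t].
    The exponent is thus at most [- ((1 - t) ^+ 2 * X - B) / t], which tends to
    [-oo] because [t] stays away from [1]. *)
Lemma neck_left_small :
  (fun n => mu i n * outflux j n / mu i n `^ (- (2 - bet n))) @ \oo --> (0 : R).
Proof.
pose c := ((2 - bets) / 2) ^+ 2.
have c0 : 0 < c by rewrite exprn_gt0//; case/andP: bets02; lra.
have h0 : (fun n => 3 * expR (- (c * ln (mu i n) - B))) @ \oo --> (0 : R).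
  rewrite -(mulr0 3); apply: cvgMr.
  apply: (@cvg_near_eq _ _ (fun n => (expR (c * ln (mu i n) - B))^-1)).
    by apply: nearW => n; rewrite expRN.
  apply: cvgy_inv; apply/cvgryPgt => t.
  apply: filterS (cvgy_near_gt (ln_cvgy mui_oo) ((t + B) / c)) => n.
  rewrite ltr_pdivrMr// mulrC => H.
  by apply: lt_le_trans (expR_ge1Dx _); lra.
apply: (squeeze_cvgr _ (cvg_cst 0) h0).
have H1 := neck_upper.
have H2 := cvgy_near_gt (ln_cvgy mui_oo) (B / c).
have H2' := cvgy_near_gt (ln_cvgy mui_oo) 0.
have H4 := outflux_bounds.
have H5 := neck_bet_gt1.
have H6 : \forall n \near \oo, (2 - bets) / 2 <= 2 - bet n.
  have : (fun n => 2 - bet n) @ \oo --> 2 - bets by apply: cvgB => //; exact: cvg_cst.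
  by move=> /cvgr_ge; apply; case/andP: bets02; lra.
near=> n.
have h1 : ln (mu i n) <= B + (bet n - 1) * ln (mu j n) by near: n.
have h2 : B / c < ln (mu i n) by near: n.
have h2' : 0 < ln (mu i n) by near: n.
have [f0 f3] : 0 < outflux j n /\ outflux j n <= 3 / mu j n by near: n.
have h5 : 1 < bet n by near: n.
have h6 : (2 - bets) / 2 <= 2 - bet n by near: n.
rewrite ltr_pdivrMr// mulrC in h2.
have y0 : 0 < mu i n `^ (- (2 - bet n)) by rewrite powR_gt0.
apply/andP; split.
  by rewrite divr_ge0 ?(ltW y0)// mulr_ge0 ?(ltW (mui_gt0 n)) ?(ltW f0).
apply: (@le_trans _ _ (3 * (mu i n / mu j n / mu i n `^ (- (2 - bet n))))).
  have -> : 3 * (mu i n / mu j n / mu i n `^ (- (2 - bet n))) =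
    mu i n * (3 / mu j n) / mu i n `^ (- (2 - bet n)) by ring.
  by rewrite ler_pM2r ?invr_gt0// ler_pM2l.
rewrite ler_pM2l//.
have -> : mu i n / mu j n / mu i n `^ (- (2 - bet n)) =
    expR ((3 - bet n) * ln (mu i n) - ln (mu j n)).
  rewrite powRN invrK /powR (gt_eqF (mui_gt0 n)).
  rewrite -{1}(lnK (mui_gt0 n)) -{1}(lnK (muj_gt0 n)) -expRN -!expRD.
  by congr expR; ring.
rewrite ler_expR.
move: h1 h2 h2' h5 h6; set X := ln (mu i n); set Y := ln (mu j n).
set t := bet n - 1; rewrite /c => h1 h2 h2' h5 h6.
have t0 : 0 < t by rewrite subr_gt0.
have t1 : t < 1 by have /andP[_] := bet02 n; rewrite /t; lra.
have E1 : (X - B) / t <= Y by rewrite ler_pdivrMr// mulrC; lra.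
have cS : c <= (1 - t) ^+ 2.
  rewrite /c ler_sqr ?nnegrE; first by rewrite /t; lra.
    by case/andP: bets02; lra.
  by lra.
have E2 : c * X <= (1 - t) ^+ 2 * X by rewrite ler_wpM2r// ltW.
have E3 : 0 <= ((1 - t) ^+ 2 * X - B) by move: E2 h2; rewrite /c; lra.
have E4 : ((1 - t) ^+ 2 * X - B) <= ((1 - t) ^+ 2 * X - B) / t.
  by rewrite ler_pdivlMr// ler_piMr// ltW.
have E5 : (3 - bet n) * X - (X - B) / t = - (((1 - t) ^+ 2 * X - B) / t).
  by rewrite (_ : bet n = t + 1); [field; rewrite gt_eqF|rewrite /t; ring].
by move: E1 E2 E4 E5; rewrite /c; lra.
Unshelve. all: by end_near. Qed.

Lemma neck_ratio : (fun n => mu i n / mu j n) @ \oo --> (0 : R).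
Proof.
have [_ M2 _ _] := bj.
have H : (fun n => mu i n * outflux j n) @ \oo --> (0 : R).
  rewrite -(mulr0 0); apply: (@cvg_near_eq _ _ (fun n =>
    mu i n * outflux j n / mu i n `^ (- (2 - bet n)) * mu i n `^ (- (2 - bet n)))).
    by apply: nearW => n; rewrite divfK// gt_eqF// powR_gt0.
  apply: cvgM; first exact: neck_left_small.
  apply: (@cvg_near_eq _ _ (fun n => (mu i n `^ (2 - bet n))^-1)).
    by apply: nearW => n; rewrite powRN.
  apply: cvgy_inv; apply: (@powR_cvgy _ (mu i) (fun n => 2 - bet n) (2 - bets)) => //.
    by case/andP: bets02; lra.
  by apply: cvgB => //; exact: cvg_cst.
have -> : 0 = 0 * 2^-1 :> R by rewrite mul0r.
apply: (@cvg_near_eq _ _ (fun n => mu i n * outflux j n * (mu j n * outflux j n)^-1)).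
  have H4 := outflux_bounds; near=> n.
  have [f0 _] : 0 < outflux j n /\ outflux j n <= 3 / mu j n by near: n.
  by field; rewrite !gt_eqF.
by apply: cvgM => //; apply: cvgV.
Unshelve. all: by end_near. Qed.

End neck_bubble.

Let lmr n := lam n * nonlin alpha (bet n) (mu i n) * rho i n ^+ 2.

(** The influx acts as a current and the height as a voltage across the neck: the
    mass between node and maximum only perturbs their proportionality. *)
Lemma neck_voltage : (fun n => lmr n / mu i n) @ \oo --> (0 : R) ->
  (fun n => outflux j n * ln (rho i n / r j n) / mu i n) @ \oo --> (1 : R).
Proof.
move=> l0.
have H : (fun n => 1 + 4^-1 * (lmr n / mu i n)) @ \oo --> (1 : R).
  rewrite -[X in _ --> X]addr0 -[X in _ + X](mulr0 4^-1).
  by apply: cvgD; [exact: cvg_cst|exact: cvgMr].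
have c1 : (fun=> 1 : R) @ \oo --> (1 : R) by exact: cvg_cst.
apply: (squeeze_cvgr _ c1 H); apply: nearW => n.
have /andP[n1 n2] := neck_log n; apply/andP; split.
  by rewrite ler_pdivlMr// mul1r.
rewrite ler_pdivrMr//; apply: le_trans n2 _.
by rewrite /lmr le_eqVlt; apply/orP; left; apply/eqP; field; rewrite gt_eqF.
Qed.

Let logrho n := ln (1 / rho i n).

Let logsplit n : ln (rho i n / r j n) = ln (1 / r j n) - logrho n.
Proof.
have r0 := neck_node_gt0 n; have p0 := neck_rho_gt0 n.
by rewrite /logrho !ln_div ?posrE// ln1; ring.
Qed.

(** Since [mu j * M j --> 2], the quotient [mu i * mu j / mu j `^ bet] is, by
    [neck_voltage], asymptotic to [2 * ln (rho i / r j) / mu j `^ bet], and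
    [ln (1 / r j) / mu j `^ bet --> A / 2].  The contribution of [ln (1 / rho i)]
    must be negligible with respect to one side of this relation; which side
    depends on whether the interval [i] blows up. *)
Lemma neck_recursion :
  (fun n => lmr n / mu i n) @ \oo --> (0 : R) ->
  (fun n => ln (1 / lam n) / mu j n `^ bet n) @ \oo --> (0 : R) ->
  (fun n => logrho n / mu j n `^ bet n) @ \oo --> (0 : R) \/
  (fun n => logrho n / (mu i n * mu j n)) @ \oo --> (0 : R) ->
  (fun n => mu i n / mu j n `^ (bet n - 1)) @ \oo --> A.
Proof.
move=> l0 L0 R0.
have [_ M2 L _] := bj.
have V := neck_voltage l0.
have p0 n : 0 < mu j n `^ bet n by rewrite powR_gt0.
have Jc : (fun n => ln (1 / r j n) / mu j n `^ bet n) @ \oo --> 2^-1 * A.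
  have -> : 2^-1 * A = 2^-1 * (A - 0) by rewrite subr0.
  apply: (@cvg_near_eq _ _ (fun n => 2^-1 *
   ((ln (1 / lam n) + 2 * ln (1 / r j n)) / mu j n `^ bet n - ln (1 / lam n) / mu j n `^ bet n))).
    by apply: nearW => n; field; rewrite gt_eqF.
  by apply: cvgMr; exact: cvgB.
have TE n : mu i n / mu j n `^ (bet n - 1) = mu i n * mu j n / mu j n `^ bet n.
  rewrite powRB; last by apply/implyP => _; rewrite gt_eqF.
  by rewrite powRr1 ?(ltW (muj_gt0 n))//; field; rewrite !gt_eqF.
pose K n := outflux j n * ln (rho i n / r j n) / mu i n.
case: R0 => R0.
  have K0 : \forall n \near \oo, 0 < K n by exact: (cvgr_gt _ V).
  have -> : A = 2 * (2^-1 * A - 0) * 1^-1 by field.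
  apply: (@cvg_near_eq _ _ (fun n => mu j n * outflux j n *
    (ln (1 / r j n) / mu j n `^ bet n - logrho n / mu j n `^ bet n) * (K n)^-1)).
    near=> n; rewrite TE; have Kn : 0 < K n by near: n.
    apply: (mulIf (lt0r_neq0 Kn)); rewrite divfK ?gt_eqF// /K logsplit.
    by field; rewrite !gt_eqF.
  apply: cvgM; last by apply: cvgV => //; exact: oner_neq0.
  by apply: cvgM => //; exact: cvgB.
have Dc : (fun n => K n + mu j n * outflux j n * (logrho n / (mu i n * mu j n))) @ \oo --> (1 : R).
  rewrite -[X in _ --> X]addr0 -[X in _ + X](mulr0 2).
  by apply: cvgD => //; exact: cvgM.
have D0 : \forall n \near \oo, 0 < K n + mu j n * outflux j n * (logrho n / (mu i n * mu j n)).
  exact: (cvgr_gt _ Dc).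
have -> : A = 2 * (2^-1 * A) * 1^-1 by field.
apply: (@cvg_near_eq _ _ (fun n => mu j n * outflux j n *
    (ln (1 / r j n) / mu j n `^ bet n) *
   (K n + mu j n * outflux j n * (logrho n / (mu i n * mu j n)))^-1)).
  near=> n; rewrite TE.
  have Dn : 0 < K n + mu j n * outflux j n * (logrho n / (mu i n * mu j n)) by near: n.
  apply: (mulIf (lt0r_neq0 Dn)); rewrite divfK ?gt_eqF// /K logsplit.
  by field; rewrite !gt_eqF.
apply: cvgM; last by apply: cvgV => //; exact: oner_neq0.
exact: cvgM.
Unshelve. all: by end_near. Qed.

(** A ratio [rho i / r j] bounded by [2] would leave the height below
    [3 * ln 2 / mu j], which tends to [0]. *)
Lemma neck_far (c : R) : 0 < c -> (\forall n \near \oo, c <= mu i n) ->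
  \forall n \near \oo, r j n <= rho i n / 2.
Proof.
move=> c0 Hc; have H1 := outflux_bounds; have H2 := cvgy_near_gt muj_oo (3 * ln 2 / c).
near=> n.
have h0 : c <= mu i n by near: n.
have [f0 f3] : 0 < outflux j n /\ outflux j n <= 3 / mu j n by near: n.
have h2 : 3 * ln 2 / c < mu j n by near: n.
have r0 := neck_node_gt0 n; have p0 := neck_rho_gt0 n.
have /andP[n1 _] := neck_log n.
have rr : ln 2 <= ln (rho i n / r j n).
  rewrite leNgt; apply/negP => lt2.
  have l20 : 0 < ln 2 :> R by rewrite ln_gt0// ltr1n.
  have a1 : mu i n <= 3 / mu j n * ln 2.
    apply: le_trans n1 _; apply: le_trans (ler_wpM2l (ltW f0) (ltW lt2)) _.
    by rewrite ler_wpM2r// ltW.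
  have a2 : mu i n * mu j n <= 3 * ln 2.
    by rewrite -ler_pdivlMr//; apply: le_trans a1 _; rewrite mulrAC.
  rewrite ltr_pdivrMr// in h2.
  have := ler_wpM2l (ltW (muj_gt0 n)) h0.
  by move: h2 a2; lra.
rewrite ler_ln ?posrE ?divr_gt0// ler_pdivlMr// in rr.
by rewrite ler_pdivlMr// mulrC.
Unshelve. all: by end_near. Qed.

Section neck_to_bubble.
Hypothesis bi : bubbled i.

Let mui_oo : mu i @ \oo --> +oo. Proof. by case: bi. Qed.

(* The definition of [gam] makes this [2 * mu i] times [lam * f (mu i) * rho i ^+ 2]. *)
Let e n := (rho i n / gam i n) ^+ 2.

Let e_gt0 n : 0 < e n.
Proof. by rewrite exprn_gt0// divr_gt0 ?neck_rho_gt0//; have [] := gam_eq n ik. Qed.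

Let e_cvg0 : e @ \oo --> (0 : R).
Proof.
have [_ _ _ c] := bi.
rewrite -(mulr0 0); apply: (@cvg_near_eq _ _ (fun n => rho i n / gam i n * (rho i n / gam i n))).
  by apply: nearW => n; rewrite -expr2.
exact: cvgM.
Qed.

Let lmrE n : lmr n = e n / (2 * mu i n).
Proof.
have [g0 gE] := gam_eq n ik.
have -> : (2 * mu i n)^-1 = lam n * nonlin alpha (bet n) (mu i n) * gam i n ^+ 2.
  apply/(mulfI (lt0r_neq0 (mulr_gt0 (ltr0Sn R 1) (mui_gt0 n)))).
  by rewrite divff ?gt_eqF ?mulr_gt0//; apply: etrans gE _; ring.
by rewrite /lmr /e; field; rewrite gt_eqF.
Qed.

Let muV_cvg0 : (fun n => (mu i n)^-1) @ \oo --> (0 : R).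
Proof. exact: cvgy_inv. Qed.

Let lmr_cvg0 : (fun n => lmr n / mu i n) @ \oo --> (0 : R).
Proof.
have -> : 0 = 2^-1 * (0 * 0) * 0 :> R by ring.
apply: (@cvg_near_eq _ _ (fun n => 2^-1 * (e n * (mu i n)^-1) * (mu i n)^-1)).
  by apply: nearW => n; rewrite lmrE; field; rewrite gt_eqF.
by apply: cvgM => //; apply: cvgMr; exact: cvgM.
Qed.

Let flux_e : \forall n \near \oo,
  3 / 64 * e n <= mu i n * outflux j n /\ mu i n * outflux j n <= e n.
Proof.
(* With [e <= d] the profile between [rho / 2] and [rho] is so close to its maximum
   that [f] loses at most a factor [4] there. *)
pose d := (4 * (1 + alpha))^-1.
have d0 : 0 < d by rewrite invr_gt0 mulr_gt0// ltr_wpDr// ltW.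
have H1 := outflux_bounds.
have H2 : \forall n \near \oo, e n < d by exact: (cvgr_lt _ e_cvg0).
have H3 := cvgy_near_gt mui_oo 1.
have H4 : \forall n \near \oo, r j n <= rho i n / 2.
  by apply: (neck_far ltr01); apply: filterS H3 => n /ltW.
near=> n.
have m0 := mui_gt0 n.
have [f0 f3] : 0 < outflux j n /\ outflux j n <= 3 / mu j n by near: n.
have h2 : e n < d by near: n.
have h3 : 1 < mu i n by near: n.
have h4 : r j n <= rho i n / 2 by near: n.
have up : mu i n * outflux j n <= e n / 4.
  have := neck_flux_le n; rewrite -/(lmr n) lmrE => /(ler_wpM2l (ltW m0)).
  move/le_trans; apply; rewrite le_eqVlt; apply/orP; left; apply/eqP.
  by field; rewrite gt_eqF.
split; last by apply: le_trans up _; have := e_gt0 n; lra.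
set M := outflux j n in f0 f3 up *.
have ln20 : 0 < ln 2 :> R by rewrite ln_gt0// ltr1n.
have ln21 : ln 2 <= 1 :> R.
  by have := @le_ln1Dx R 1; rewrite (_ : 1 + 1 = 2)//; apply; lra.
have d14 : d <= 1 / 4.
  rewrite /d -[leRHS]invrK div1r invrK lef_pV2 ?posrE ?mulr_gt0// ?ltr_wpDr ?ltW//.
  by move: alpha0; lra.
have muM : mu i n * M <= d / 4 by apply: le_trans up _; move: h2; lra.
have M1 : M <= mu i n * M by rewrite ler_peMl// ltW.
pose th := mu i n - M * ln 2.
have ML : M * ln 2 <= M by rewrite ler_piMr// ltW.
have ML0 : 0 < M * ln 2 by rewrite mulr_gt0.
have th2 : mu i n / 2 <= th by rewrite /th; lra.
have th0 : 0 < th by apply: lt_le_trans th2; rewrite divr_gt0.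
have thm : th <= mu i n by rewrite /th; lra.
have b2 : bet n <= 2 by case/andP: (bet02 n) => _ /ltW.
have Rt := nonlin_ratio (ltW alpha0) b2 th0 thm.
set g := th / mu i n * _ in Rt.
have g4 : 1 / 4 <= g.
  have -> : 1 / 4 = 1 / 2 * (1 / 2) :> R by field.
  apply: ler_pM => //; try by lra.
    by rewrite ler_pdivlMr//; lra.
  apply: le_trans (expR_ge1Dx _).
  set p := mu i n `^ _.
  have p1 : p <= 1.
    rewrite /p -[leRHS](powRr0 (mu i n)); apply: ler_powR; first exact: ltW.
    by move: b2; lra.
  have p0 : 0 <= p by exact: powR_ge0.
  have sq : mu i n ^+ 2 - th ^+ 2 <= 2 * (mu i n * M).
    have -> : mu i n ^+ 2 - th ^+ 2 = 2 * (mu i n * (M * ln 2)) - (M * ln 2) ^+ 2.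
      by rewrite /th; ring.
    have := ler_wpM2l (ltW m0) ML; have := sqr_ge0 (M * ln 2); lra.
  have sq0 : 0 <= mu i n ^+ 2 - th ^+ 2.
    by rewrite subr_ge0 ler_sqr ?nnegrE ?(ltW th0)// ltW.
  have ap : 1 + alpha * p <= 1 + alpha.
    by rewrite lerD2l ler_piMr// ltW.
  have ap0 : 0 <= 1 + alpha * p by rewrite addr_ge0// mulr_ge0// ltW.
  have : (mu i n ^+ 2 - th ^+ 2) * (1 + alpha * p) <= d / 2 * (1 + alpha).
    by apply: ler_pM => //; lra.
  have -> : d / 2 * (1 + alpha) = 1 / 8.
    by rewrite /d; field; apply: lt0r_neq0; move: alpha0; lra.
  lra.
have := neck_flux_ge h4 (ltW th0); rewrite -/M -/th => /(ler_wpM2l (ltW m0)).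
apply: le_trans.
have lr : lmr n / 4 <= lam n * nonlin alpha (bet n) th * rho i n ^+ 2.
  have -> : lmr n / 4 = lam n * (nonlin alpha (bet n) (mu i n) * (1 / 4)) * rho i n ^+ 2.
    by rewrite /lmr; field.
  rewrite ler_wpM2r ?sqr_ge0// ler_wpM2l ?(ltW (lam0 n))//.
  apply: le_trans Rt; rewrite ler_wpM2l// mulr_ge0 ?expR_ge0// ltW//.
have -> : 3 / 64 * e n = mu i n * (3 / 8 * (lmr n / 4)).
  by rewrite lmrE; field; rewrite gt_eqF.
by rewrite ler_wpM2l ?(ltW m0)// ler_wpM2l.
Unshelve. all: by end_near. Qed.

Let X n := ln (mu i n).
Let Y n := ln (mu j n).

(** By [flux_e], [2 * ln (rho i / gam i)] is [ln (mu i) + ln (outflux j)] up to a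
    constant, and [ln (outflux j)] is [- ln (mu j)] up to a constant; the definition
    of [gam i] expresses [ln (gam i)] through [mu i] and [lam]. *)
Lemma neck_rho_log : exists C, \forall n \near \oo,
  `|2 * logrho n - (mu i n ^+ 2 + alpha * mu i n `^ bet n - ln (1 / lam n) + X n + Y n)| <= C.
Proof.
have [_ M2 _ _] := bj.
have H1 : \forall n \near \oo, 1 <= mu j n * outflux j n.
  by apply: (cvgr_ge _ M2); lra.
have H2 : \forall n \near \oo, mu j n * outflux j n <= 3.
  by apply: (cvgr_le _ M2); lra.
have H3 := flux_e; have H4 := outflux_bounds.
exists (ln 2 + ln 3 + ln (64 / 3)).
near=> n.
have h1 : 1 <= mu j n * outflux j n by near: n.
have h2 : mu j n * outflux j n <= 3 by near: n.
have [h3 h3'] : 3 / 64 * e n <= mu i n * outflux j n /\ mu i n * outflux j n <= e n by near: n.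
have [f0 f3] : 0 < outflux j n /\ outflux j n <= 3 / mu j n by near: n.
have m0 := mui_gt0 n; have m0' := muj_gt0 n; have [g0 gE] := gam_eq n ik.
have L0 := lam0 n; have p0 := neck_rho_gt0 n; have e0 := e_gt0 n.
have ln20 : 0 < ln 2 :> R by rewrite ln_gt0// ltr1n.
have a1 : 0 <= Y n + ln (outflux j n).
  by rewrite -lnM ?posrE// ln_ge0.
have a2 : Y n + ln (outflux j n) <= ln 3.
  by rewrite -lnM ?posrE//; apply: ln_le h2; exact: mulr_gt0.
have q0 : 0 < mu i n * outflux j n by exact: mulr_gt0.
have c0 : 0 < 64 / 3 :> R by lra.
have a3 : ln (e n) <= ln (64 / 3) + (X n + ln (outflux j n)).
  rewrite -lnM ?posrE// -lnM ?posrE//; apply: ln_le => //.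
  by move: h3; lra.
have a4 : X n + ln (outflux j n) <= ln (e n).
  by rewrite -lnM ?posrE//; exact: ln_le.
have a5 : ln (e n) = 2 * ln (rho i n) - 2 * ln (gam i n).
  by rewrite /e lnXn ?divr_gt0// ln_div ?posrE// mulr2n; ring.
have E := congr1 (@ln R) gE.
rewrite ln1 /nonlin (gtr0_norm m0) in E.
rewrite !lnM ?posrE ?mulr_gt0 ?expR_gt0 ?exprn_gt0// in E.
rewrite expRK -/(X n) in E.
have l3 : 0 <= ln 3 :> R by rewrite ln_ge0// ler1n.
have l4 : 0 <= ln (64 / 3) :> R by rewrite ln_ge0// ler_pdivlMr//; lra.
have lr : logrho n = - ln (rho i n) by rewrite /logrho ln_div ?posrE// ln1 sub0r.
have ll : ln (1 / lam n) = - ln (lam n) by rewrite ln_div ?posrE// ln1 sub0r.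
rewrite lr ll ler_norml; move: (mu i n `^ bet n) E => p E.
by apply/andP; split; move: E a1 a2 a3 a4 a5 ln20 l3 l4; lra.
Unshelve. all: by end_near. Qed.

Hypothesis lam_i : exists l0 : R, (fun n => ln (1 / lam n) / mu i n `^ bet n) @ \oo --> l0.

Lemma neck_rho_asym : (fun n => (2 * logrho n - Y n) / mu i n ^+ 2) @ \oo --> (1 : R).
Proof.
have [C HC] := neck_rho_log; have [l0 Hl] := lam_i.
pose y n := mu i n `^ (- (2 - bet n)).
have yc : y @ \oo --> (0 : R).
  apply: (@cvg_near_eq _ _ (fun n => (mu i n `^ (2 - bet n))^-1)).
    by apply: nearW => n; rewrite /y powRN.
  apply: cvgy_inv; apply: (@powR_cvgy _ (mu i) (fun n => 2 - bet n) (2 - bets)) => //.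
    by case/andP: bets02; lra.
  by apply: cvgB => //; exact: cvg_cst.
have Xc : (fun n => X n / mu i n ^+ 2) @ \oo --> (0 : R).
  have b2 : (fun=> 2 : R) @ \oo --> (2 : R) by exact: cvg_cst.
  apply: cvg_near_eq (ln_powR_cvg0 (ltr0Sn R 1) b2 mui_oo).
  by apply: nearW => n; rewrite powR_mulrn// ltW.
have Cc : (fun n => C * ((mu i n)^-1 * (mu i n)^-1)) @ \oo --> (0 : R).
  have -> : 0 = C * (0 * 0) :> R by ring.
  by apply: cvgMr; exact: cvgM.
pose D n := 1 + (alpha - ln (1 / lam n) / mu i n `^ bet n) * y n + X n / mu i n ^+ 2.
have Dc : D @ \oo --> (1 : R).
  have -> : 1 = 1 + (alpha - l0) * 0 + 0 :> R by ring.
  apply: cvgD => //; apply: cvgD; first exact: cvg_cst.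
  by apply: cvgM => //; apply: cvgB => //; exact: cvg_cst.
have l1 : (fun n => D n - C * ((mu i n)^-1 * (mu i n)^-1)) @ \oo --> (1 : R).
  by rewrite -[X in _ --> X]subr0; exact: cvgB.
have l2 : (fun n => D n + C * ((mu i n)^-1 * (mu i n)^-1)) @ \oo --> (1 : R).
  by rewrite -[X in _ --> X]addr0; exact: cvgD.
apply: (squeeze_cvgr _ l1 l2); apply: filterS HC => n; rewrite ler_norml => /andP[c1 c2].
have m0 := mui_gt0 n.
have m2 : 0 < mu i n ^+ 2 by rewrite exprn_gt0.
have DE : D n = (mu i n ^+ 2 + alpha * mu i n `^ bet n - ln (1 / lam n) + X n) / mu i n ^+ 2.
  have yE : mu i n `^ bet n = mu i n ^+ 2 * y n.
    by rewrite (powR_sqr_split (bet n) m0) /y opprB.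
  by rewrite /D yE; field; rewrite !gt_eqF// powR_gt0.
have CE : C * ((mu i n)^-1 * (mu i n)^-1) = C / mu i n ^+ 2.
  by field; rewrite gt_eqF.
rewrite DE CE -mulrBl -mulrDl !ler_pM2r ?invr_gt0//.
by move: c1 c2; move: (mu i n `^ bet n) => p; lra.
Qed.

(** The ratio [mu i / mu j] tends to [0], hence so does
    [ln (1 / lam) / mu j `^ bet] once [ln (1 / lam) / mu i `^ bet] converges, and
    [ln (1 / rho i)], of order [mu i ^+ 2 + ln (mu j)], is negligible with respect
    to [mu i * mu j]. *)
Lemma neck_rec_bubble :
  (fun n => ln (1 / lam n) / mu j n `^ bet n) @ \oo --> (0 : R) /\
  (fun n => mu i n / mu j n `^ (bet n - 1)) @ \oo --> A.
Proof.
have Rt := neck_ratio mui_oo.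
have L0 : (fun n => ln (1 / lam n) / mu j n `^ bet n) @ \oo --> (0 : R).
  have [l0 Hl] := lam_i.
  rewrite -(mulr0 l0).
  apply: (@cvg_near_eq _ _
    (fun n => ln (1 / lam n) / mu i n `^ bet n * (mu i n / mu j n) `^ bet n)).
    apply: nearW => n; rewrite powRM ?invr_ge0 ?(ltW (mui_gt0 n)) ?(ltW (muj_gt0 n))//.
    have -> : (mu j n)^-1 `^ bet n = (mu j n `^ bet n)^-1.
      by rewrite -(powR_inv1 (ltW (muj_gt0 n))) -powRrM mulN1r powRN.
    by field; rewrite !gt_eqF// powR_gt0.
  apply: cvgM => //; rewrite -(powR0 (lt0r_neq0 bets0)); apply: cvg_powR => // n.
  by rewrite divr_ge0 ?(ltW (mui_gt0 n)) ?(ltW (muj_gt0 n)).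
split => //; apply: neck_recursion => //; right.
have Yc : (fun n => Y n / mu j n) @ \oo --> (0 : R).
  have b1 : (fun=> 1 : R) @ \oo --> (1 : R) by exact: cvg_cst.
  apply: cvg_near_eq (ln_powR_cvg0 ltr01 b1 muj_oo).
  by apply: nearW => n; rewrite powRr1// ltW.
have -> : 0 = 2^-1 * (1 * 0 + 0 * 0) :> R by ring.
apply: (@cvg_near_eq _ _ (fun n => 2^-1 * ((2 * logrho n - Y n) / mu i n ^+ 2 * (mu i n / mu j n) +
   Y n / mu j n * (mu i n)^-1))).
  by apply: nearW => n; field; rewrite !gt_eqF.
apply: cvgMr; apply: cvgD; last exact: cvgM.
by apply: cvgM => //; exact: neck_rho_asym.
Qed.

End neck_to_bubble.
End neck.

(** The influx into the first interval is [0]; the influx into each further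
    interval is negligible because the previous one is a bubble. *)
Lemma all_bubbled (m : nat) : (m <= k.+1)%N ->
  (forall i, (1 <= i <= m)%N -> condE alpha bets lam bet u r rho mu gam i) ->
  forall i, (1 <= i <= m)%N -> bubbled i.
Proof.
move=> mk cE; elim=> // -[|i] IH im.
  have m1k : (1 <= 1 <= k.+1)%N by [].
  apply: (condE_bubbled m1k (cE _ im)).
  by apply: cvg_near_eq (cvg_cst 0); apply: nearW => n /=; rewrite outflux0 mulr0 mul0r.
have im' : (1 <= i.+1 <= m)%N by case/andP: im => _ /ltnW.
have i2k : (i.+2 <= k.+1)%N by case/andP: im => _ im; exact: leq_trans im mk.
have ik : (1 <= i.+1 <= k)%N by rewrite -ltnS.
have ik' : (1 <= i.+2 <= k.+1)%N by [].
apply: (condE_bubbled ik' (cE _ im)).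
by apply: (neck_left_small ik (IH im')); have [] := cE _ im.
Qed.

End bubble_tower.

(** * Bubble towers in logarithmic form *)

Lemma cvg_ln (R : realType) (f : nat -> R) (c : R) : 0 < c ->
  f @ \oo --> c -> (fun n => ln (f n)) @ \oo --> ln c.
Proof. by move=> c0 fc; apply: continuous_cvg => //; exact: continuous_ln. Qed.

Lemma cvg_ln_ratio (R : realType) (f g : nat -> R) (c : R) : 0 < c ->
  (\forall n \near \oo, 0 < g n) -> (fun n => f n / g n) @ \oo --> c ->
  (fun n => ln (f n) - ln (g n)) @ \oo --> ln c.
Proof.
move=> c0 g0 fg; have H : \forall n \near \oo, 0 < f n / g n by exact: (cvgr_gt _ fg).
apply: cvg_near_eq (cvg_ln c0 fg); near=> n.
have gn : 0 < g n by near: n.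
have : 0 < f n / g n by near: n.
by rewrite pmulr_lgt0 ?invr_gt0// => fn; rewrite ln_div ?posrE.
Unshelve. all: by end_near. Qed.

Lemma cvg_expR (R : realType) (f : nat -> R) (l : R) :
  f @ \oo --> l -> (fun n => expR (f n)) @ \oo --> expR l.
Proof. by move=> fl; apply: continuous_cvg => //; exact: continuous_expR. Qed.

Lemma cvg_of_ln (R : realType) (f p g : nat -> R) (l : R) :
  (\forall n \near \oo, 0 < f n) -> (\forall n \near \oo, 0 < g n) ->
  (fun n => ln (f n) - p n * ln (g n)) @ \oo --> l ->
  (fun n => f n / g n `^ p n) @ \oo --> expR l.
Proof.
move=> f0 g0 H; apply: cvg_near_eq (cvg_expR H); near=> n.
have fn : 0 < f n by near: n.
have gn : 0 < g n by near: n.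
by rewrite expRB lnK ?posrE// /powR gt_eqF.
Unshelve. all: by end_near. Qed.

Lemma cvg_powR_of_ln (R : realType) (p g : nat -> R) (l : R) :
  (\forall n \near \oo, 0 < g n) ->
  (fun n => p n * ln (g n)) @ \oo --> l ->
  (fun n => g n `^ p n) @ \oo --> expR l.
Proof.
move=> g0 H; apply: cvg_near_eq (cvg_expR H); near=> n.
have gn : 0 < g n by near: n.
by rewrite /powR gt_eqF.
Unshelve. all: by end_near. Qed.

Lemma cvg_exprn (R : realType) (f : nat -> R) (l : R) (j : nat) :
  f @ \oo --> l -> (fun n => f n ^+ j) @ \oo --> l ^+ j.
Proof.
move=> fl; elim: j => [|j IH].
  by under eq_fun do rewrite expr0; rewrite expr0; exact: cvg_cst.
by under eq_fun do rewrite exprS; rewrite exprS; exact: cvgM.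
Qed.

Lemma cvgy_of_ratio (R : realType) (f g : nat -> R) (c : R) : 0 < c ->
  g @ \oo --> +oo -> (fun n => f n / g n) @ \oo --> c -> f @ \oo --> +oo.
Proof.
move=> c0 gy fg.
have H1 : \forall n \near \oo, c / 2 <= f n / g n by apply: (cvgr_ge _ fg); lra.
apply/cvgryPgt => t.
have H2 := cvgy_near_gt gy (2 / c * `|t|).
have H3 := cvgy_near_gt gy 0.
near=> n.
have h1 : c / 2 <= f n / g n by near: n.
have h2 : 2 / c * `|t| < g n by near: n.
have h3 : 0 < g n by near: n.
rewrite ler_pdivlMr// in h1; apply: lt_le_trans h1.
apply: (le_lt_trans (ler_norm t)).
have := ltr_pM2l (_ : 0 < c / 2) (2 / c * `|t|) (g n).
rewrite h2 => /(_ _)/esym; rewrite divr_gt0// => /(_ isT).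
by have -> : c / 2 * (2 / c * `|t|) = `|t| by field; rewrite gt_eqF.
Unshelve. all: by end_near. Qed.

(* Only sequences of real numbers from here on: [m] bubbles with heights [mu],
   outer fluxes [M], nodes [r] and maximum points [rho].  In [step] the relations
   between two consecutive bubbles depend on the size of [loglam] compared to the
   outer one, which is known for the outermost bubble and passes inwards. *)
Section tower.
Context (R : realType) (bets A : R) (bet loglam : nat -> R) (m : nat)
  (mu M r rho : nat -> nat -> R).
Hypotheses (bets02 : 0 < bets < 2) (A0 : 0 < A) (bet_cvg : bet @ \oo --> bets)
  (mu_gt0 : forall i n, (1 <= i <= m)%N -> 0 < mu i n)
  (r_gt0 : forall i n, (1 <= i <= m)%N -> 0 < r i n)
  (mu_oo : forall i, (1 <= i <= m)%N -> mu i @ \oo --> +oo)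
  (flux : forall i, (1 <= i <= m)%N -> (fun n => mu i n * M i n) @ \oo --> (2 : R))
  (logs : forall i, (1 <= i <= m)%N ->
     (fun n => (loglam n + 2 * ln (1 / r i n)) / mu i n `^ bet n) @ \oo --> A)
  (step : forall j, (1 <= j < m)%N ->
    (\forall n \near \oo, 1 < bet n) /\
    forall l : R, (fun n => loglam n / mu j.+1 n `^ bet n) @ \oo --> l ->
     [/\ (fun n => loglam n / mu j n `^ bet n) @ \oo --> (0 : R),
         (fun n => mu j.+1 n / mu j n `^ (bet n - 1)) @ \oo --> A &
         (fun n => (2 * ln (1 / rho j.+1 n) - ln (mu j n)) / mu j.+1 n ^+ 2) @ \oo --> (1 : R)]).

Let bets0 : 0 < bets. Proof. by case/andP: bets02. Qed.

Let X i n := ln (mu i n).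

Let mup_oo i : (1 <= i <= m)%N -> (fun n => mu i n `^ bet n) @ \oo --> +oo.
Proof. by move=> im; exact: (@powR_cvgy _ (mu i) bet bets bets0 bet_cvg (mu_oo im)). Qed.

Lemma tower_X_oo i : (1 <= i <= m)%N -> X i @ \oo --> +oo.
Proof. by move=> im; exact/ln_cvgy/mu_oo. Qed.

Section lam.
Variable l : R.
Hypothesis lm : (fun n => loglam n / mu m n `^ bet n) @ \oo --> l.

Lemma tower_lam i : (1 <= i <= m)%N ->
  exists l' : R, (fun n => loglam n / mu i n `^ bet n) @ \oo --> l'.
Proof.
move=> im.
suff H d : (d < m)%N -> exists l' : R, (fun n => loglam n / mu (m - d)%N n `^ bet n) @ \oo --> l'.
  have := H (m - i)%N; rewrite subKn; last by case/andP: im.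
  by apply; case/andP: im => i0 im; rewrite ltn_subrL i0 (leq_trans i0 im).
elim: d => [_|d IH dm]; first by exists l; rewrite subn0.
have [l' Hl'] := IH (ltnW dm).
have jm : (1 <= m - d.+1 < m)%N by rewrite subn_gt0 dm ltn_subrL/= (leq_trans _ dm).
have [_ /(_ l')] := step jm; rewrite subnSK; last exact: ltnW.
by move=> /(_ Hl')[H _ _]; exists 0.
Qed.

Lemma tower_step j : (1 <= j < m)%N ->
 [/\ (fun n => loglam n / mu j n `^ bet n) @ \oo --> (0 : R),
     (fun n => X j.+1 n - (bet n - 1) * X j n) @ \oo --> ln A &
     (fun n => (2 * ln (1 / rho j.+1 n) - X j n) / mu j.+1 n ^+ 2) @ \oo --> (1 : R)].
Proof.
move=> jm; have j1 : (1 <= j.+1 <= m)%N by case/andP: jm.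
have j0 : (1 <= j <= m)%N by case/andP: jm => -> /ltnW.
have [l' Hl'] := tower_lam j1; have [_ /(_ l' Hl')[H1 H2 H3]] := step jm.
split => //.
have g0 : \forall n \near \oo, 0 < mu j n `^ (bet n - 1).
  by apply: nearW => n; rewrite powR_gt0// mu_gt0.
apply: cvg_near_eq (cvg_ln_ratio A0 g0 H2).
by apply: nearW => n; rewrite ln_powR.
Qed.

End lam.

Section node.
Variable i : nat.
Hypothesis im : (1 <= i <= m)%N.
Hypothesis lam0 : (fun n => loglam n / mu i n `^ bet n) @ \oo --> (0 : R).

Let rlim : (fun n => ln (1 / r i n) / mu i n `^ bet n) @ \oo --> A / 2.
Proof.
have -> : A / 2 = 2^-1 * (A - 0) by rewrite subr0 mulrC.
apply: (@cvg_near_eq _ _ (fun n => 2^-1 *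
   ((loglam n + 2 * ln (1 / r i n)) / mu i n `^ bet n - loglam n / mu i n `^ bet n))).
  by apply: nearW => n; field; rewrite gt_eqF// powR_gt0// mu_gt0.
by apply: cvgMr; apply: cvgB => //; exact: logs.
Qed.

Let loglog (S : nat -> R) : (fun n => S n / mu i n `^ bet n) @ \oo --> A / 2 ->
  [/\ S @ \oo --> +oo & (fun n => ln (S n) - bet n * X i n) @ \oo --> ln (A / 2)].
Proof.
move=> H; have A2 : 0 < A / 2 by rewrite divr_gt0.
split; first exact: cvgy_of_ratio A2 (mup_oo im) H.
have g0 : \forall n \near \oo, 0 < mu i n `^ bet n.
  by apply: nearW => n; rewrite powR_gt0// mu_gt0.
apply: cvg_near_eq (cvg_ln_ratio A2 g0 H).
by apply: nearW => n; rewrite ln_powR.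
Qed.

(** The term [loglam] is negligible in [logs], which leaves
    [ln (1 / r i) ~ A / 2 * mu i `^ bet]. *)
Lemma tower_node : [/\ (fun n => ln (1 / r i n)) @ \oo --> +oo &
  (fun n => ln (ln (1 / r i n)) - bet n * X i n) @ \oo --> ln (A / 2)].
Proof. exact: loglog rlim. Qed.

(** [M i / r i] differs from [1 / r i] by a factor of order [1 / mu i], invisible
    after taking the logarithm twice. *)
Lemma tower_slope (d : nat -> R) :
  (\forall n \near \oo, d n = M i n / r i n) ->
  [/\ (fun n => ln (d n)) @ \oo --> +oo &
  (fun n => ln (ln (d n)) - bet n * X i n) @ \oo --> ln (A / 2)].
Proof.
move=> dE; apply: loglog.
have -> : A / 2 = A / 2 + ln 2 * 0 - 0 by ring.
have F := flux im; have F0 : \forall n \near \oo, 0 < mu i n * M i n by exact: (cvgr_gt _ F).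
apply: (@cvg_near_eq _ _ (fun n => ln (1 / r i n) / mu i n `^ bet n +
   ln (mu i n * M i n) * (mu i n `^ bet n)^-1 - X i n / mu i n `^ bet n)).
  near=> n.
  have -> : d n = M i n / r i n by near: n.
  have f0 : 0 < mu i n * M i n by near: n.
  have m0 := mu_gt0 n im; have r0 := r_gt0 n im.
  have M0 : 0 < M i n by rewrite -(pmulr_rgt0 _ m0).
  rewrite !ln_div ?posrE// ln1 lnM ?posrE// /X.
  by field; rewrite gt_eqF// powR_gt0.
apply: cvgB; last exact: ln_powR_cvg0 bets0 bet_cvg (mu_oo im).
apply: cvgD => //; apply: cvgM; first exact: cvg_ln.
exact: cvgy_inv (mup_oo im).
Unshelve. all: by end_near. Qed.

End node.

(** By the recursion, [ln (mu j)] is about [ln (mu j.+1) / (bet - 1)], and the lower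
    bound on [bet - 1] keeps this below a multiple of [ln (mu j.+1) ^+ 2], which is
    negligible with respect to [mu j.+1 ^+ 2]. *)
Lemma tower_rho j (c : R) : (1 <= j < m)%N -> 0 < c ->
  (\forall n \near \oo, c <= (bet n - 1) * X j.+1 n) ->
  (fun n => X j.+1 n - (bet n - 1) * X j n) @ \oo --> ln A ->
  (fun n => (2 * ln (1 / rho j.+1 n) - X j n) / mu j.+1 n ^+ 2) @ \oo --> (1 : R) ->
  (fun n => ln (1 / rho j.+1 n)) @ \oo --> +oo /\
  (fun n => ln (ln (1 / rho j.+1 n)) - 2 * X j.+1 n) @ \oo --> - ln 2.
Proof.
move=> jm c0 Hc HX Hr; have j1 : (1 <= j.+1 <= m)%N by case/andP: jm.
have j0 : (1 <= j <= m)%N by case/andP: jm => -> /ltnW.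
pose C := 1 - ln A + `|ln A|.
have Z : (fun n => X j.+1 n / mu j.+1 n) @ \oo --> (0 : R).
  have b1 : (fun=> 1 : R) @ \oo --> (1 : R) by exact: cvg_cst.
  apply: cvg_near_eq (ln_powR_cvg0 ltr01 b1 (mu_oo j1)).
  by apply: nearW => n; rewrite powRr1// ltW// mu_gt0.
have muV : (fun n => (mu j.+1 n)^-1) @ \oo --> (0 : R) by exact: cvgy_inv (mu_oo j1).
have up : (fun n => c^-1 * (X j.+1 n / mu j.+1 n) * (X j.+1 n / mu j.+1 n + C * (mu j.+1 n)^-1))
  @ \oo --> (0 : R).
  have -> : 0 = c^-1 * 0 * (0 + C * 0) :> R by ring.
  by apply: cvgM; [exact: cvgMr|apply: cvgD => //; exact: cvgMr].
have XX : (fun n => X j n / mu j.+1 n ^+ 2) @ \oo --> (0 : R).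
  have c00 : (fun=> 0 : R) @ \oo --> (0 : R) by exact: cvg_cst.
  apply: (squeeze_cvgr _ c00 up).
  have H1 : \forall n \near \oo, ln A - 1 <= X j.+1 n - (bet n - 1) * X j n.
    by apply: (cvgr_ge _ HX); lra.
  have H2 := cvgy_near_gt (tower_X_oo j1) 0.
  have H3 := cvgy_near_gt (tower_X_oo j0) 0.
  near=> n.
  have h1 : ln A - 1 <= X j.+1 n - (bet n - 1) * X j n by near: n.
  have h2 : 0 < X j.+1 n by near: n.
  have h3 : 0 < X j n by near: n.
  have h4 : c <= (bet n - 1) * X j.+1 n by near: n.
  have m0 : 0 < mu j.+1 n by exact: mu_gt0.
  have b0 : 0 < bet n - 1 by rewrite -(pmulr_lgt0 _ h2) (lt_le_trans c0).
  apply/andP; split; first by rewrite divr_ge0 ?sqr_ge0// ltW.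
  have -> : c^-1 * (X j.+1 n / mu j.+1 n) * (X j.+1 n / mu j.+1 n + C / mu j.+1 n) =
    c^-1 * X j.+1 n * (X j.+1 n + C) / mu j.+1 n ^+ 2.
    by field; rewrite !gt_eqF.
  rewrite ler_pM2r ?invr_gt0 ?exprn_gt0//.
  have h5 : (bet n - 1) * X j n <= X j.+1 n + C by move: h1 (normr_ge0 (ln A)); rewrite /C; lra.
  have h6 : c * X j n <= X j.+1 n * (X j.+1 n + C).
    apply: le_trans (ler_wpM2r (ltW h3) h4) _.
    by rewrite mulrAC mulrC ler_wpM2l// ltW.
  by rewrite -mulrA -[leLHS](mulKf (lt0r_neq0 c0)) ler_pM2l ?invr_gt0.
have Rl : (fun n => ln (1 / rho j.+1 n) / mu j.+1 n ^+ 2) @ \oo --> (2^-1 * (1 + 0) : R).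
  apply: (@cvg_near_eq _ _ (fun n => 2^-1 * ((2 * ln (1 / rho j.+1 n) - X j n) / mu j.+1 n ^+ 2 +
     X j n / mu j.+1 n ^+ 2))).
    by apply: nearW => n; field; rewrite gt_eqF// mu_gt0.
  by apply: cvgMr; exact: cvgD.
rewrite addr0 mulr1 in Rl.
have h20 : 0 < 2^-1 :> R by rewrite invr_gt0.
have m2 : (fun n => mu j.+1 n ^+ 2) @ \oo --> +oo.
  have b2 : (fun=> 2 : R) @ \oo --> (2 : R) by exact: cvg_cst.
  have := powR_cvgy (ltr0Sn R 1) b2 (mu_oo j1).
  by under eq_fun => n do rewrite powR_mulrn ?(ltW (mu_gt0 n j1))//.
split; first exact: cvgy_of_ratio h20 m2 Rl.
rewrite -lnV ?posrE//.
have g0 : \forall n \near \oo, 0 < mu j.+1 n ^+ 2.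
  by apply: nearW => n; rewrite exprn_gt0// mu_gt0.
apply: cvg_near_eq (cvg_ln_ratio h20 g0 Rl).
by apply: nearW => n; rewrite lnXn ?mu_gt0// mulr2n /X; ring.
Unshelve. all: by end_near. Qed.

End tower.

(** * Limits when the parameter vanishes *)

Section vanishing_limit.
Context (R : realType) (bets A : R) (bet loglam : nat -> R) (k : nat)
  (mu M r rho : nat -> nat -> R).
Hypotheses (bets02 : 0 < bets < 2) (A0 : 0 < A) (bet_cvg : bet @ \oo --> bets)
  (mu_gt0 : forall i n, (1 <= i <= k.+1)%N -> 0 < mu i n)
  (r_gt0 : forall i n, (1 <= i <= k.+1)%N -> 0 < r i n)
  (mu_oo : forall i, (1 <= i <= k.+1)%N -> mu i @ \oo --> +oo)
  (flux : forall i, (1 <= i <= k.+1)%N -> (fun n => mu i n * M i n) @ \oo --> (2 : R))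
  (logs : forall i, (1 <= i <= k.+1)%N ->
     (fun n => (loglam n + 2 * ln (1 / r i n)) / mu i n `^ bet n) @ \oo --> A)
  (step : forall j, (1 <= j < k.+1)%N ->
    (\forall n \near \oo, 1 < bet n) /\
    forall l : R, (fun n => loglam n / mu j.+1 n `^ bet n) @ \oo --> l ->
     [/\ (fun n => loglam n / mu j n `^ bet n) @ \oo --> (0 : R),
         (fun n => mu j.+1 n / mu j n `^ (bet n - 1)) @ \oo --> A &
         (fun n => (2 * ln (1 / rho j.+1 n) - ln (mu j n)) / mu j.+1 n ^+ 2) @ \oo --> (1 : R)])
  (lam_top : (fun n => loglam n / mu k.+1 n `^ bet n) @ \oo --> A).

Let bets0 : 0 < bets. Proof. by case/andP: bets02. Qed.
Let bets2 : 2 - bets != 0. Proof. by rewrite gt_eqF// subr_gt0; case/andP: bets02. Qed.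
Let top : (1 <= k.+1 <= k.+1)%N. Proof. by rewrite leqnn. Qed.
Let X i n := ln (mu i n).
Let Y n := ln (loglam n).

Let mup_oo i : (1 <= i <= k.+1)%N -> (fun n => mu i n `^ bet n) @ \oo --> +oo.
Proof. by move=> im; exact: (@powR_cvgy _ (mu i) bet bets bets0 bet_cvg (mu_oo im)). Qed.

Lemma loglam_oo : loglam @ \oo --> +oo.
Proof. exact: cvgy_of_ratio A0 (mup_oo top) lam_top. Qed.

Let loglam_gt0 : \forall n \near \oo, 0 < loglam n.
Proof. exact: cvgy_near_gt loglam_oo 0. Qed.

Let Y_oo : Y @ \oo --> +oo. Proof. exact/ln_cvgy/loglam_oo. Qed.

Let steps j := tower_step A0 mu_gt0 step lam_top (j := j).

Let Y_top : (fun n => Y n - bet n * X k.+1 n) @ \oo --> ln A.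
Proof.
have g0 : \forall n \near \oo, 0 < mu k.+1 n `^ bet n.
  by apply: nearW => n; rewrite powR_gt0// mu_gt0.
apply: cvg_near_eq (cvg_ln_ratio A0 g0 lam_top).
by apply: nearW => n; rewrite ln_powR.
Qed.

(* The geometric sum [1 + bets * (1 + p + ... + p ^+ (k - i))] with [p = bets - 1]. *)
Let E i := (2 - bets * (bets - 1) ^+ (k.+1 - i)) / (2 - bets).

Let betp j : (fun n => (bet n - 1) ^+ j) @ \oo --> (bets - 1) ^+ j.
Proof. by apply: cvg_exprn; apply: cvgB => //; exact: cvg_cst. Qed.

Let log_tower i : (1 <= i <= k.+1)%N ->
  (fun n => Y n - bet n * (bet n - 1) ^+ (k.+1 - i) * X i n) @ \oo --> E i * ln A.
Proof.
move=> im.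
suff H d : (d < k.+1)%N ->
   (fun n => Y n - bet n * (bet n - 1) ^+ d * X (k.+1 - d)%N n) @ \oo -->
     (2 - bets * (bets - 1) ^+ d) / (2 - bets) * ln A.
  have := H (k.+1 - i)%N; rewrite subKn; last by case/andP: im.
  by apply; case/andP: im => i0 _; rewrite ltn_subrL i0.
elim: d => [_|d IH dm].
  rewrite expr0 mulr1 divff// mul1r subn0.
  by under eq_fun do rewrite expr0 mulr1.
have jm : (1 <= k.+1 - d.+1 < k.+1)%N by rewrite subn_gt0 dm ltn_subrL.
have [_ H _] := steps jm; rewrite subnSK in H; last exact: ltnW.
have -> : (2 - bets * (bets - 1) ^+ d.+1) / (2 - bets) * ln A =
  (2 - bets * (bets - 1) ^+ d) / (2 - bets) * ln A + bets * (bets - 1) ^+ d * ln A.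
  by rewrite exprS; field.
apply: (@cvg_near_eq _ _ (fun n => (Y n - bet n * (bet n - 1) ^+ d * X (k.+1 - d)%N n) +
   bet n * (bet n - 1) ^+ d * (X (k.+1 - d)%N n - (bet n - 1) * X (k.+1 - d.+1)%N n))).
  by apply: nearW => n; rewrite exprS; ring.
apply: cvgD; first exact: IH (ltnW dm).
by apply: cvgM => //; exact: cvgM.
Qed.

Let kE i : (1 <= i <= k)%N -> (k - i + 1)%N = (k.+1 - i)%N.
Proof. by case/andP => _ ik; rewrite addn1 subSn. Qed.

Let ikW i : (1 <= i <= k)%N -> (1 <= i <= k.+1)%N.
Proof. by case/andP => -> /leqW. Qed.

Let ikL i : (1 <= i <= k)%N -> (1 <= i < k.+1)%N. Proof. by []. Qed.

Lemma vanishing_height i : (1 <= i <= k)%N ->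
  (fun n => loglam n / mu i n `^ (bet n * (bet n - 1) ^+ (k - i + 1))) @ \oo -->
  A `^ ((2 - bets * (bets - 1) ^+ (k - i + 1)) / (2 - bets)).
Proof.
move=> ik; rewrite kE// {2}/powR gt_eqF//.
apply: cvg_of_ln => //; last exact: log_tower (ikW ik).
by apply: nearW => n; exact: mu_gt0 (ikW ik).
Qed.

(** Nodes and slopes have the same double logarithm to this order, so one
    computation serves both. *)
Lemma vanishing_log (S : nat -> R) i : (1 <= i <= k)%N ->
  S @ \oo --> +oo -> (fun n => ln (S n) - bet n * X i n) @ \oo --> ln (A / 2) ->
  (fun n => loglam n / S n `^ ((bet n - 1) ^+ (k - i + 1))) @ \oo -->
  2 `^ ((bets - 1) ^+ (k - i + 1)) *
  A `^ ((2 - 2 * (bets - 1) ^+ (k - i + 1)) / (2 - bets)).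
Proof.
move=> ik S_oo SX; rewrite kE// /powR [2 == 0]gt_eqF// [A == 0]gt_eqF// -expRD.
apply: cvg_of_ln => //; first exact: cvgy_near_gt S_oo 0.
have -> : (bets - 1) ^+ (k.+1 - i) * ln 2 + (2 - 2 * (bets - 1) ^+ (k.+1 - i)) / (2 - bets) * ln A =
  E i * ln A - (bets - 1) ^+ (k.+1 - i) * ln (A / 2).
  by rewrite ln_div ?posrE// /E; field.
apply: (@cvg_near_eq _ _ (fun n => (Y n - bet n * (bet n - 1) ^+ (k.+1 - i) * X i n) -
  (bet n - 1) ^+ (k.+1 - i) * (ln (S n) - bet n * X i n))).
  by apply: nearW => n; rewrite /Y; ring.
apply: cvgB; first exact: log_tower (ikW ik).
by apply: cvgM.
Qed.

Lemma vanishing_node i : (1 <= i <= k)%N ->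
  (fun n => loglam n / ln (1 / r i n) `^ ((bet n - 1) ^+ (k - i + 1))) @ \oo -->
  2 `^ ((bets - 1) ^+ (k - i + 1)) *
  A `^ ((2 - 2 * (bets - 1) ^+ (k - i + 1)) / (2 - bets)).
Proof.
move=> ik; have [l0 _ _] := steps (ikL ik).
have [h1 h2] := tower_node bets02 A0 bet_cvg mu_gt0 mu_oo logs (ikW ik) l0.
exact: vanishing_log.
Qed.

Lemma vanishing_slope (d : nat -> R) i : (1 <= i <= k)%N ->
  (\forall n \near \oo, d n = M i n / r i n) ->
  (fun n => loglam n / ln (d n) `^ ((bet n - 1) ^+ (k - i + 1))) @ \oo -->
  2 `^ ((bets - 1) ^+ (k - i + 1)) *
  A `^ ((2 - 2 * (bets - 1) ^+ (k - i + 1)) / (2 - bets)).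
Proof.
move=> ik dE; have [l0 _ _] := steps (ikL ik).
have [h1 h2] := tower_slope bets02 A0 bet_cvg mu_gt0 r_gt0 mu_oo flux logs (ikW ik) l0 dE.
exact: vanishing_log.
Qed.

(** There is a bubble outside the [i]-th one, so the recursion bounds
    [(bet - 1) * ln (mu i)] below and [tower_rho] applies. *)
Lemma vanishing_top i : (2 <= i <= k)%N ->
  (fun n => loglam n / ln (1 / rho i n) `^ (bet n * (bet n - 1) ^+ (k - i + 1) / 2)) @ \oo -->
  2 `^ (bets * (bets - 1) ^+ (k - i + 1) / 2) *
  A `^ ((2 - bets * (bets - 1) ^+ (k - i + 1)) / (2 - bets)).
Proof.
case: i => // i /andP[i0 ik].
have ik1 : (1 <= i.+1 <= k)%N by rewrite ik.
have ij : (1 <= i < k.+1)%N by apply/andP; split; [exact: i0|exact: leqW].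
have [_ H1 H2] := steps ij.
have [_ H3 _] := steps (ikL ik1).
have Hc : \forall n \near \oo, 1 <= (bet n - 1) * X i.+1 n.
  have Z1 : \forall n \near \oo, X i.+2 n - (bet n - 1) * X i.+1 n <= ln A + 1.
    by apply: (cvgr_le _ H3); lra.
  have Z2 : \forall n \near \oo, ln A + 2 < X i.+2 n.
    by apply: cvgy_near_gt; apply/ln_cvgy/mu_oo.
  near=> n.
  have z1 : X i.+2 n - (bet n - 1) * X i.+1 n <= ln A + 1 by near: n.
  have z2 : ln A + 2 < X i.+2 n by near: n.
  by move: z1 z2; lra.
have [h1 h2] := tower_rho mu_gt0 mu_oo ij ltr01 Hc H1 H2.
rewrite kE// /powR [2 == 0]gt_eqF// [A == 0]gt_eqF// -expRD.
apply: cvg_of_ln => //; first exact: cvgy_near_gt h1 0.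
set j := (k.+1 - i.+1)%N.
have -> : bets * (bets - 1) ^+ j / 2 * ln 2 + (2 - bets * (bets - 1) ^+ j) / (2 - bets) * ln A =
  E i.+1 * ln A - bets * (bets - 1) ^+ j * 2^-1 * (- ln 2).
  by rewrite /E -/j; field.
apply: (@cvg_near_eq _ _ (fun n => (Y n - bet n * (bet n - 1) ^+ j * X i.+1 n) -
  bet n * (bet n - 1) ^+ j * 2^-1 * (ln (ln (1 / rho i.+1 n)) - 2 * X i.+1 n))).
  by apply: nearW => n; rewrite /Y; field.
apply: cvgB; first exact: log_tower (ikW ik1).
by apply: cvgM => //; apply: cvgMl; exact: cvgM.
Unshelve. all: by end_near. Qed.

Let bet_gt0 : \forall n \near \oo, 0 < bet n.
Proof. exact: (cvgr_gt _ bet_cvg). Qed.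

Let loglam_powV (c : R) : 0 < c ->
  (fun n => loglam n `^ (c / bet n) / mu k.+1 n `^ c) @ \oo --> A `^ (c / bets).
Proof.
move=> c0.
pose f n := `|loglam n / mu k.+1 n `^ bet n|.
have fA : f @ \oo --> A.
  by rewrite -(gtr0_norm A0); apply: cvg_norm.
have gc : (fun n => c / bet n) @ \oo --> c / bets.
  by apply: cvgM; [exact: cvg_cst|apply: cvgV => //; rewrite gt_eqF].
have f0 n : 0 <= f n by exact: normr_ge0.
apply: cvg_near_eq (cvg_powR _ (divr_gt0 c0 bets0) f0 fA gc); near=> n.
have b0 : 0 < bet n by near: n.
have L0 : 0 < loglam n by near: n.
have m0 : 0 < mu k.+1 n by exact: mu_gt0.
rewrite /f gtr0_norm ?divr_gt0 ?powR_gt0//.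
rewrite powRM ?invr_ge0 ?powR_ge0 ?(ltW L0)//; congr (_ * _).
rewrite -!powRN -powRrM; congr (_ `^ _); field; by rewrite gt_eqF.
Unshelve. all: by end_near. Qed.

Lemma vanishing_boundary_slope (d : nat -> R) :
  (\forall n \near \oo, d n = M k.+1 n) ->
  (fun n => loglam n `^ (1 / bet n) * d n) @ \oo --> 2 * A `^ (1 / bets).
Proof.
move=> dE.
rewrite mulrC; apply: (@cvg_near_eq _ _ (fun n => loglam n `^ (1 / bet n) / mu k.+1 n `^ 1 *
   (mu k.+1 n * M k.+1 n))).
  near=> n; have -> : d n = M k.+1 n by near: n.
  have m0 : 0 < mu k.+1 n by exact: mu_gt0.
  by rewrite powRr1 ?(ltW m0)//; field; rewrite gt_eqF.
by apply: cvgM; [exact: loglam_powV|exact: flux].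
Unshelve. all: by end_near. Qed.

Section last_top.
Hypothesis k1 : (1 <= k)%N.

Let kk : (1 <= k < k.+1)%N. Proof. by rewrite k1 ltnS leqnn. Qed.
Let Rk n := ln (1 / rho k.+1 n).
Let ratio n := Y n / ((bet n - 1) * loglam n `^ (2 / bet n)).
Let bet1 : \forall n \near \oo, 1 < bet n. Proof. by have [] := step kk. Qed.

Let m2V : (fun n => loglam n `^ (2 / bet n) / mu k.+1 n ^+ 2) @ \oo --> A `^ (2 / bets).
Proof.
apply: cvg_near_eq (loglam_powV (ltr0Sn R 1)); apply: nearW => n.
by rewrite powR_mulrn// ltW// mu_gt0.
Qed.

Let XkY : (fun n => (bet n - 1) * X k n / Y n) @ \oo --> 1 / bets.
Proof.
have [_ H _] := steps kk.
have YV : (fun n => (Y n)^-1) @ \oo --> (0 : R) by exact: cvgy_inv.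
have Y0 : \forall n \near \oo, 0 < Y n by exact: cvgy_near_gt Y_oo 0.
have -> : 1 / bets = (1 - ln A * 0) / bets - ln A * 0 by ring.
apply: (@cvg_near_eq _ _ (fun n => (1 - (Y n - bet n * X k.+1 n) * (Y n)^-1) / bet n -
   (X k.+1 n - (bet n - 1) * X k n) * (Y n)^-1)).
  near=> n.
  have b0 : 0 < bet n by near: n.
  have y0 : 0 < Y n by near: n.
  by field; rewrite !gt_eqF.
apply: cvgB; last exact: cvgM.
apply: cvgM; last by apply: cvgV => //; rewrite gt_eqF.
by apply: cvgB; [exact: cvg_cst|exact: cvgM].
Unshelve. all: by end_near. Qed.

Let ratio0 : bets != 1 -> ratio @ \oo --> (0 : R).
Proof.
move=> b1.
have gc : (fun n => 2 / bet n) @ \oo --> 2 / bets.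
  by apply: cvgM; [exact: cvg_cst|apply: cvgV => //; rewrite gt_eqF].
have H := ln_powR_cvg0 (divr_gt0 (ltr0Sn R 1) bets0) gc loglam_oo.
rewrite -(mul0r (bets - 1)^-1).
apply: (@cvg_near_eq _ _ (fun n => ln (loglam n) / loglam n `^ (2 / bet n) * (bet n - 1)^-1)).
  near=> n.
  have b0 : 1 < bet n by near: n.
  have L0 : 0 < loglam n by near: n.
  rewrite /ratio /Y; field; rewrite (gt_eqF (powR_gt0 _ L0)) andbT.
  by rewrite gt_eqF// subr_gt0.
apply: cvgM => //; apply: cvgV; first by rewrite subr_eq0.
by apply: cvgB => //; exact: cvg_cst.
Unshelve. all: by end_near. Qed.

Let Xk_split : \forall n \near \oo, X k n / mu k.+1 n ^+ 2 =
  (bet n - 1) * X k n / Y n * ratio n * (loglam n `^ (2 / bet n) / mu k.+1 n ^+ 2).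
Proof.
have Y0 : \forall n \near \oo, 0 < Y n by exact: cvgy_near_gt Y_oo 0.
near=> n.
have b0 : 1 < bet n by near: n.
have L0 : 0 < loglam n by near: n.
have y0 : 0 < Y n by near: n.
have m0 : 0 < mu k.+1 n by exact: mu_gt0.
have p0 := powR_gt0 (2 / bet n) L0.
by rewrite /ratio; field; rewrite !gt_eqF// subr_gt0.
Unshelve. all: by end_near. Qed.

(** For the outermost maximum point no lower bound on [(bet - 1) * ln (mu k.+1)] is
    available, and [ln (mu k)] may compete with [mu k.+1 ^+ 2].  The recursion
    expresses their quotient through [ratio], whose limit [L] therefore enters the
    result. *)
Lemma vanishing_last_top (L : R) : 0 <= L -> ratio @ \oo --> L ->
  (fun n => loglam n / Rk n `^ (bet n / 2)) @ \oo -->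
  2 `^ (bets / 2) * A * (1 + L * A `^ (2 / bets)) `^ (- (bets / 2)).
Proof.
move=> L0 rL; have [_ _ H] := steps kk.
(* [L] can be nonzero only if [bets = 1]. *)
have Lb : L / bets = L.
  have [->|b1] := eqVneq bets 1; first by rewrite divr1.
  have -> : L = 0 by exact: (cvg_unique _ rL (ratio0 b1)).
  by rewrite mul0r.
have XX : (fun n => X k n / mu k.+1 n ^+ 2) @ \oo --> L * A `^ (2 / bets).
  have -> : L * A `^ (2 / bets) = 1 / bets * L * A `^ (2 / bets).
    by rewrite -[in LHS]Lb; ring.
  by apply: cvg_near_eq Xk_split _; apply: cvgM => //; exact: cvgM.
set D := 1 + L * A `^ (2 / bets) in XX *.
have D0 : 0 < D by rewrite /D ltr_pwDl// mulr_ge0// powR_ge0.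
have Rl : (fun n => Rk n / mu k.+1 n ^+ 2) @ \oo --> 2^-1 * D.
  apply: (@cvg_near_eq _ _ (fun n => 2^-1 * ((2 * Rk n - X k n) / mu k.+1 n ^+ 2 +
     X k n / mu k.+1 n ^+ 2))).
    by apply: nearW => n; field; rewrite gt_eqF// mu_gt0.
  by apply: cvgMr; exact: cvgD.
have D20 : 0 < 2^-1 * D by rewrite mulr_gt0// invr_gt0.
have R0 : \forall n \near \oo, 0 < Rk n.
  have Q0 : \forall n \near \oo, 0 < Rk n / mu k.+1 n ^+ 2 by exact: (cvgr_gt _ Rl).
  by apply: filterS Q0 => n; rewrite pmulr_lgt0// invr_gt0 exprn_gt0// mu_gt0.
have -> : 2 `^ (bets / 2) * A * D `^ (- (bets / 2)) =
   expR (ln A - bets * 2^-1 * ln (2^-1 * D)).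
  rewrite lnM ?posrE ?invr_gt0// lnV ?posrE//.
  rewrite /powR !(gt_eqF (_ : 0 < _))// -{1}(lnK A0) -!expRD.
  by congr expR; field.
apply: cvg_of_ln => //.
have g0 : \forall n \near \oo, 0 < mu k.+1 n ^+ 2.
  by apply: nearW => n; rewrite exprn_gt0// mu_gt0.
have lR := cvg_ln_ratio D20 g0 Rl.
apply: (@cvg_near_eq _ _ (fun n => (Y n - bet n * X k.+1 n) -
   bet n * 2^-1 * (ln (Rk n) - ln (mu k.+1 n ^+ 2)))).
  by apply: nearW => n; rewrite lnXn ?mu_gt0// mulr2n /Y /X; field.
by apply: cvgB => //; apply: cvgM => //; exact: cvgMl.
Qed.

(** Here [ln (mu k)] dominates [mu k.+1 ^+ 2], so [2 * ln (1 / rho)] is asymptotic to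
    [ln (mu k)], that is, to [ln loglam / (bets * (bet - 1))]. *)
Lemma vanishing_last_top_oo : ratio @ \oo --> +oo ->
  bets = 1 /\ (fun n => Y n / ((bet n - 1) * Rk n)) @ \oo --> (2 : R).
Proof.
move=> roo.
have b1 : bets = 1.
  apply/eqP; apply: contraT => b1; have r0 := ratio0 b1.
  have Z1 : \forall n \near \oo, ratio n < 1 by exact: (cvgr_lt _ r0).
  have Z2 := cvgy_near_gt roo 1.
  have [n [z1 z2]] := filter_ex (filterI Z1 Z2).
  by move: (lt_trans z1 z2); rewrite ltxx.
split => //; have [_ _ H] := steps kk.
have Y0 : \forall n \near \oo, 0 < Y n by exact: cvgy_near_gt Y_oo 0.
have rV : (fun n => (ratio n)^-1) @ \oo --> (0 : R) by exact: cvgy_inv.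
have r0 := cvgy_near_gt roo 0.
have Ab : A `^ (2 / bets) != 0 by rewrite gt_eqF// powR_gt0.
have mV : (fun n => (loglam n `^ (2 / bet n) / mu k.+1 n ^+ 2)^-1) @ \oo --> (A `^ (2 / bets))^-1.
  exact: cvgV.
pose W n := Rk n * (bet n - 1) / Y n.
have Wc : W @ \oo --> 2^-1 * (1 * (A `^ (2 / bets))^-1 * 0 + 1 / bets).
  apply: (@cvg_near_eq _ _ (fun n => 2^-1 * ((2 * Rk n - X k n) / mu k.+1 n ^+ 2 *
     (loglam n `^ (2 / bet n) / mu k.+1 n ^+ 2)^-1 * (ratio n)^-1 +
     (bet n - 1) * X k n / Y n))).
    near=> n.
    have b0 : 1 < bet n by near: n.
    have L0 : 0 < loglam n by near: n.
    have y0 : 0 < Y n by near: n.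
    have m0 : 0 < mu k.+1 n by exact: mu_gt0.
    have p0 := powR_gt0 (2 / bet n) L0.
    by rewrite /W /ratio; field; rewrite !gt_eqF// subr_gt0.
  by apply: cvgMr; apply: cvgD => //; apply: cvgM => //; exact: cvgM.
rewrite mulr0 add0r b1 divr1 mulr1 in Wc.
have -> : 2 = (2^-1)^-1 :> R by rewrite invrK.
have h20 : 2^-1 != 0 :> R by rewrite invr_eq0.
apply: cvg_near_eq (cvgV h20 Wc).
by apply: nearW => n; rewrite /W /= invf_div [Rk n * _]mulrC.
Unshelve. all: by end_near. Qed.

End last_top.
End vanishing_limit.

(** * Limits when a nonzero parameter remains *)

Section residual_limit.
Context (R : realType) (bets A : R) (bet loglam : nat -> R) (N : nat)
  (mu M r rho : nat -> nat -> R) (muN : nat -> R) (muL : R).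
Hypotheses (N1 : (1 <= N)%N) (bets02 : 0 < bets < 2) (A0 : 0 < A)
  (bet_cvg : bet @ \oo --> bets)
  (mu_gt0 : forall i n, (1 <= i <= N)%N -> 0 < mu i n)
  (r_gt0 : forall i n, (1 <= i <= N)%N -> 0 < r i n)
  (mu_oo : forall i, (1 <= i <= N)%N -> mu i @ \oo --> +oo)
  (flux : forall i, (1 <= i <= N)%N -> (fun n => mu i n * M i n) @ \oo --> (2 : R))
  (logs : forall i, (1 <= i <= N)%N ->
     (fun n => (loglam n + 2 * ln (1 / r i n)) / mu i n `^ bet n) @ \oo --> A)
  (step : forall j, (1 <= j < N)%N ->
    (\forall n \near \oo, 1 < bet n) /\
    forall l : R, (fun n => loglam n / mu j.+1 n `^ bet n) @ \oo --> l ->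
     [/\ (fun n => loglam n / mu j n `^ bet n) @ \oo --> (0 : R),
         (fun n => mu j.+1 n / mu j n `^ (bet n - 1)) @ \oo --> A &
         (fun n => (2 * ln (1 / rho j.+1 n) - ln (mu j n)) / mu j.+1 n ^+ 2) @ \oo --> (1 : R)])
  (lamN : (fun n => loglam n / mu N n `^ bet n) @ \oo --> (0 : R))
  (muN_gt0 : forall n, 0 < muN n) (muN_cvg : muN @ \oo --> muL)
  (neckN : (fun n => muN n / mu N n `^ (bet n - 1)) @ \oo --> A).

Let bets0 : 0 < bets. Proof. by case/andP: bets02. Qed.
Let X i n := ln (mu i n).
Let NN : (1 <= N <= N)%N. Proof. by rewrite N1 leqnn. Qed.
Let XN_oo : X N @ \oo --> +oo. Proof. exact/ln_cvgy/mu_oo. Qed.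
Let steps j := tower_step A0 mu_gt0 step lamN (j := j).

Let neck_ln : (fun n => ln (muN n) - (bet n - 1) * X N n) @ \oo --> ln A.
Proof.
have g0 : \forall n \near \oo, 0 < mu N n `^ (bet n - 1).
  by apply: nearW => n; rewrite powR_gt0// mu_gt0.
apply: cvg_near_eq (cvg_ln_ratio A0 g0 neckN).
by apply: nearW => n; rewrite ln_powR.
Qed.

(** If the height of the residual interval vanishes, the neck relation sends
    [(bet - 1) * ln (mu N)] to [-oo]. *)
Lemma residual_small : muL = 0 -> \forall n \near \oo, bet n < 1.
Proof.
move=> m0.
have H1 : \forall n \near \oo, ln A - 1 <= ln (muN n) - (bet n - 1) * X N n.
  by apply: (cvgr_ge _ neck_ln); lra.
have H2 : \forall n \near \oo, muN n < expR (ln A - 1).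
  by apply: (cvgr_lt _ muN_cvg); rewrite m0 expR_gt0.
have H3 := cvgy_near_gt XN_oo 0.
near=> n.
have h1 : ln A - 1 <= ln (muN n) - (bet n - 1) * X N n by near: n.
have h2 : muN n < expR (ln A - 1) by near: n.
have h3 : 0 < X N n by near: n.
have h4 : ln (muN n) < ln A - 1.
  by rewrite -[ltRHS]expRK ltr_ln ?posrE ?expR_gt0.
have : 0 < (1 - bet n) * X N n by move: h1 h4; lra.
by rewrite pmulr_lgt0// subr_gt0.
Unshelve. all: by end_near. Qed.

Lemma residual_bets_le1 : muL = 0 -> bets <= 1.
Proof.
move=> m0; rewrite leNgt; apply/negP => b1.
have H1 : \forall n \near \oo, 1 < bet n by exact: (cvgr_gt _ bet_cvg).
have [n [h1 h2]] := filter_ex (filterI H1 (residual_small m0)).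
by move: (lt_trans h1 h2); rewrite ltxx.
Qed.

Section positive_residue.
Hypothesis muL0 : 0 < muL.
Let q := muL / A.
Let q0 : 0 < q. Proof. exact: divr_gt0. Qed.

Let bXN : (fun n => (bet n - 1) * X N n) @ \oo --> ln q.
Proof.
rewrite /q ln_div ?posrE//.
apply: (@cvg_near_eq _ _ (fun n => ln (muN n) - (ln (muN n) - (bet n - 1) * X N n))).
  by apply: nearW => n; ring.
by apply: cvgB => //; exact: cvg_ln.
Qed.

Let bet1_cvg0 : (fun n => bet n - 1) @ \oo --> (0 : R).
Proof.
have XV : (fun n => (X N n)^-1) @ \oo --> (0 : R) by exact: cvgy_inv.
have H := cvgy_near_gt XN_oo 0.
rewrite -(mulr0 (ln q)); apply: (@cvg_near_eq _ _ (fun n => (bet n - 1) * X N n * (X N n)^-1)).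
  near=> n; have x0 : 0 < X N n by near: n.
  by rewrite mulfK// gt_eqF.
exact: cvgM.
Unshelve. all: by end_near. Qed.

(** The product [(bet - 1) * ln (mu N)] converges while [ln (mu N)] diverges. *)
Lemma residual_bets : bets = 1.
Proof.
have H : bet @ \oo --> (1 : R).
  rewrite -[X in _ --> X]add0r.
  apply: (@cvg_near_eq _ _ (fun n => (bet n - 1) + 1)); first by apply: nearW => n; ring.
  by apply: cvgD => //; exact: cvg_cst.
exact: (cvg_unique _ bet_cvg H).
Qed.

Let bet_cvg1 : bet @ \oo --> (1 : R). Proof. by rewrite -residual_bets. Qed.

Let betp0 j : (0 < j)%N -> (fun n => (bet n - 1) ^+ j) @ \oo --> (0 : R).
Proof.
case: j => // j _; have -> : 0 = 0 ^+ j.+1 :> R by rewrite expr0n.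
exact: cvg_exprn.
Qed.

Let tower_pow i : (1 <= i <= N)%N ->
  (fun n => (bet n - 1) ^+ (N.+1 - i) * X i n) @ \oo --> ln q.
Proof.
move=> im.
suff H d : (d < N)%N ->
   (fun n => (bet n - 1) ^+ d.+1 * X (N - d)%N n) @ \oo --> ln q.
  have /andP[i0 iN] := im; have := H (N - i)%N; rewrite subKn// => h.
  by rewrite subSn//; apply: h; rewrite ltn_subrL i0.
elim: d => [_|d IH dm].
  by rewrite subn0; under eq_fun do rewrite expr1.
have jm : (1 <= N - d.+1 < N)%N by rewrite subn_gt0 dm ltn_subrL.
have [_ H _] := steps jm; rewrite subnSK in H; last exact: ltnW.
have -> : ln q = ln q - 0 * ln A by rewrite mul0r subr0.
apply: (@cvg_near_eq _ _ (fun n => (bet n - 1) ^+ d.+1 * X (N - d)%N n -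
   (bet n - 1) ^+ d.+1 * (X (N - d)%N n - (bet n - 1) * X (N - d.+1)%N n))).
  by apply: nearW => n; rewrite [in LHS]exprS; ring.
apply: cvgB; first exact: IH (ltnW dm).
by apply: cvgM => //; exact: betp0.
Qed.

Let iE i : (1 <= i <= N)%N -> (N - i + 1)%N = (N.+1 - i)%N.
Proof. by case/andP => _ iN; rewrite addn1 subSn. Qed.

Let iE0 i : (1 <= i <= N)%N -> (0 < N.+1 - i)%N.
Proof. by case/andP => _ iN; rewrite subn_gt0. Qed.

Lemma residual_height i : (1 <= i <= N)%N ->
  (fun n => mu i n `^ ((bet n - 1) ^+ (N - i + 1))) @ \oo --> q.
Proof.
move=> im; rewrite iE// -(lnK q0); apply: cvg_powR_of_ln; last exact: tower_pow.
by apply: nearW => n; exact: mu_gt0.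
Qed.

Let log_lam0 i : (1 <= i <= N)%N ->
  (fun n => loglam n / mu i n `^ bet n) @ \oo --> (0 : R).
Proof.
move=> /andP[i0]; rewrite leq_eqVlt => /predU1P[->//|iN].
by have [] := steps (j := i) ltac:(by rewrite i0 iN).
Qed.

Let residual_log (S : nat -> R) i : (1 <= i <= N)%N ->
  S @ \oo --> +oo -> (fun n => ln (S n) - bet n * X i n) @ \oo --> ln (A / 2) ->
  (fun n => S n `^ ((bet n - 1) ^+ (N - i + 1))) @ \oo --> q.
Proof.
move=> im S_oo SX; rewrite iE// -(lnK q0).
apply: cvg_powR_of_ln; first exact: cvgy_near_gt S_oo 0.
have -> : ln q = 0 * ln (A / 2) + 1 * ln q by ring.
apply: (@cvg_near_eq _ _ (fun n => (bet n - 1) ^+ (N.+1 - i) * (ln (S n) - bet n * X i n) +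
   bet n * ((bet n - 1) ^+ (N.+1 - i) * X i n))).
  by apply: nearW => n; ring.
apply: cvgD; apply: cvgM => //; first exact/betp0/iE0.
exact: tower_pow.
Qed.

Lemma residual_node i : (1 <= i <= N)%N ->
  (fun n => ln (1 / r i n) `^ ((bet n - 1) ^+ (N - i + 1))) @ \oo --> q.
Proof.
move=> im.
have [h1 h2] := tower_node bets02 A0 bet_cvg mu_gt0 mu_oo logs im (log_lam0 im).
exact: residual_log.
Qed.

Lemma residual_slope (d : nat -> R) i : (1 <= i <= N)%N ->
  (\forall n \near \oo, d n = M i n / r i n) ->
  (fun n => ln (d n) `^ ((bet n - 1) ^+ (N - i + 1))) @ \oo --> q.
Proof.
move=> im dE.
have [h1 h2] := tower_slope bets02 A0 bet_cvg mu_gt0 r_gt0 mu_oo flux logs im (log_lam0 im) dE.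
exact: residual_log.
Qed.

(** The condition [1 < q] gives the lower bound on [(bet - 1) * ln (mu i)] that
    [tower_rho] needs when [i] is the last bubble. *)
Lemma residual_top i : 1 < q -> (2 <= i <= N)%N ->
  (fun n => ln (1 / rho i n) `^ ((bet n - 1) ^+ (N - i + 1))) @ \oo --> q ^+ 2.
Proof.
move=> q1; case: i => // i /andP[i0 iN].
have im : (1 <= i.+1 <= N)%N by rewrite iN.
have ij : (1 <= i < N)%N by apply/andP; split; [exact: i0|exact: iN].
have [_ H1 H2] := steps ij.
have lq : 0 < ln q by exact: ln_gt0.
have Hc : \forall n \near \oo, Num.min (ln q / 2) 1 <= (bet n - 1) * X i.+1 n.
  move: iN; rewrite leq_eqVlt => /predU1P[->|iN].
    have : \forall n \near \oo, ln q / 2 <= (bet n - 1) * X N n.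
      by apply: (cvgr_ge _ bXN); move: lq; lra.
    by apply: filterS => n; apply: le_trans; rewrite ge_min lexx.
  have [_ H3 _] := steps (j := i.+1) iN.
  have Z1 : \forall n \near \oo, X i.+2 n - (bet n - 1) * X i.+1 n <= ln A + 1.
    by apply: (cvgr_le _ H3); lra.
  have Z2 : \forall n \near \oo, ln A + 2 < X i.+2 n.
    by apply: cvgy_near_gt; apply/ln_cvgy/mu_oo.
  near=> n.
  have z1 : X i.+2 n - (bet n - 1) * X i.+1 n <= ln A + 1 by near: n.
  have z2 : ln A + 2 < X i.+2 n by near: n.
  rewrite ge_min; apply/orP; right; by move: z1 z2; lra.
have c0 : 0 < Num.min (ln q / 2) 1 by rewrite lt_min ltr01 divr_gt0.
have [h1 h2] := tower_rho mu_gt0 mu_oo ij c0 Hc H1 H2.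
have -> : q ^+ 2 = expR (0 * - ln 2 + 2 * ln q).
  by rewrite mul0r add0r mulrC expRM_natr lnK.
rewrite iE//; apply: cvg_powR_of_ln; first exact: cvgy_near_gt h1 0.
apply: (@cvg_near_eq _ _
  (fun n => (bet n - 1) ^+ (N.+1 - i.+1) * (ln (ln (1 / rho i.+1 n)) - 2 * X i.+1 n) +
   2 * ((bet n - 1) ^+ (N.+1 - i.+1) * X i.+1 n))).
  by apply: nearW => n; ring.
apply: cvgD; last by apply: cvgMr; exact: tower_pow.
by apply: cvgM => //; exact/betp0/iE0.
Unshelve. all: by end_near. Qed.

Lemma residual_bet_gt1 : 1 < q -> \forall n \near \oo, 1 < bet n.
Proof.
move=> q1; have lq : 0 < ln q by exact: ln_gt0.
have H1 : \forall n \near \oo, 0 < (bet n - 1) * X N n by exact: (cvgr_gt _ bXN).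
have H2 := cvgy_near_gt XN_oo 0.
near=> n.
have h1 : 0 < (bet n - 1) * X N n by near: n.
have h2 : 0 < X N n by near: n.
by move: h1; rewrite pmulr_lgt0// subr_gt0.
Unshelve. all: by end_near. Qed.

Lemma residual_bet_lt1 : q < 1 -> \forall n \near \oo, bet n < 1.
Proof.
move=> q1; have lq : ln q < 0 by apply: ln_lt0; rewrite q0.
have H1 : \forall n \near \oo, (bet n - 1) * X N n < 0 by exact: (cvgr_lt _ bXN).
have H2 := cvgy_near_gt XN_oo 0.
near=> n.
have h1 : (bet n - 1) * X N n < 0 by near: n.
have h2 : 0 < X N n by near: n.
by move: h1; rewrite pmulr_llt0// subr_lt0.
Unshelve. all: by end_near. Qed.

Let near_absurd (Q1 Q2 : nat -> Prop) :
  (\forall n \near \oo, Q1 n) -> (\forall n \near \oo, Q2 n) ->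
  (forall n, Q1 n -> Q2 n -> False) -> False.
Proof.
move=> H1 H2 H; have [n [h1 h2]] := filter_ex (filterI H1 H2).
exact: H h1 h2.
Qed.

Lemma residual_ge1 : (\forall n \near \oo, 1 <= bet n) -> 1 <= q.
Proof.
move=> H; rewrite leNgt; apply/negP => /residual_bet_lt1 H2.
by apply: (near_absurd H H2) => n; rewrite leNgt => /negbTE ->.
Qed.

Lemma residual_le1 : (\forall n \near \oo, bet n <= 1) -> q <= 1.
Proof.
move=> H; rewrite leNgt; apply/negP => /residual_bet_gt1 H2.
by apply: (near_absurd H H2) => n; rewrite leNgt => /negbTE ->.
Qed.

(** Up to a bounded error [2 * ln (1 / rhoN)] is [ln (mu N)], and the factor
    [bet - 1 --> 0] removes the error. *)
Lemma residual_rho (rhoN : nat -> R) : (forall n, 0 < rhoN n) ->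
  (exists C : R, \forall n \near \oo, `|2 * ln (1 / rhoN n) - X N n| <= C) ->
  (fun n => rhoN n `^ (bet n - 1)) @ \oo --> Num.sqrt q^-1.
Proof.
move=> r0 [C HC].
have bC : (fun n => `|bet n - 1| * C) @ \oo --> (0 : R).
  rewrite -(mul0r C) -[X in X * C](normr0 R); apply: cvgMl.
  exact: cvg_norm.
have bCn : (fun n => - (`|bet n - 1| * C)) @ \oo --> (0 : R) by rewrite -oppr0; exact: cvgN.
have D : (fun n => (bet n - 1) * (2 * ln (1 / rhoN n) - X N n)) @ \oo --> (0 : R).
  apply: (squeeze_cvgr _ bCn bC); apply: filterS HC => n h.
  by rewrite -ler_norml normrM ler_wpM2l.
have -> : Num.sqrt q^-1 = expR (- 2^-1 * (0 + ln q)).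
  rewrite add0r mulNr mulrC expRN expRM lnK// powR12_sqrt ?(ltW q0)//.
  by rewrite sqrtrV// ltW.
apply: cvg_powR_of_ln; first exact: nearW.
apply: (@cvg_near_eq _ _ (fun n => - 2^-1 * ((bet n - 1) * (2 * ln (1 / rhoN n) - X N n) +
   (bet n - 1) * X N n))).
  by apply: nearW => n; rewrite ln_div ?posrE// ln1; field.
by apply: cvgMr; exact: cvgD.
Qed.

End positive_residue.
End residual_limit.

(** * Integrals over moving intervals *)

Lemma cvg_bounded_seq (R : realType) (f : nat -> R) (l : R) : f @ \oo --> l ->
  exists K, 0 < K /\ forall n, `|f n| <= K.
Proof.
move=> fl; have [M [_ HM]] : bounded_fun f by apply: cvg_seq_bounded; apply/cvg_ex; exists l.
exists (`|M| + 1); split; first by rewrite ltr_wpDl.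
by move=> n; apply: HM => //; rewrite (le_lt_trans (ler_norm M))// ltrDl.
Qed.

(* The pointwise limit is known below [c] only and the right ends [b n] tend to
   [c] from either side, hence the upper limit [Num.min (b n) c]. *)
Section truncated_integral.
Context (R : realType) (alpha c : R) (bet a b m : nat -> R) (v : nat -> R -> R)
  (v0 : R -> R) (mL betL : R).
Notation leb := (@lebesgue_measure R).
Hypotheses (alpha0 : 0 <= alpha) (c01 : 0 < c <= 1) (bet0 : forall n, 0 < bet n)
  (betL0 : 0 < betL)
  (bet_cvg : bet @ \oo --> betL) (a0 : forall n, 0 < a n)
  (a_cvg : a @ \oo --> (0 : R)) (b_cvg : b @ \oo --> c) (m_cvg : m @ \oo --> mL)
  (vm : forall n s, a n <= s <= b n -> `|v n s| <= m n)
  (cv : forall n, {within `[0, 1], continuous (v n)})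
  (v_cvg : forall s, 0 < s < c -> (fun n => v n s) @ \oo --> v0 s).

Let h n s := nonlin alpha (bet n) (v n s) * s.
Let h0 s := nonlin alpha betL (v0 s) * s.
Let D : set R := `]0, c[%classic.
Let g n := h n \_ `[a n, b n].

Let mD : measurable D. Proof. exact: measurable_itv. Qed.

Let nonlin_abs n t x : `|t| <= x -> `|nonlin alpha (bet n) t| <= nonlin alpha (bet n) x.
Proof.
move=> tx; have -> : `|nonlin alpha (bet n) t| = nonlin alpha (bet n) `|t|.
  by rewrite /nonlin normrM (ger0_norm (expR_ge0 _)) normr_id real_normK ?num_real.
exact: nonlin_mono.
Qed.

Lemma nonlin_height_bound : exists K, 0 < K /\
  forall n s, a n <= s <= b n -> `|nonlin alpha (bet n) (v n s)| <= K.
Proof.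
have [K [K0 HK]] := cvg_bounded_seq (cvg_nonlin (alpha := alpha) _ betL0 m_cvg bet_cvg).
exists K; split => // n s sab; apply: le_trans (HK n).
by apply: le_trans (nonlin_abs _ (vm sab)) (ler_norm _).
Qed.

Let mh n : measurable_fun `[(0 : R), 1] (h n).
Proof.
have ch : {within `[0, 1], continuous (h n)}.
  have -> : h n = (fun s => 1 * nonlin alpha (bet n) (v n s) * s).
    by apply/funext => s; rewrite mul1r.
  exact: within_nonlin.
by have /measurable_int/measurable_EFinP := continuous_compact_integrable
  (@segment_compact R 0 1) ch.
Qed.

Let mg n : measurable_fun D (g n).
Proof.
apply/measurable_restrict => //; apply: measurable_funS (mh n) => //.
move=> x [/=]; rewrite !in_itv/= => /andP[x0 xc] _; rewrite ltW//=.
by case/andP: c01 => _; exact: le_trans (ltW xc).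
Qed.

Let gE n s : a n <= s <= b n -> g n s = h n s.
Proof. by move=> sab; rewrite /g patchE mem_set//= in_itv. Qed.

Let g_cvg s : D s -> (fun n => g n s) @ \oo --> h0 s.
Proof.
rewrite /D/= in_itv/= => /andP[s0 sc].
have A : \forall n \near \oo, a n < s by exact: (cvgr_lt _ a_cvg).
have B : \forall n \near \oo, s < b n by exact: (cvgr_gt _ b_cvg).
apply: (@cvg_near_eq _ _ (fun n => h n s)).
  near=> n; apply: gE.
  have an : a n < s by near: n.
  have bn : s < b n by near: n.
  by rewrite !ltW.
apply: cvgMl; apply: cvg_nonlin => //; apply: v_cvg; by rewrite s0.
Unshelve. all: by end_near. Qed.

Let mh0 : measurable_fun D h0.
Proof. exact: (measurable_fun_cvg mg g_cvg). Qed.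

Let g_int : (fun n => Rintegral leb D (g n)) @ \oo --> Rintegral leb D h0.
Proof.
have [K [K0 HK]] := nonlin_height_bound.
have iK : leb.-integrable D (EFin \o (fun=> K)).
  have iK' : leb.-integrable `[(0 : R), 1] (EFin \o (fun=> K)).
    apply: continuous_compact_integrable; first exact: segment_compact.
    by apply: continuous_subspaceT => x; exact: cvg_cst.
  apply: integrableS iK' => //.
  by apply: subset_itv; rewrite bnd_simp//; case/andP: c01.
have gK n s : D s -> `|g n s| <= K.
  move=> Ds; rewrite /g patchE; case: ifPn => [|_]; last by rewrite normr0 ltW.
  rewrite inE/= in_itv/= => sab; rewrite /h normrM.
  have s1 : `|s| <= 1.
    move: Ds; rewrite /D/= in_itv/= => /andP[s0 sc]; rewrite gtr0_norm//.
    by case/andP: c01 => _; exact: le_trans (ltW sc).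
  by rewrite -[leRHS]mulr1 ler_pM// HK.
have dc := @dominated_convergence _ _ R leb D mD (fun n => EFin \o g n) (EFin \o h0)
  (EFin \o (fun=> K)) (fun n => (measurable_EFinP _ _).2 (mg n)) ((measurable_EFinP _ _).2 mh0).
case: dc => [|//||ih0 _ H].
- by apply: aeW => x Dx; apply/fine_cvgP; split; [exact: nearW|exact: g_cvg].
- by apply: aeW => x n Dx; rewrite lee_fin gK.
have fi : (\int[leb]_(x in D) (h0 x)%:E)%E \is a fin_num by exact: integrable_fin_num.
rewrite /Rintegral; apply: fine_cvg; rewrite fineK//.
Qed.

Lemma truncated_integral_cvg :
  (fun n => Rintegral leb `[a n, Num.min (b n) c] (h n)) @ \oo --> Rintegral leb `[0, c] h0.
Proof.
have /andP[c0 c1] := c01.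
have -> : Rintegral leb `[0, c] h0 = Rintegral leb D h0.
  rewrite /Rintegral integral_itv_bndoo//; exact/measurable_EFinP.
have A : \forall n \near \oo, a n < c by exact: (cvgr_lt _ a_cvg).
apply: cvg_near_eq g_int; apply: filterS A => n an.
rewrite /g -Rintegral_mkcondr.
have [bc|cb] := ltP (b n) c.
  congr (Rintegral _ _ _); apply/seteqP; split=> x; rewrite /D/= !in_itv/=.
    by move=> /andP[ax xb]; rewrite ax xb (lt_le_trans (a0 n) ax) (le_lt_trans xb bc).
  by case.
have -> : D `&` `[a n, b n] = `[a n, c[%classic.
  apply/seteqP; split=> x; rewrite /D/= !in_itv/=.
    by case=> /andP[_ ->] /andP[-> _].
  by move=> /andP[ax xc]; rewrite xc ax (lt_le_trans (a0 n) ax) (le_trans (ltW xc) cb).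
rewrite /Rintegral integral_itv_bndo_bndc//; apply/measurable_EFinP.
apply: measurable_funS (mh n) => // x /=; rewrite !in_itv/= => /andP[ax xc].
by rewrite (le_trans (ltW (a0 n)) ax) (le_trans (ltW xc) c1).
Qed.

End truncated_integral.

(** * The interval next to the last bubble *)

Lemma radial_increment (R : realType) (lam alpha bet : R) (v P : R -> R) (x y : R) :
  0 < bet -> radial_flux lam alpha bet v P -> 0 <= x -> x <= y -> y <= 1 ->
  P y - P x = lam * Rintegral (@lebesgue_measure R) `[x, y]
    (fun s => nonlin alpha bet (v s) * s).
Proof.
move=> b0 [[cv _] pP _] x0 xy y1.
have ch : {within `[0, 1], continuous (fun s => nonlin alpha bet (v s) * s)}.
  have -> : (fun s => nonlin alpha bet (v s) * s) = (fun s => 1 * nonlin alpha bet (v s) * s).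
    by apply/funext => s; rewrite mul1r.
  exact: within_nonlin.
have [H [pH HE]] := exists_prim ltr01 ch; rewrite (HE _ _ x0 xy y1) mulrBr.
have pH' : prim 0 1 (fun s => lam * H s) (fun s => lam * nonlin alpha bet (v s) * s).
  by apply: prim_ext (primZ lam pH) => s _; rewrite mulrA.
have l1 := prim_le pP pH' (fun _ _ => lexx _) x0 xy y1.
have l2 := prim_le pH' pP (fun _ _ => lexx _) x0 xy y1.
by apply/le_anti; rewrite l1 l2.
Qed.

Section residual_profile.
Context (R : realType) (alpha : R) (k : nat) (lams bets : R)
    (lam bet : nat -> R) (u P : nat -> R -> R)
    (r rho mu gam : nat -> nat -> R).
Hypotheses (alpha0 : 0 < alpha) (bets02 : 0 < bets < 2)
  (lam0 : forall n, 0 < lam n) (bet02 : forall n, 0 < bet n < 2)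
  (lam_cvg : lam @ \oo --> lams) (bet_cvg : bet @ \oo --> bets)
  (u0_gt0 : forall n, 0 < u n 0)
  (data : nodal_data alpha k lam bet u r rho mu gam)
  (uP : forall n, radial_flux (lam n) alpha (bet n) (u n) (P n)).
Variables (N : nat) (muL : R).
Hypotheses (Nk : (1 <= N <= k)%N)
  (bN : bubbled alpha bets lam bet P r rho mu gam N)
  (lams0 : 0 < lams) (muL_cvg : mu N.+1 @ \oo --> muL)
  (rho_cvg : rho N.+1 @ \oo --> (0 : R)).

Let bets0 : 0 < bets. Proof. by case/andP: bets02. Qed.
Let bet0 n : 0 < bet n. Proof. by case/andP: (bet02 n). Qed.
Let i := N.+1.
Let ik : (1 <= i <= k.+1)%N. Proof. by case/andP: Nk. Qed.
Let Nk' : (1 <= N <= k.+1)%N. Proof. by case/andP: Nk => -> /leqW. Qed.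
Let muN_gt0 n : 0 < mu N n. Proof. exact: mu_gt0 data _ _ Nk'. Qed.
Let mui_gt0 n : 0 < mu i n. Proof. exact: mu_gt0 data _ _ ik. Qed.
Let rho0 n : 0 < rho i n. Proof. exact: (neck_rho_gt0 data Nk n). Qed.
Let rho1 n : rho i n <= 1. Proof. exact: (neck_rho_le1 data Nk n). Qed.
Let muN_oo : mu N @ \oo --> +oo. Proof. by case: bN. Qed.
Let M n := outflux P r N n.
Let fmu n := nonlin alpha (bet n) (mu i n).
Let X n := ln (mu N n).
Let S n := ln (1 / rho i n).

(** [ln (1 / lam)] converges because the limit of [lam] is positive. *)
Lemma residual_lam : (fun n => ln (1 / lam n) / mu N n `^ bet n) @ \oo --> (0 : R).
Proof.
have pV : (fun n => (mu N n `^ bet n)^-1) @ \oo --> (0 : R).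
  by apply: cvgy_inv; exact: (@powR_cvgy _ (mu N) bet bets bets0 bet_cvg muN_oo).
rewrite -(mulr0 (ln (1 / lams))); apply: cvgM => //.
apply: cvg_ln; first by rewrite divr_gt0.
by apply: cvgM; [exact: cvg_cst|apply: cvgV => //; rewrite gt_eqF].
Qed.

Let f_bound : exists K, 0 < K /\ forall n, lam n * fmu n <= K.
Proof.
have H : (fun n => lam n * fmu n) @ \oo --> lams * nonlin alpha bets muL.
  by apply: cvgM => //; exact: cvg_nonlin.
have [K [K0 HK]] := cvg_bounded_seq H; exists K; split => // n.
exact: le_trans (ler_norm _) (HK n).
Qed.

Let S_ge0 n : 0 <= S n.
Proof. by rewrite /S ln_ge0// ler_pdivlMr// mul1r. Qed.

Let SE n : S n = - ln (rho i n).
Proof. by rewrite /S ln_div ?posrE// ln1 sub0r. Qed.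

Let M_low : \forall n \near \oo, 1 / mu N n <= M n.
Proof.
have [_ M2 _ _] := bN.
have H : \forall n \near \oo, 1 <= mu N n * outflux P r N n.
  by apply: (cvgr_ge _ M2); lra.
by apply: filterS H => n; rewrite ler_pdivrMr// mulrC.
Qed.

Let S_up : exists C, \forall n \near \oo, 2 * S n <= C + X n.
Proof.
have [K [K0 HK]] := f_bound.
exists (ln K - ln 2); apply: filterS M_low => n h1.
have up := neck_flux_le alpha0 lam0 bet02 u0_gt0 data uP Nk n.
have r2 : 0 < rho i n ^+ 2 by rewrite exprn_gt0.
have h2 : 2 / (K * mu N n) <= rho i n ^+ 2.
  rewrite ler_pdivrMr ?mulr_gt0//.
  have h3 : 1 / mu N n <= K * rho i n ^+ 2 / 2.
    apply: le_trans h1 _; apply: le_trans up _.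
    by rewrite ler_pM2r ?invr_gt0// ler_pM2r.
  by move: h3; rewrite ler_pdivrMr//; lra.
have p2 : 0 < 2 / (K * mu N n) by rewrite divr_gt0// mulr_gt0.
have := ln_le p2 h2.
rewrite ln_div ?posrE ?mulr_gt0// lnM ?posrE// lnXn// mulr2n SE /X.
lra.
Qed.

(** The influx is at least [1 / mu N] and at most a multiple of [rho ^+ 2], because
    [lam * f] is bounded on the residual interval; so [ln (1 / rho)] is at most of
    order [ln (mu N)]. *)
Lemma residual_rho_small : (fun n => S n / mu N n `^ bet n) @ \oo --> (0 : R).
Proof.
have [C HC] := S_up.
have pV : (fun n => (mu N n `^ bet n)^-1) @ \oo --> (0 : R).
  by apply: cvgy_inv; exact: (@powR_cvgy _ (mu N) bet bets bets0 bet_cvg muN_oo).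
have H : (fun n => 2^-1 * (C * (mu N n `^ bet n)^-1 + X n / mu N n `^ bet n)) @ \oo --> (0 : R).
  have -> : 0 = 2^-1 * (C * 0 + 0) :> R by ring.
  apply: cvgMr; apply: cvgD; first exact: cvgMr.
  exact: ln_powR_cvg0 bets0 bet_cvg muN_oo.
have c0 : (fun=> 0 : R) @ \oo --> (0 : R) by exact: cvg_cst.
apply: (squeeze_cvgr _ c0 H); apply: filterS HC => n h.
have p0 : 0 < mu N n `^ bet n by rewrite powR_gt0.
apply/andP; split; first by rewrite divr_ge0// ltW.
have -> : 2^-1 * (C / mu N n `^ bet n + X n / mu N n `^ bet n) =
  2^-1 * (C + X n) / mu N n `^ bet n by field; rewrite gt_eqF.
by rewrite ler_pM2r ?invr_gt0//; lra.
Qed.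

Lemma residual_neck :
  (fun n => mu i n / mu N n `^ (bet n - 1)) @ \oo --> alpha * (1 - bets / 2).
Proof.
apply: (neck_recursion alpha0 lam0 bet02 u0_gt0 data uP Nk bN).
- have -> : 0 = lams * expR (muL ^+ 2 + alpha * `|muL| `^ bets) * (0 * 0) :> R by ring.
  apply: (@cvg_near_eq _ _ (fun n => lam n * expR (mu i n ^+ 2 + alpha * `|mu i n| `^ bet n) *
     (rho i n * rho i n))).
    apply: nearW => n; rewrite /nonlin -/i; move: (expR _) => e.
    by field; rewrite gt_eqF.
  by apply: cvgM; apply: cvgM => //; exact: cvg_nonlin_weight.
- exact: residual_lam.
- by left; exact: residual_rho_small.
Qed.

Section positive.
Hypothesis muL0 : 0 < muL.

Let M_cvg0 : M @ \oo --> (0 : R).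
Proof.
have [_ M2 _ _] := bN.
rewrite -(mulr0 2); apply: (@cvg_near_eq _ _ (fun n => mu N n * M n * (mu N n)^-1)).
  by apply: nearW => n; rewrite mulrAC divff ?mul1r// gt_eqF.
by apply: cvgM => //; exact: cvgy_inv.
Qed.

(** A positive limit height bounds [lam * f] below near the maximum as well, so the
    influx, of order [1 / mu N], is comparable to [rho ^+ 2]. *)
Lemma residual_rho_log :
  exists C : R, \forall n \near \oo, `|2 * ln (1 / rho i n) - ln (mu N n)| <= C.
Proof.
have [C HC] := S_up.
have H1 : \forall n \near \oo, muL / 2 <= mu i n - M n * ln 2.
  have : (fun n => mu i n - M n * ln 2) @ \oo --> muL - 0 * ln 2.
    by apply: cvgB => //; exact: cvgMl.
  by move=> /cvgr_ge; apply; rewrite mul0r subr0; move: muL0; lra.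
have H2 : \forall n \near \oo, lams / 2 <= lam n.
  by apply: (cvgr_ge _ lam_cvg); move: lams0; lra.
have H3 : \forall n \near \oo, muL / 2 <= mu i n.
  by apply: (cvgr_ge _ muL_cvg); move: muL0; lra.
have mL2 : 0 < muL / 2 by rewrite divr_gt0.
have H4 := neck_far alpha0 lam0 bet02 u0_gt0 data uP Nk bN mL2 H3.
have H5 := outflux_bounds data Nk bN.
pose c := 3 / 8 * (lams / 2 * (muL / 2)).
have c0 : 0 < c by rewrite !mulr_gt0.
exists (`|C| + `|ln 3 - ln c|).
near=> n.
have h0 : 2 * S n <= C + X n by near: n.
have h1 : muL / 2 <= mu i n - M n * ln 2 by near: n.
have h2 : lams / 2 <= lam n by near: n.
have h4 : r N n <= rho i n / 2 by near: n.
have [f0 f3] : 0 < M n /\ M n <= 3 / mu N n by near: n.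
have r2 : 0 < rho i n ^+ 2 by rewrite exprn_gt0.
have th0 : 0 < mu i n - M n * ln 2 by exact: lt_le_trans h1.
have low := neck_flux_ge alpha0 lam0 bet02 u0_gt0 data uP Nk h4 (ltW th0).
rewrite -/(M n) in low.
have fl : muL / 2 <= nonlin alpha (bet n) (mu i n - M n * ln 2).
  apply: le_trans h1 _; rewrite /nonlin ler_peMr ?(ltW th0)//.
  rewrite -expR0 ler_expR addr_ge0 ?sqr_ge0// mulr_ge0 ?powR_ge0 ?(ltW alpha0)//.
have cM : c * rho i n ^+ 2 <= 3 / mu N n.
  apply: le_trans _ f3; apply: le_trans _ low.
  have L2 : 0 <= lams / 2 by rewrite divr_ge0// ltW.
  have cf := ler_pM L2 (ltW mL2) h2 fl.
  by rewrite /c -[3 / 8 * _ * _]mulrA ler_pM2l// ler_pM2r.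
have := ln_le (mulr_gt0 c0 r2) cM.
rewrite lnM ?posrE// lnXn// ln_div ?posrE// -/(X n) mulr2n => h5.
rewrite -/(S n) -/(X n) ler_norml; apply/andP; split.
  have := ler_norm (ln 3 - ln c); have := normr_ge0 C; move: h5; rewrite SE; lra.
have := ler_norm C; have := normr_ge0 (ln 3 - ln c); move: h0; lra.
Unshelve. all: by end_near. Qed.

Variables (c : R) (u0 : R -> R).
Hypotheses (c01 : 0 < c <= 1) (rN_cvg : r N @ \oo --> (0 : R)) (ri_cvg : r i @ \oo --> c)
  (u_cvg : forall s, 0 < s < c -> (fun n => u n s) @ \oo --> u0 s).

(** The influx [P (r N)] tends to [0], and the flux gained up to
    [Num.min (r i) c] converges by dominated convergence.  The remaining piece has
    length at most [`|r i - c|] and bounded density. *)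
Lemma residual_boundary_slope :
  (fun n => derive_in `[r i.-1 n, r i n] (u n) (r i n)) @ \oo -->
  - (1 / c) * lams * Rintegral (@lebesgue_measure R) `[0, c]
     (fun s => nonlin alpha bets (u0 s) * s).
Proof.
have /andP[c0 c1] := c01.
pose a n := r N n; pose b n := r i n; pose e n := Num.min (b n) c.
have a0 n : 0 < a n by exact: (neck_node_gt0 data Nk n).
have ab n : a n < b n by exact: (node_lt data n ik).
have b1 n : b n <= 1 by apply: (node_le1 data n); case/andP: ik.
have um n s : a n <= s <= b n -> `|u n s| <= mu i n.
  by move=> sab; have [_ _ _ /(_ i ik)[_ _ _ [_ [_ H]] _]] := data n; exact: H.
have cu n : {within `[0, 1], continuous (u n)} by have [[]] := uP n.
have [K [K0 HK]] := nonlin_height_bound (ltW alpha0) bet0 bets0 bet_cvg muL_cvg um.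
have I := truncated_integral_cvg (ltW alpha0) c01 bet0 bets0 bet_cvg a0 rN_cvg ri_cvg muL_cvg um
  cu u_cvg.
set J := Rintegral (@lebesgue_measure R) `[0, c] (fun s => nonlin alpha bets (u0 s) * s).
have Pa : (fun n => P n (a n)) @ \oo --> (0 : R).
  have Ma : (fun n => - `|M n|) @ \oo --> (0 : R).
    by rewrite -[X in _ --> X]oppr0 -[X in - X](normr0 R); apply: cvgN; exact: cvg_norm.
  have Mb : (fun n => `|M n|) @ \oo --> (0 : R).
    by rewrite -[X in _ --> X](normr0 R); exact: cvg_norm.
  apply: (squeeze_cvgr _ Ma Mb); apply: nearW => n; rewrite -ler_norml.
  by rewrite /M /outflux normrM normrX normrN1 expr1n mul1r.
have A : \forall n \near \oo, a n < c by exact: (cvgr_lt _ rN_cvg).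
have Pe : (fun n => P n (e n)) @ \oo --> lams * J.
  rewrite -[X in _ --> X]addr0.
  apply: (@cvg_near_eq _ _ (fun n => lam n * Rintegral (@lebesgue_measure R) `[a n, e n]
     (fun s => nonlin alpha (bet n) (u n s) * s) + P n (a n))).
    apply: filterS A => n an.
    have ae : a n <= e n by rewrite le_min (ltW (ab n)) ltW.
    have e1 : e n <= 1 by rewrite ge_min b1.
    by rewrite -(radial_increment (bet0 n) (uP n) (ltW (a0 n)) ae e1) subrK.
  by apply: cvgD => //; exact: cvgM.
have be : (fun n => b n - e n) @ \oo --> (0 : R).
  have Z : (fun=> 0 : R) @ \oo --> (0 : R) by exact: cvg_cst.
  have bc : (fun n => `|b n - c|) @ \oo --> (0 : R).
    rewrite -[X in _ --> X](normr0 R) -(subrr c); apply: cvg_norm.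
    by apply: cvgB => //; exact: cvg_cst.
  apply: (squeeze_cvgr _ Z bc); apply: nearW => n; rewrite /e.
  have [h|h] := ltP (b n) c; first by rewrite subrr lexx normr_ge0.
  by rewrite subr_ge0 h ler_norm.
have Pbe : (fun n => P n (b n) - P n (e n)) @ \oo --> (0 : R).
  have Q1 : (fun n => lam n * K * (b n - e n)) @ \oo --> (0 : R).
    by rewrite -(mulr0 (lams * K)); apply: cvgM => //; exact: cvgMl.
  have Q2 : (fun n => - (lam n * K * (b n - e n))) @ \oo --> (0 : R).
    by rewrite -[X in _ --> X]oppr0; exact: cvgN.
  apply: (squeeze_cvgr _ Q2 Q1); apply: filterS A => n an.
  have ae : a n <= e n by rewrite le_min (ltW (ab n)) ltW.
  have eb : e n <= b n by rewrite ge_min lexx.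
  have [_ pP _] := uP n.
  have e0 : 0 <= e n by rewrite (le_trans (ltW (a0 n))).
  have pP' := prim_sub e0 (b1 n) pP.
  have pid := primZ (lam n * K) (prim_id (e n) (b n)).
  have bd x : e n < x < b n -> `|lam n * nonlin alpha (bet n) (u n x) * x| <= lam n * K.
    move=> /andP[ex xb]; have x0 : 0 < x by exact: le_lt_trans ex.
    rewrite -mulrA normrM (gtr0_norm (lam0 n)) ler_pM2l// normrM (gtr0_norm x0).
    rewrite -[leRHS]mulr1; apply: ler_pM => //; first exact: ltW.
      by apply: HK; rewrite (le_trans ae (ltW ex)) ltW.
    exact: le_trans (ltW xb) (b1 n).
  have l1 := prim_le pP' pid _ (lexx _) eb (lexx _).
  have l2 := prim_le (primZ (-1) pP') pid _ (lexx _) eb (lexx _).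
  apply/andP; split.
    rewrite lerNl mulrBr opprB; move: l2; rewrite !mulN1r opprK addrC; apply.
    by move=> x /bd; rewrite mulr1 ler_norml mulN1r => /andP[]; rewrite lerNl.
  rewrite mulrBr; apply: l1 => x /bd; rewrite mulr1 ler_norml => /andP[_]; exact.
have Pb : (fun n => P n (b n)) @ \oo --> lams * J.
  rewrite -[X in _ --> X]add0r.
  apply: (@cvg_near_eq _ _ (fun n => (P n (b n) - P n (e n)) + P n (e n))).
    by apply: nearW => n; rewrite subrK.
  exact: cvgD.
have -> : - (1 / c) * lams * J = - (lams * J * c^-1) by field; rewrite gt_eqF.
apply: (@cvg_near_eq _ _ (fun n => - (P n (b n) * (b n)^-1))).
  apply: nearW => n.
  exact: (radial_slope (uP n) (ltW (a0 n)) (ab n) (b1 n)).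
by apply: cvgN; apply: cvgM => //; apply: cvgV => //; rewrite gt_eqF.
Qed.

End positive.
End residual_profile.

(** * Assembly *)

Lemma cvg_Cloc_uniform (R : realType) (m : nat) (J : set R) (D : nat -> set R)
    (fn : nat -> R -> R) (f : R -> R) (a b e : R) : `[a, b] `<=` J ->
  cvg_Cloc m J D fn f -> 0 < e ->
  \forall n \near \oo, forall s, a <= s <= b -> `|f s - fn n s| < e.
Proof.
move=> abJ [_ /(_ _ _ abJ)[_ /(_ 0%N (leq0n _)) H]] e0.
have N : nbhs (f : {uniform` `[a, b] -> R})
  [set h | forall s, `[a, b]%classic s -> ball (f s) e (h s)].
  apply/uniform_nbhs; exists [set xy | ball xy.1 e xy.2]; split => //.
  exact: entourage_ball (PosNum e0).
have HN : \forall n \near \oo, forall s, `[a, b]%classic s -> ball (f s) e (fn n s).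
  exact: (H _ N).
by apply: filterS HN => n h s sab; apply: h; rewrite /= in_itv.
Qed.

Section assembly.
Context (R : realType) (alpha : R) (k : nat) (lams bets : R)
    (lam bet : nat -> R) (u P : nat -> R -> R)
    (r rho mu gam : nat -> nat -> R).
Hypotheses (alpha0 : 0 < alpha) (bets02 : 0 < bets < 2)
  (lam0 : forall n, 0 < lam n) (bet02 : forall n, 0 < bet n < 2)
  (lam_cvg : lam @ \oo --> lams) (bet_cvg : bet @ \oo --> bets)
  (u0_gt0 : forall n, 0 < u n 0)
  (data : nodal_data alpha k lam bet u r rho mu gam)
  (uP : forall n, radial_flux (lam n) alpha (bet n) (u n) (P n)).
Variable m : nat.
Hypotheses (mk : (m <= k.+1)%N)
  (bub : forall i, (1 <= i <= m)%N -> bubbled alpha bets lam bet P r rho mu gam i).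

Let mW i : (1 <= i <= m)%N -> (1 <= i <= k.+1)%N.
Proof. by case/andP => -> /leq_trans; apply. Qed.

Lemma bubbled_step j : (1 <= j < m)%N ->
  (\forall n \near \oo, 1 < bet n) /\
  forall l : R, (fun n => ln (1 / lam n) / mu j.+1 n `^ bet n) @ \oo --> l ->
   [/\ (fun n => ln (1 / lam n) / mu j n `^ bet n) @ \oo --> (0 : R),
       (fun n => mu j.+1 n / mu j n `^ (bet n - 1)) @ \oo --> alpha * (1 - bets / 2) &
       (fun n => (2 * ln (1 / rho j.+1 n) - ln (mu j n)) / mu j.+1 n ^+ 2) @ \oo --> (1 : R)].
Proof.
move=> /andP[j0 jm].
have jk : (1 <= j <= k)%N by rewrite j0 -ltnS (leq_trans jm).
have bj : bubbled alpha bets lam bet P r rho mu gam j by apply: bub; rewrite j0 ltnW.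
have bj1 : bubbled alpha bets lam bet P r rho mu gam j.+1 by exact: bub.
split.
  apply: (neck_bet_gt1 alpha0 bets02 lam0 bet02 lam_cvg bet_cvg u0_gt0 data uP jk bj).
  by case: bj1.
move=> l Hl.
have Hl' : exists l0 : R, (fun n => ln (1 / lam n) / mu j.+1 n `^ bet n) @ \oo --> l0 by exists l.
have [h1 h2] := neck_rec_bubble alpha0 bets02 lam0 bet02 lam_cvg bet_cvg u0_gt0 data uP jk bj bj1
  Hl'.
split => //.
exact: (neck_rho_asym alpha0 bets02 lam0 bet02 bet_cvg u0_gt0 data uP jk bj bj1 Hl').
Qed.

Lemma bubbled_slope i : (1 <= i <= m)%N -> \forall n \near \oo,
  `|derive_in `[r i.-1 n, r i n] (u n) (r i n)| = outflux P r i n / r i n.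
Proof.
move=> im; have [_ F _ _] := bub im.
have F0 : \forall n \near \oo, 0 < mu i n * outflux P r i n by exact: (cvgr_gt _ F).
apply: filterS F0 => n; rewrite pmulr_rgt0; last exact: (mu_gt0 data n (mW im)).
move=> M0; rewrite (data_slope data uP n (mW im)).
have r0 : 0 < r i n by case/andP: (mW im) => i0 ik; exact: (node_gt0 data n i0 ik).
by rewrite normrM normrN normrX normrN1 expr1n mul1r gtr0_norm// divr_gt0.
Qed.

End assembly.

Theorem theorem1p6 (R : realType) (alpha : R) (k : nat) (lams bets : R)
    (lam bet : nat -> R) (u : nat -> R -> R) (u0 : R -> R)
    (r rho mu gam : nat -> nat -> R) (t : nat -> R)
    (halpha : 0 < alpha)
    (hlams : 0 <= lams)
    (hbets : 0 < bets < (if k == 0%N then 2 else 3 / 2))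
    (hlam : forall n, 0 < lam n)
    (hbet : forall n, 0 < bet n < 2)
    (hlam_cvg : lam @ \oo --> lams)
    (hbet_cvg : bet @ \oo --> bets)
    (hu : forall n, nodal_sol alpha k (lam n) (bet n) (planar (u n)))
    (hu0 : forall n, 0 < u n 0)
    (hbound : k <> 0%N -> exists M : R, forall n,
       (\int[@leb2 R]_(x in @disk R) (grad_sq (planar (u n)) x)%:E <= M%:E)%E)
    (hweak : weak_cvg_H10 (fun n => planar (u n)) (planar u0))
    (hdata : nodal_data alpha k lam bet u r rho mu gam)
    (ht : J0_zeros t) :
  let A := alpha * (1 - bets / 2) in
  let loglam n := ln (1 / lam n) in
  let du i n := derive_in `[r i.-1 n, r i n] (u n) (r i n) in
  let ratio n := ln (loglam n) / ((bet n - 1) * loglam n `^ (2 / bet n)) in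
  (case_i alpha k lams bets lam bet u u0 r rho mu gam ->
   ((forall n, bet n <= 1) -> k = 0%N) /\
   (fun n => loglam n / mu k.+1 n `^ bet n) @ \oo --> A /\
   (forall i, (1 <= i <= k)%N ->
      (fun n => loglam n / mu i n `^ (bet n * (bet n - 1) ^+ (k - i + 1)))
        @ \oo --> A `^ ((2 - bets * (bets - 1) ^+ (k - i + 1)) / (2 - bets))) /\
   (fun n => loglam n `^ (1 / bet n) * `|du k.+1 n|)
     @ \oo --> 2 * A `^ (1 / bets) /\
   (forall i, (1 <= i <= k)%N ->
      let c := 2 `^ ((bets - 1) ^+ (k - i + 1)) *
               A `^ ((2 - 2 * (bets - 1) ^+ (k - i + 1)) / (2 - bets)) in
      (fun n => loglam n / ln (1 / r i n) `^ ((bet n - 1) ^+ (k - i + 1)))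
        @ \oo --> c /\
      (fun n => loglam n / ln `|du i n| `^ ((bet n - 1) ^+ (k - i + 1)))
        @ \oo --> c) /\
   (forall i, (2 <= i <= k)%N ->
      (fun n => loglam n /
         ln (1 / rho i n) `^ (bet n * (bet n - 1) ^+ (k - i + 1) / 2))
        @ \oo --> 2 `^ (bets * (bets - 1) ^+ (k - i + 1) / 2) *
           A `^ ((2 - bets * (bets - 1) ^+ (k - i + 1)) / (2 - bets))) /\
   ((1 <= k)%N ->
      (forall L : R, 0 <= L -> ratio @ \oo --> L ->
         (fun n => loglam n / ln (1 / rho k.+1 n) `^ (bet n / 2))
           @ \oo --> 2 `^ (bets / 2) * A *
                     (1 + L * A `^ (2 / bets)) `^ (- (bets / 2))) /\
      (ratio @ \oo --> +oo ->
         bets = 1 /\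
         (fun n => ln (loglam n) / ((bet n - 1) * ln (1 / rho k.+1 n)))
           @ \oo --> (2 : R))))
  /\
  (forall (N : nat) (mui ri rhoi : nat -> R),
   case_ii alpha k lams bets lam bet u u0 r rho mu gam t N mui ri rhoi ->
   let q := 2 * mui N.+1 / alpha in
   bets <= 1 /\
   ((forall n, bet n <= 1) -> N = 1%N) /\
   (([/\ 0 < mui N.+1, bets = 1 &
         forall i, (1 <= i <= N)%N ->
           [/\ (fun n => mu i n `^ ((bet n - 1) ^+ (N - i + 1))) @ \oo --> q,
               (fun n => ln (1 / r i n) `^ ((bet n - 1) ^+ (N - i + 1)))
                 @ \oo --> q &
               (fun n => ln `|du i n| `^ ((bet n - 1) ^+ (N - i + 1)))
                 @ \oo --> q]] /\
      (du N.+1 @ \oo -->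
         - (1 / ri N.+1) * lams *
           Rintegral (@lebesgue_measure R) `[0, ri N.+1]
             (fun s => nonlin alpha 1 (u0 s) * s)) /\
      (fun n => rho N.+1 n `^ (bet n - 1))
        @ \oo --> Num.sqrt (alpha / (2 * mui N.+1)) /\
      (1 < q -> \forall n \near \oo, 1 < bet n) /\
      (0 < q < 1 -> \forall n \near \oo, bet n < 1) /\
      ((forall n, 1 < bet n) -> 1 <= q) /\
      ((forall n, bet n = 1) -> q = 1) /\
      ((forall n, bet n < 1) -> q <= 1) /\
      ((1 < N)%N ->
         [/\ (2 <= k)%N, \forall n \near \oo, 1 < bet n, 1 <= q &
             1 < q -> forall i, (2 <= i <= N)%N ->
               (fun n => ln (1 / rho i n) `^ ((bet n - 1) ^+ (N - i + 1)))
                 @ \oo --> q ^+ 2]))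
    \/
    ((forall i, (N.+1 <= i <= k.+1)%N -> mui i = 0) /\
     \forall n \near \oo, bet n < 1))).
Proof.
move=> A loglam du ratio.
have bets02 : 0 < bets < 2.
  by case/andP: hbets => -> /=; case: ifP => // _; lra.
have bets0 : 0 < bets by case/andP: bets02.
have bet0 n : 0 < bet n by case/andP: (hbet n).
have A0 : 0 < A by rewrite mulr_gt0//; case/andP: bets02; lra.
have [P uP] := choice (fun n => radial_system (bet0 n) (hu n)).
have not_gt1 : (forall n, bet n <= 1) -> ~ \forall n \near \oo, 1 < bet n.
  by move=> b1 /filter_ex[n]; rewrite ltNge b1.
have mu0 i n : (1 <= i <= k.+1)%N -> 0 < mu i n by exact: mu_gt0 hdata i n.
have r0 i n : (1 <= i <= k.+1)%N -> 0 < r i n.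
  by case/andP => i0 ik; exact: (node_gt0 hdata n i0 ik).
pose M := outflux P r.
have bubbles m : (m <= k.+1)%N ->
    (forall i, (1 <= i <= m)%N -> condE alpha bets lam bet u r rho mu gam i) ->
    forall i, (1 <= i <= m)%N -> bubbled alpha bets lam bet P r rho mu gam i.
  by move=> mk cE; exact:
    (all_bubbled halpha bets02 hlam hbet hlam_cvg hbet_cvg hu0 hdata uP mk cE).
split.
  move=> [_ cE _ _ _].
  have bub := bubbles _ (leqnn _) cE.
  have mu_oo i : (1 <= i <= k.+1)%N -> mu i @ \oo --> +oo by move=> /bub[].
  have flux i : (1 <= i <= k.+1)%N -> (fun n => mu i n * M i n) @ \oo --> (2 : R).
    by move=> /bub[].
  have logs i : (1 <= i <= k.+1)%N ->
    (fun n => (loglam n + 2 * ln (1 / r i n)) / mu i n `^ bet n) @ \oo --> A.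
    by move=> /bub[].
  have step := bubbled_step halpha bets02 hlam hbet hlam_cvg hbet_cvg hu0 hdata uP (leqnn _) bub.
  have slope := bubbled_slope hdata uP (leqnn _) bub.
  have top : (1 <= k.+1 <= k.+1)%N by rewrite leqnn.
  have r1 n : r k.+1 n = 1 by have [] := hdata n.
  have lam_top : (fun n => loglam n / mu k.+1 n `^ bet n) @ \oo --> A.
    apply: cvg_near_eq (logs _ top); apply: nearW => n.
    by rewrite r1 divr1 ln1 mulr0 addr0.
  split; [|split; [|split; [|split; [|split; [|split]]]]].
  - move=> b1; apply/eqP; rewrite -leqn0 leqNgt; apply/negP => k0.
    have [g1 _] := step k ltac:(by rewrite k0 ltnS leqnn).
    exact: not_gt1 b1 g1.
  - exact: lam_top.
  - exact: (vanishing_height bets02 A0 hbet_cvg mu0 mu_oo step lam_top).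
  - apply: (vanishing_boundary_slope bets02 A0 hbet_cvg mu0 mu_oo flux lam_top).
    by apply: filterS (slope _ top) => n ->; rewrite r1 divr1.
  - move=> i ik c; split.
      exact: (vanishing_node bets02 A0 hbet_cvg mu0 mu_oo logs step lam_top).
    apply: (vanishing_slope bets02 A0 hbet_cvg mu0 r0 mu_oo flux logs step lam_top ik).
    by apply: slope; case/andP: ik => -> /leqW.
  - exact: (vanishing_top bets02 A0 hbet_cvg mu0 mu_oo step lam_top).
  - move=> k1; split.
      exact: (vanishing_last_top bets02 A0 hbet_cvg mu0 mu_oo step lam_top k1).
    exact: (vanishing_last_top_oo bets02 A0 hbet_cvg mu0 mu_oo step lam_top k1).
move=> N mui ri rhoi [[_ Nk] cE [lims [rhoN riN rik rho_lt ri_lt]] [lams_neq0 u_cvg _ _] alt] q.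
have /andP[N0 Nk'] := Nk.
have NW i : (1 <= i <= N)%N -> (1 <= i <= k.+1)%N.
  by case/andP => -> iN; rewrite (leq_trans iN)// leqW.
have Nk1 : (N <= k.+1)%N by exact: leqW.
have bub := bubbles _ Nk1 (fun i iN => (cE i iN).1).
have NN : (1 <= N <= N)%N by rewrite N0 leqnn.
have mu0N i n : (1 <= i <= N)%N -> 0 < mu i n by move=> /NW; exact: mu0.
have r0N i n : (1 <= i <= N)%N -> 0 < r i n by move=> /NW; exact: r0.
have mu_oo i : (1 <= i <= N)%N -> mu i @ \oo --> +oo by move=> /bub[].
have flux i : (1 <= i <= N)%N -> (fun n => mu i n * M i n) @ \oo --> (2 : R).
  by move=> /bub[].
have logs i : (1 <= i <= N)%N ->
  (fun n => (loglam n + 2 * ln (1 / r i n)) / mu i n `^ bet n) @ \oo --> A.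
  by move=> /bub[].
have step := bubbled_step halpha bets02 hlam hbet hlam_cvg hbet_cvg hu0 hdata uP Nk1 bub.
have slope := bubbled_slope hdata uP Nk1 bub.
have lams0 : 0 < lams by rewrite lt_neqAle hlams andbT eq_sym; exact/eqP.
have iN : (N.+1 <= N.+1 <= k.+1)%N by rewrite leqnn.
have [mui_ge0 ri01 _ [mui_cvg ri_cvg rhoi_cvg]] := lims _ iN.
rewrite rhoN in rhoi_cvg.
have lamN := residual_lam bets02 hlam_cvg hbet_cvg (bub _ NN) lams0.
have neckN := residual_neck halpha bets02 hlam hbet hlam_cvg hbet_cvg hu0 hdata uP Nk (bub _ NN)
  lams0 mui_cvg rhoi_cvg.
have mui0n n : 0 < mu N.+1 n by exact: mu0.
have Nbig : (1 < N)%N -> \forall n \near \oo, 1 < bet n.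
  by move=> N1; have [] := step 1%N ltac:(by rewrite N1).
have Ng1 : (forall n, bet n <= 1) -> N = 1%N.
  move=> b1; apply/eqP; rewrite eqn_leq N0 andbT leqNgt; apply/negP => /Nbig.
  exact: not_gt1.
case: alt => [[muL0 _]|[muL0 u00 _ _]]; last first.
  have b1 : \forall n \near \oo, bet n < 1 by exact:
    (residual_small N0 A0 mu0N mu_oo mui0n mui_cvg neckN muL0).
  split; first exact: (residual_bets_le1 N0 A0 hbet_cvg mu0N mu_oo mui0n mui_cvg neckN muL0).
  split => //; right; split => // i /andP[].
  rewrite leq_eqVlt => /predU1P[<-//|]; case: i => // i; rewrite !ltnS => Ni ik.
  have ik' : (N.+1 <= i <= k)%N by rewrite Ni.
  have [_ _ _ [mc _ rc]] := lims i.+1 ltac:(by rewrite ltnS (ltnW Ni)).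
  have rp : 0 < rhoi i.+1.
    apply: lt_trans (ri_lt _ ik').
    by have [_ /andP[ri0 _] _ _] := lims i ltac:(by rewrite Ni leqW).
  (* The maximum points of the outer intervals stay away from the centre, and there
     the solutions tend to [0] uniformly. *)
  have mc0 : mu i.+1 @ \oo --> (0 : R).
    apply/cvgrPdist_lt => e e0.
    have sub : `[rhoi i.+1 / 2, 1] `<=` `]0, 1].
      by apply: subset_itv; rewrite bnd_simp// divr_gt0.
    have H := cvg_Cloc_uniform sub u_cvg e0.
    have Hr : \forall n \near \oo, rhoi i.+1 / 2 < rho i.+1 n.
      by apply: (cvgr_gt _ rc); move: rp; lra.
    near=> n.
    have i1k : (1 <= i.+1 <= k.+1)%N by [].
    have h : forall s, rhoi i.+1 / 2 <= s <= 1 -> `|u0 s - u n s| < e by near: n.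
    have hr : rhoi i.+1 / 2 < rho i.+1 n by near: n.
    have rho1 : rho i.+1 n <= 1.
      have /andP[_ rb] := rho_itv hdata n i1k.
      by apply: le_trans (ltW rb) _; apply: (node_le1 hdata n); case/andP: i1k.
    have [_ _ _ /(_ _ i1k)[_ _ _ [_ [muE _]] _]] := hdata n.
    have := h (rho i.+1 n); rewrite (ltW hr) rho1 => /(_ isT).
    rewrite u00 ?rho1 ?andbT; last by rewrite (lt_trans _ hr)// divr_gt0.
    by rewrite !sub0r !normrN muE normr_id.
  exact: (cvg_unique _ mc mc0).
have b1 := residual_bets N0 A0 hbet_cvg mu0N mu_oo mui_cvg neckN muL0.
(* For [bets = 1] the constant [A] is [alpha / 2]. *)
have qE : q = mui N.+1 / A by rewrite /q /A b1; field; rewrite gt_eqF.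
have q0 : 0 < q by rewrite divr_gt0// mulr_gt0.
rewrite -/A in neckN.
have ge1 : (\forall n \near \oo, 1 <= bet n) -> 1 <= q.
  by rewrite qE; exact: (residual_ge1 N0 A0 mu0N mu_oo mui_cvg neckN muL0).
have le1 : (\forall n \near \oo, bet n <= 1) -> q <= 1.
  by rewrite qE; exact: (residual_le1 N0 A0 mu0N mu_oo mui_cvg neckN muL0).
split; first by rewrite b1.
split => //; left.
split; [|split; [|split; [|split; [|split; [|split; [|split; [|split]]]]]]].
- split => // i im; rewrite qE; split.
  + exact: (residual_height N0 A0 mu0N mu_oo step lamN mui_cvg neckN muL0).
  + exact: (residual_node N0 bets02 A0 hbet_cvg mu0N mu_oo logs step lamN mui_cvg neckN muL0).
  + apply: (residual_slope N0 bets02 A0 hbet_cvg mu0N r0N mu_oo flux logs step lamN mui_cvg neckN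
    muL0 im).
    exact: slope.
- have Js s : 0 < s < ri N.+1 -> (fun n => u n s) @ \oo --> u0 s.
    move=> /andP[s0 s1].
    have s01 : (`]0, 1]%classic : set R) s.
      rewrite /= in_itv/= s0; apply: le_trans (ltW s1) _; by case/andP: ri01.
    by have [_] := cvg_Cloc_pointwise s01 u_cvg.
  have rN0 : r N @ \oo --> (0 : R) by have [] := cE N NN.
  have := residual_boundary_slope halpha bets02 hlam hbet hlam_cvg hbet_cvg hdata uP Nk (bub _ NN)
    mui_cvg ri01 rN0 ri_cvg Js.
  by rewrite b1.
- have -> : alpha / (2 * mui N.+1) = (mui N.+1 / A)^-1.
    by rewrite -qE /q invf_div.
  apply: (residual_rho N0 A0 mu0N mu_oo mui_cvg neckN muL0).
    exact: (neck_rho_gt0 hdata Nk).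
  exact: (residual_rho_log halpha bets02 hlam hbet hlam_cvg hbet_cvg hu0 hdata uP Nk (bub _ NN)
    lams0 mui_cvg muL0).
- by rewrite qE; exact: (residual_bet_gt1 N0 A0 mu0N mu_oo mui_cvg neckN muL0).
- by move=> /andP[_]; rewrite qE; exact: (residual_bet_lt1 N0 A0 mu0N mu_oo mui_cvg neckN muL0).
- by move=> H; apply: ge1; apply: nearW => n; rewrite ltW.
- move=> H; apply/le_anti; rewrite le1 ?ge1//; apply: nearW => n; by rewrite H.
- by move=> H; apply: le1; apply: nearW => n; rewrite ltW.
- move=> N1; split.
  + exact: leq_trans N1 Nk'.
  + exact: Nbig.
  + by apply: ge1; apply: filterS (Nbig N1) => n /ltW.
  + move=> q1 i iN2; rewrite qE in q1 *.
    exact: (residual_top N0 A0 mu0N mu_oo step lamN mui_cvg neckN muL0 q1 iN2).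
Unshelve. all: by end_near. Qed.
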